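(* Let $\mathbb{K}=\mathbb{Q}(y_1,\dots,y_u)(\beta)$, where $y_1,\dots,y_u$ are indeterminates and $\beta$ is algebraic over $\mathbb{Q}(y_1,\dots,y_u)$, and let $\mathbb{F}$ be an algebraic closure of $\mathbb{K}$. Let $\alpha\in\mathbb{F}$ be algebraic of degree $n$ over $\mathbb{K}$. Let $\mathcal{C}\subseteq\mathbb{F}^N$ be a rational curve that is defined over $\mathbb{K}$ but is not parametrizable over $\mathbb{K}$, and suppose $\mathcal{C}$ is given by a birational parametrization $\phi$ with coefficients in $\mathbb{K}(\alpha)$. Let $\mathcal{U}$ be the one-dimensional component of the $\alpha$-witness variety of $\mathcal{C}$ (with respect to $\phi$) for the extension $\mathbb{K}\subseteq\mathbb{K}(\alpha)$. Then there are infinitely many elements $\eta$, quadratic over $\mathbb{K}$, such that $\mathcal{U}$ is an $\alpha$-hypercircle with respect to the algebraic extension $\mathbb{K}(\eta)\subseteq\mathbb{K}(\eta,\alpha)$.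
   Context: Fields of definition and parametrization: $\mathcal{C}$ is defined over a field $\mathbb{L}\subseteq\mathbb{F}$ if its ideal in $\mathbb{F}[x_1,\dots,x_N]$ is generated by polynomials with coefficients in $\mathbb{L}$; it is parametrizable over $\mathbb{L}$ if it has a birational parametrization with components in $\mathbb{L}(t)$ (with inverse also defined over $\mathbb{L}$). Witness variety: let $\phi=(\phi_1,\dots,\phi_N)$, $\phi_j\in\mathbb{K}(\alpha)(t)$, be the birational parametrization of $\mathcal{C}$, written as $\phi_j=f_j/g$ with $\gcd(f_1,\dots,f_N,g)=1$. Let $t_0,\dots,t_{n-1}$ be new variables and write $$\phi_j\Big(\sum_{i=0}^{n-1}\alpha^i t_i\Big)=\sum_{i=0}^{n-1}\alpha^i\psi_{ij}(t_0,\dots,t_{n-1}),\qquad \psi_{ij}=\frac{F_{ij}}{\delta}\in\mathbb{K}(t_0,\dots,t_{n-1}),$$ with $F_{ij},\delta\in\mathbb{K}[t_0,\dots,t_{n-1}]$ having no common factor (common denominator $\delta$ in lowest terms). The $\alpha$-witness variety of $\phi$ for $\mathbb{K}\subseteq\mathbb{K}(\alpha)$ is the Zariski closure $\mathcal{Z}\subseteq\mathbb{F}^n$ of $\{F_{ij}=0 \mid 1\le i\le n-1,\ 1\le j\le N\}\setminus\{\delta=0\}$. It is known that $\dim\mathcal{Z}\le 1$, that $\mathcal{Z}$ has at most one one-dimensional component, and that $\mathbb{K}$ is a field of definition of $\mathcal{C}$ if and only if $\dim\mathcal{Z}=1$. Hypercircle: let $\mathbb{L}\subseteq\mathbb{F}$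 be a field and $\alpha$ algebraic of degree $m$ over $\mathbb{L}$. Given $\frac{at+b}{ct+d}\in\mathbb{L}(\alpha)(t)$ with $a,b,c,d\in\mathbb{L}(\alpha)$, $ad-bc\ne0$, write $\frac{at+b}{ct+d}=\psi_0(t)+\alpha\psi_1(t)+\dots+\alpha^{m-1}\psi_{m-1}(t)$ with $\psi_i\in\mathbb{L}(t)$. The $\alpha$-hypercircle associated to $\frac{at+b}{ct+d}$ for the extension $\mathbb{L}\subseteq\mathbb{L}(\alpha)$ is the curve in $\mathbb{F}^m$ parametrized by $(\psi_0,\dots,\psi_{m-1})$ (Zariski closure of the image). A curve is an $\alpha$-hypercircle for $\mathbb{L}\subseteq\mathbb{L}(\alpha)$ if it is associated to some such linear fraction. *)

(* Defs.v *)
From HB Require Import structures.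
From mathcomp Require Import all_boot all_order all_algebra.
From mathcomp Require Import mpoly.

Set Implicit Arguments.
Unset Strict Implicit.
Unset Printing Implicit Defensive.

Import GRing.Theory.
Local Open Scope ring_scope.

Notation "x %:F" := (tofrac x) : ring_scope.

(* Subfields of the ambient field F are Prop-valued predicates on F; points of
   affine space F^n are row vectors, and their coordinates are x 0 j. *)

Definition is_subfield (F : fieldType) (L : F -> Prop) : Prop :=
  [/\ L 1, forall x y, L x -> L y -> L (x - y)
    & forall x y, L x -> L y -> L (x / y)].

Definition adjoin (F : fieldType) (L : F -> Prop) (a : F) : F -> Prop :=
  fun x => forall M : F -> Prop,
    is_subfield M -> (forall z, L z -> M z) -> M a -> M x.

Definition poly_over (F : fieldType) (L : F -> Prop) (p : {poly F}) : Prop :=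
  forall i, L p`_i.

Definition mpoly_over (F : fieldType) (L : F -> Prop) (n : nat)
    (p : {mpoly F[n]}) : Prop :=
  forall m, L p@_m.

Definition ratfun_over (F : fieldType) (L : F -> Prop)
    (r : {fraction {poly F}}) : Prop :=
  exists p q : {poly F},
    [/\ poly_over L p, poly_over L q, q != 0 & r = p%:F / q%:F].

Definition algebraic_over (F : fieldType) (L : F -> Prop) (a : F) : Prop :=
  exists p : {poly F}, [/\ poly_over L p, p != 0 & root p a].

Definition algebraic_of_degree (F : fieldType) (L : F -> Prop) (a : F)
    (d : nat) : Prop :=
  (exists p : {poly F}, [/\ poly_over L p, size p = d.+1 & root p a])
  /\ (forall q : {poly F}, poly_over L q -> q != 0 -> root q a ->
        (d < size q)%N).

Definition affset (F : fieldType) (n : nat) := 'rV[F]_n -> Prop.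

Definition sub_affset (F : fieldType) (n : nat) (A B : affset F n) : Prop :=
  forall x, A x -> B x.

Definition eq_affset (F : fieldType) (n : nat) (A B : affset F n) : Prop :=
  forall x, A x <-> B x.

Definition vanishes_on (F : fieldType) (n : nat) (A : affset F n)
    (p : {mpoly F[n]}) : Prop :=
  forall x, A x -> p.@[x 0] = 0.

Definition zariski_closure (F : fieldType) (n : nat) (A : affset F n) :
    affset F n :=
  fun x => forall p, vanishes_on A p -> p.@[x 0] = 0.

Definition zariski_closed (F : fieldType) (n : nat) (A : affset F n) : Prop :=
  exists G : {mpoly F[n]} -> Prop,
    forall x, A x <-> (forall p, G p -> p.@[x 0] = 0).

Definition irreducible_closed (F : fieldType) (n : nat) (A : affset F n) :
    Prop :=
  [/\ zariski_closed A, exists x, A x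
    & forall B C : affset F n, zariski_closed B -> zariski_closed C ->
        (forall x, A x -> B x \/ C x) -> sub_affset A B \/ sub_affset A C].

Definition krull_dim_ge (F : fieldType) (n : nat) (A : affset F n) (d : nat) :
    Prop :=
  exists c : nat -> affset F n,
    (forall i, (i <= d)%N -> irreducible_closed (c i) /\ sub_affset (c i) A)
    /\ (forall i, (i < d)%N ->
          sub_affset (c i) (c i.+1) /\ ~ sub_affset (c i.+1) (c i)).

Definition krull_dim (F : fieldType) (n : nat) (A : affset F n) (d : nat) :
    Prop :=
  krull_dim_ge A d /\ ~ krull_dim_ge A d.+1.

Definition irreducible_component (F : fieldType) (n : nat)
    (A U : affset F n) : Prop :=
  [/\ irreducible_closed U, sub_affset U A
    & forall V : affset F n, irreducible_closed V -> sub_affset V A ->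
        sub_affset U V -> sub_affset V U].

Definition is_curve (F : fieldType) (n : nat) (A : affset F n) : Prop :=
  irreducible_closed A /\ krull_dim A 1.

Definition in_ideal (F : fieldType) (n : nat) (G : {mpoly F[n]} -> Prop)
    (p : {mpoly F[n]}) : Prop :=
  exists2 s : seq ({mpoly F[n]} * {mpoly F[n]}),
    forall cg, cg \in s -> G cg.2 & p = \sum_(cg <- s) cg.1 * cg.2.

Definition defined_over (F : fieldType) (L : F -> Prop) (n : nat)
    (A : affset F n) : Prop :=
  exists2 G : {mpoly F[n]} -> Prop,
    forall g, G g -> mpoly_over L g
    & forall p, vanishes_on A p <-> in_ideal G p.

(* r(s) = v, for r in F(t) and s, v in a field E containing F through e; as
   soon as one fraction p / q representing r has q(s) != 0, the value v is
   independent of the choice of such a fraction. *)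
Definition ratfun_value (F E : fieldType) (e : F -> E)
    (r : {fraction {poly F}}) (s v : E) : Prop :=
  exists p q : {poly F},
    [/\ r = p%:F / q%:F, (map_poly e q).[s] != 0
      & v = (map_poly e p).[s] / (map_poly e q).[s]].

Definition param_point (F : fieldType) (N : nat)
    (phi : 'I_N -> {fraction {poly F}}) (t : F) (x : 'rV[F]_N) : Prop :=
  forall j, ratfun_value id (phi j) t (x 0 j).

Definition param_closure (F : fieldType) (N : nat)
    (phi : 'I_N -> {fraction {poly F}}) : affset F N :=
  zariski_closure (fun x => exists t, param_point phi t x).

(* p(phi(t)) in F(t). *)
Definition mpoly_at_param (F : fieldType) (N : nat) (p : {mpoly F[N]})
    (phi : 'I_N -> {fraction {poly F}}) : {fraction {poly F}} :=
  mmap (fun c : F => c%:P%:F) phi p.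

(* phi sends the affine line dominantly to A, and p / q, with coefficients in
   L, is its inverse: both composites are the identity where they are defined.
   The components of phi are not constrained to lie in L(t) here. *)
Definition birational_param (F : fieldType) (L : F -> Prop) (N : nat)
    (A : affset F N) (phi : 'I_N -> {fraction {poly F}}) : Prop :=
  eq_affset A (param_closure phi)
  /\ exists p q : {mpoly F[N]},
       [/\ mpoly_over L p /\ mpoly_over L q,
           mpoly_at_param q phi != 0,
           mpoly_at_param p phi / mpoly_at_param q phi = ('X)%:F
         & forall x y : 'rV[F]_N, A x -> q.@[x 0] != 0 ->
             param_point phi (p.@[x 0] / q.@[x 0]) y -> y = x].

Definition parametrizable (F : fieldType) (L : F -> Prop) (N : nat)
    (A : affset F N) : Prop :=
  exists2 phi : 'I_N -> {fraction {poly F}},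
    forall j, ratfun_over L (phi j) & birational_param L A phi.

Definition mpoly_frac_const (F : fieldType) (n : nat) (c : F) :
    {fraction {mpoly F[n]}} :=
  (c%:MP_[n])%:F.

(* f i j / delta are the coefficients psi_ij, in lowest terms over K, of the
   expansion of phi_j (\sum_i alpha^i t_i) in powers of alpha. *)
Definition witness_data (F : fieldType) (K : F -> Prop) (alpha : F)
    (n N : nat) (phi : 'I_N -> {fraction {poly F}})
    (f : 'I_n -> 'I_N -> {mpoly F[n]}) (delta : {mpoly F[n]}) : Prop :=
  [/\ (forall i j, mpoly_over K (f i j)) /\ mpoly_over K delta,
      delta != 0,
      forall h : {mpoly F[n]}, mpoly_over K h ->
        (exists k, delta = k * h) -> (forall i j, exists k, f i j = k * h) ->
        exists c : F, h = c%:MP_[n]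
    & forall j,
        ratfun_value (@mpoly_frac_const F n) (phi j)
          (\sum_(i < n) alpha ^+ i *: 'X_i)%:F
          (\sum_(i < n) mpoly_frac_const n (alpha ^+ i)
                          * ((f i j)%:F / delta%:F))].

(* witness_data determines f and delta up to a common nonzero factor in K, so
   that the set below does not depend on them. *)
Definition witness_variety (F : fieldType) (K : F -> Prop) (alpha : F)
    (n N : nat) (phi : 'I_N -> {fraction {poly F}}) : affset F n :=
  fun x => exists (f : 'I_n -> 'I_N -> {mpoly F[n]}) (delta : {mpoly F[n]}),
    witness_data K alpha phi f delta
    /\ zariski_closure
         (fun z => (forall (i : 'I_n) j, (0 < i)%N -> (f i j).@[z 0] = 0)
                   /\ delta.@[z 0] != 0) x.

(* The dimension m of the ambient space of an alpha-hypercircle for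
   L <= L(alpha) is the degree of alpha over L. *)
Definition hypercircle (F : fieldType) (L : F -> Prop) (alpha : F) (m : nat)
    (A : affset F m) : Prop :=
  algebraic_of_degree L alpha m
  /\ exists (a b c d : F) (psi : 'I_m -> {fraction {poly F}}),
       [/\ [/\ adjoin L alpha a, adjoin L alpha b, adjoin L alpha c
             & adjoin L alpha d],
           a * d - b * c != 0,
           forall i, ratfun_over L (psi i),
           (a *: 'X + b%:P)%:F / (c *: 'X + d%:P)%:F
             = \sum_(i < m) (alpha ^+ i)%:P%:F * psi i
         & eq_affset A (param_closure psi)].

(* Main.v *)
Require Import Defs.
From HB Require Import structures.
From mathcomp Require Import all_boot all_order all_algebra all_field.
From mathcomp Require Import mpoly perm ring zify.
From Stdlib Require Import Classical ClassicalEpsilon.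

Set Implicit Arguments.
Unset Strict Implicit.
Unset Printing Implicit Defensive.

Import GRing.Theory.
Local Open Scope ring_scope.

(* Let L = K(alpha), let t be the parameter of phi, and work inside F(t). Since the curve is
   defined over K, the fields F and K(phi) are linearly disjoint over K, so t lies in
   K(phi)(alpha) and has conjugates t_z, one for each conjugate z of alpha; each t_z is a
   Moebius function of t. Interpolating the conjugates of (d phi_j / dt) t^i for i <= 2, where
   phi_j is not constant, gives elements of K(phi) inside f' F[t]_(<= 2), with
   f' = d phi_j / dt: this is the space of sections of the anticanonical bundle, with its
   K-structure. Three independent sections have six products in a space of dimension five,
   hence satisfy a quadratic relation over K. This conic model of the curve can be normalised
   to g0^2 = b g1^2 + 2 c g1 g2 + d g2^2 with c^2 <> b d.

   For a suitable s in K the value e = b + 2 c s + d s^2 is not a square in L: only finitely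
   many square classes of K become trivial in L, so a norm down to Q(y_1, ..., y_u), a
   specialization of the y_i and finally a prime dividing the value of an integer polynomial
   exactly once produce such an s. With eta^2 = e the conic acquires a point over
   K' = K(eta), and projecting from it yields a parameter w in K'(phi) such that phi_j = r_j(w)
   with r_j over K', while w = M(t) for a Moebius transformation M over K'(alpha). The expansion
   psi of the inverse of M along the powers of alpha is a hypercircle.

   The numerators F_ij (i > 0) vanish on psi because phi_j(M^-1) = r_j has no component along
   alpha^i. Conversely a point x of the witness set has coordinates t_z = sum_i z^i x_i with
   phi_j^z(t_z) independent of z; inverting the parametrization recovers s such that
   t_z = (M^z)^-1 (s) for all z, that is x = psi(s), unless every t_z is a root of a fixed
   nonzero polynomial. An irreducible component of dimension one is not contained in that
   finite exceptional set, so it is the closure of psi. Replacing eta by its multiples by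
   positive integers gives infinitely many choices. *)

(** * Specialization of square classes *)

Section PrimeValues.
Import Num.Theory.

(** A hypercircle for [K(eta)] can only lie in [F^n] if [alpha] keeps its degree [n] over [K(eta)].
    Hence [eta] must avoid the whole field [K(alpha)]: a nonsquare of [K] would not suffice. The
    inequality [c^2 <> b d] makes [b + 2 c s + d s^2] separable in [s], and separability is what
    produces a prime that divides a value exactly once.

    Linear disjointness is used in two ways. It preserves the minimal polynomial of [alpha] when [K]
    is enlarged to [K(phi)] or [K] to [K(t)], so conjugation can be defined by replacing [alpha] by
    another root [z] in a polynomial expression; no automorphism of [F] is extended. It also lowers
    coefficients: a linear relation with coefficients in [F] between elements of the disjoint field
    yields one over the base field, and a second linear combination that was nonzero can be kept
    nonzero. The conic, the coefficients of the Moebius map and the functions [r_j] are all first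
    obtained over [F] and then lowered in this way. *)

Lemma poly_nat_nonroot (R : idomainType) (p : {poly R}) :
  injective (fun n : nat => n%:R : R) -> p != 0 -> exists n : nat, p.[n%:R] != 0.
Proof.
move=> inj p0; apply: NNPP => nex.
have := @max_poly_roots _ p [seq n%:R | n <- iota 0 (size p)] p0.
rewrite size_map size_iota ltnn map_inj_uniq // iota_uniq => H.
have // : false; apply: H => //.
apply/allP => _ /mapP [n _ ->]; rewrite rootE.
by apply/negPn/negP => H; apply: nex; exists n.
Qed.

Lemma horner_sub_dvd (p : {poly int}) (x y : int) : exists q, p.[x] - p.[y] = (x - y) * q.
Proof.
have /factor_theorem [q Hq] : root (p - p.[y]%:P) y.
  by rewrite rootE !hornerE subrr.
exists q.[x]; have := congr1 (fun z => z.[x]) Hq; rewrite !hornerE => ->.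
by rewrite mulrC.
Qed.

(** First-order Taylor expansion: the quotient of [p - p(x)] by [X - x] takes the value [p'(x)] at
    [x], and its value changes by a multiple of [y] from [x] to [x + y]. *)
Lemma horner_add_mod_sqr (p : {poly int}) (x y : int) :
  exists q, p.[x + y] = p.[x] + p^`().[x] * y + y ^+ 2 * q.
Proof.
have /factor_theorem [q Hq] : root (p - p.[x]%:P) x by rewrite rootE !hornerE subrr.
have Dp : p = q * ('X - x%:P) + p.[x]%:P by rewrite -Hq subrK.
have [r Hr] := horner_sub_dvd q (x + y) x.
exists r; rewrite {1}Dp [in p^`()]Dp derivD derivM derivB derivX !derivC !hornerE.
have -> : q.[x+y] = q.[x] + (x + y - x) * r by rewrite -Hr; ring.
ring.
Qed.

Lemma logn_eq1 (p : nat) (m : int) :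
  prime p -> (p%:Z %| m)%Z -> ~~ ((p ^ 2)%N%:Z %| m)%Z -> logn p `|m|%N = 1%N.
Proof.
move=> pp; have [->|m0] := eqVneq m 0; first by rewrite !dvdz0.
rewrite /dvdz /= !unfold_in /= -[X in (X %| _)%N -> _](expn1 p) !pfactor_dvdn ?absz_gt0 //.
by case: (logn _ _) => [|[|]].
Qed.

(** Euclid's argument along the progression [x0 + c M x] with [c = h(x0)] and [M = r e]: there
    [h = c w] with [w] congruent to 1 modulo [M], so a prime factor [p] of [w] divides neither [e]
    nor [r]. By the Bezout relation [p] cannot divide [h'] as well as [h]. If [p^2] divides [h(y)],
    then [h(y + p)] has valuation exactly one. *)
Lemma int_poly_prime_once (h u v : {poly int}) (r e : int) :
  u * h + v * h^`() = r%:P -> r != 0 -> e != 0 -> (1 < size h)%N ->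
  exists (x : int) (p : nat), [/\ prime p, logn p `|h.[x]|%N = 1%N & ~~ (p%:Z %| e)%Z].
Proof.
move=> Bez r0 e0 sh.
have injZ : injective (fun n : nat => n%:R : int).
  by move=> a b /eqP; rewrite eqr_nat => /eqP.
have h0 : h != 0 by rewrite -size_poly_gt0 ltnW.
have [x0 cn0] := poly_nat_nonroot injZ h0.
set c := h.[x0%:R] in cn0; pose M := r * e.
have M0 : M != 0 by rewrite mulf_neq0.
pose H := h \Po (x0%:R%:P + (c * M) *: 'X).
have sl : size (x0%:R%:P + (c * M) *: 'X : {poly int}) = 2%N.
  rewrite addrC size_addl ?size_scale ?mulf_neq0 // size_polyX //.
  by rewrite (leq_ltn_trans (size_polyC_leq1 _)).
have sH : (1 < size H)%N by rewrite size_comp_poly2 // sl.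
have H0 : H != 0 by rewrite -size_poly_gt0 ltnW.
(* A point where this product is nonzero excludes [w = 1], [w = -1] and [w = 0], so that [w] has a
   prime factor. *)
have g0 : (H ^+ 2 - (c ^+ 2)%:P) * H != 0.
  rewrite mulf_neq0 // subr_eq0; apply: contraTneq sH => E.
  have := congr1 (fun p : {poly int} => size p) E.
  rewrite expr2 size_mul // size_polyC expf_neq0 //=; case: (size H) => [|[|k]] //=.
  by rewrite addnS.
have [x] := poly_nat_nonroot injZ g0.
rewrite hornerM hornerD horner_exp hornerN hornerC mulf_eq0 negb_or => /andP [].
pose y := x0%:R + c * M * x%:R.
have -> : H.[x%:R] = h.[y] by rewrite horner_comp hornerD hornerC hornerZ hornerX.
move=> Hne Hy0.
have [q Hq] := horner_sub_dvd h y x0%:R; rewrite -/c in Hq.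
pose w := 1 + M * x%:R * q.
have Hw : h.[y] = c * w.
  have -> : h.[y] = c + (y - x0%:R) * q by rewrite -Hq; ring.
  rewrite /w /y. ring.
have w1 : (1 < `|w|)%N.
  have : (`|w| != 1)%N.
    apply: contraNneq Hne => E; rewrite Hw exprMn.
    have -> : w ^+ 2 = 1 by move: E; case: (w) => [[|[|k]]|[|k]].
    by rewrite mulr1 subrr.
  have : (`|w| != 0)%N by rewrite absz_eq0; apply: contraNneq Hy0 => E; rewrite Hw E mulr0.
  by case: `|w|%N => [|[|]].
pose p := pdiv `|w|; have pp : prime p by apply: pdiv_prime.
have pw : (p%:Z %| w)%Z by rewrite /dvdz unfold_in /= pdiv_dvd.
have pM : ~~ (p%:Z %| M)%Z.
  apply: contraL pw => pM; rewrite /w rpredDr; last by rewrite -mulrA dvdz_mulr.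
  by rewrite /dvdz unfold_in /= dvdn1; apply: contraTneq pp => ->.
have ph : (p%:Z %| h.[y])%Z by rewrite Hw dvdz_mull.
have pe : ~~ (p%:Z %| e)%Z by apply: contra pM => /dvdz_mull; apply.
have pd : ~~ (p%:Z %| h^`().[y])%Z.
  apply: contra pM => pd; rewrite dvdz_mulr //.
  have := congr1 (fun z => z.[y]) Bez; rewrite !hornerE => <-.
  by rewrite rpredD // dvdz_mull.
case: (boolP ((p ^ 2)%N%:Z %| h.[y])%Z) => p2; last first.
  by exists y, p; split=> //; apply: logn_eq1.
exists (y + p%:Z), p; split=> //; have [z ->] := horner_add_mod_sqr h y p%:Z.
have pp2 : (p ^ 2)%N%:Z = p%:Z ^+ 2 by rewrite PoszM expr2.
apply: logn_eq1 => //.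
  apply: rpredD; first by rewrite rpredD // dvdz_mull ?dvdzz.
  by rewrite expr2 -mulrA dvdz_mulr ?dvdzz.
rewrite rpredDr ?rpredDl // pp2; last by rewrite dvdz_mulr ?dvdzz.
rewrite expr2 dvdz_mul2r //.
by rewrite -absz_eq0 /= -lt0n prime_gt0.
Qed.
End PrimeValues.

Section RationalSquareClasses.
Import Num.Theory.

Local Notation pZtoQ := (map_poly (intr : int -> rat)).

(** The prime dividing the value exactly once is chosen away from all numerators and denominators of
    [es]. The value then has odd valuation there, whereas [e * y ^+ 2] has even valuation. *)
Lemma rat_poly_avoids_square_classes (h : {poly rat}) (es : seq rat) :
  coprimep h h^`() -> (1 < size h)%N -> (forall e, e \in es -> e != 0) ->
  exists x : int, h.[x%:~R] != 0 /\ forall e y, e \in es -> h.[x%:~R] <> e * y ^+ 2.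
Proof.
move=> cop sh es0.
have [q [a a0 Dh]] := rat_poly_scale h.
have aQ : a%:~R != 0 :> rat by rewrite intr_eq0.
(* [q] is [a h]; one more factor [a] gives [a^2 h], an integer polynomial whose values lie in the
   same square classes as those of [h]. *)
pose q1 := a *: q.
have Dq1 : pZtoQ q1 = (a%:~R ^+ 2) *: h.
  by rewrite /q1 map_polyZ Dh scalerA expr2 mulrK ?unitfE.
have sq1 : (1 < size q1)%N.
  by rewrite -size_rat_int_poly Dq1 size_scale // expf_neq0.
have /Bezout_coprimepP [[u v] /= /eqpP[[c1 c2] /= /andP[c10 c20] Buv]] := cop.
have [U [au au0 Du]] := rat_poly_scale u; have [V [av av0 Dv]] := rat_poly_scale v.
have auQ : au%:~R != 0 :> rat by rewrite intr_eq0.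
have avQ : av%:~R != 0 :> rat by rewrite intr_eq0.
have [r0 [r B]] : exists r : rat, r != 0 /\
   pZtoQ ((av *: U) * q1 + (au *: V) * q1^`()) = r%:P.
  exists (au%:~R * av%:~R * (a%:~R ^+ 2) * (c2 / c1)); split.
    by rewrite !mulf_neq0 ?expf_neq0 ?invr_eq0.
  have E : u * h + v * h^`() = (c2 / c1)%:P.
    apply: (scalerI c10); rewrite Buv -[1]/(1%:P) -!mul_polyC -!polyCM mulr1.
    by rewrite mulrCA mulfV ?mulr1.
  rewrite rmorphD !rmorphM /= -deriv_map /= Dq1 derivZ !map_polyZ /=.
  have -> : pZtoQ U = au%:~R *: u by rewrite Du scalerA mulfV ?scale1r.
  have -> : pZtoQ V = av%:~R *: v by rewrite Dv scalerA mulfV ?scale1r.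
  rewrite -[_ * (c1^-1)%:P]polyCM -E -!mul_polyC ?polyCM; ring.
set W := (X in pZtoQ X) in B.
have W0 : W = (W`_0)%:P.
  apply: size1_polyC; rewrite -size_rat_int_poly B; exact: size_polyC_leq1.
have w0 : W`_0 != 0.
  apply: contraNneq r => E0; move: B; rewrite W0 E0 polyC0 rmorph0 => /eqP.
  by rewrite eq_sym polyC_eq0.
pose E := \prod_(e <- es) (numq e * denq e).
have E0 : E != 0.
  rewrite prodf_seq_neq0; apply/allP => e /es0 e0 /=.
  by rewrite mulf_neq0 ?denq_neq0 // numq_eq0.
have [x [p [pp lp pE]]] := int_poly_prime_once W0 w0 E0 sq1.
have hx : q1.[x]%:~R = a%:~R ^+ 2 * h.[x%:~R] :> rat.
  by rewrite -hornerZ -Dq1 horner_map.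
have q1x0 : q1.[x] != 0 by apply: contraPneq lp => ->; rewrite logn0.
exists x; split.
  by apply: contraNneq q1x0 => H; rewrite -(intr_eq0 rat) hx H mulr0.
move=> e y ein H.
have eE : ~~ (p%:Z %| numq e * denq e)%Z.
  apply: contra pE => H1; rewrite /E (big_rem e) //=.
  by rewrite dvdz_mulr.
move: hx; rewrite H -[e]divq_num_den -[y]divq_num_den.
set n := numq e; set d := denq e; set s := numq y; set t := denq y.
have d0 : d%:~R != 0 :> rat by rewrite intr_eq0 denq_neq0.
have t0 : t%:~R != 0 :> rat by rewrite intr_eq0 denq_neq0.
move=> EQ.
have : (q1.[x] * d * t ^+ 2)%:~R = ((a * s) ^+ 2 * n)%:~R :> rat.
  rewrite !rmorphM /= EQ; field.
  by rewrite d0 t0.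
move/intr_inj => EZ.
have tn : t != 0 by rewrite denq_neq0.
have dn : d != 0 by rewrite denq_neq0.
have L0 : q1.[x] * d * t ^+ 2 != 0 by rewrite !mulf_neq0 ?expf_neq0.
have := L0; rewrite EZ mulf_eq0 negb_or => /andP [as0 n0].
have := congr1 (fun z : int => odd (logn p `|z|%N)) EZ.
rewrite !(abszX, abszM) lognM ?muln_gt0 ?absz_gt0 ?q1x0 ?expn_gt0 ?absz_gt0 ?tn //.
rewrite lognM ?absz_gt0 // [in RHS]lognM ?absz_gt0 //; last first.
  by rewrite expn_gt0 -abszM absz_gt0; rewrite expf_eq0 /= in as0; rewrite as0.
rewrite !lognX lp !oddD /= !addbF !addbb.
have z1 m : (p%:Z %| m)%Z = false -> logn p `|m|%N = 0%N.
  by move=> Hm; apply/eqP; rewrite -leqn0 leqNgt logn_gt0 mem_primes pp /= -[(p %| _)%N]/(p%:Z %| m)%Z Hm andbF.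
rewrite !z1 //.
  by apply: contraNF eE => H1; rewrite dvdz_mulr.
by apply: contraNF eE => H1; rewrite dvdz_mull.
Qed.
End RationalSquareClasses.

Lemma muni_eq0 (R : nzRingType) n (p : {mpoly R[n.+1]}) : muni p = 0 -> p = 0.
Proof.
move=> E; apply/eqP; rewrite -msupp_eq0; apply/eqP.
case Ds: (msupp p) => [|m0 s] //; exfalso.
have m0s : m0 \in msupp p by rewrite Ds mem_head.
have := congr1 (fun q : {poly {mpoly R[n]}} => (q`_(m0 ord_max))@_[multinom (m0 (widen_ord (leqnSn n) i)) | i < n]) E.
rewrite muniE coef_sum raddf_sum (bigD1_seq m0) ?msupp_uniq //= big1 ?addr0.
  rewrite coefZ coefXn eqxx mulr1 mcoeffZ mcoeffX eqxx mulr1 coef0 mcoeff0 => H.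
  by move: m0s; rewrite mcoeff_msupp H eqxx.
move=> m ne; rewrite coefZ coefXn; case: eqP => [Em|]; last by rewrite mulr0 mcoeff0.
rewrite mulr1 mcoeffZ mcoeffX; case: eqP => [Em'|]; last by rewrite mulr0.
case/eqP: ne; apply/mnmP => i.
have [/eqP Hi|Hi] := boolP (i == ord_max); first by rewrite Hi Em.
have li : (i < n)%N.
  by have := ltn_ord i; rewrite ltnS leq_eqVlt -val_eqE /= in Hi *; rewrite (negbTE Hi).
move/mnmP: Em' => /(_ (Ordinal li)); rewrite !mnmE.
by have -> : widen_ord (leqnSn n) (Ordinal li) = i by apply: val_inj.
Qed.

(** Induction on the number of variables: a point off the zeros of the leading coefficient in the
    last variable, then a natural number for that variable. *)
Lemma mpoly_nonroot (R : idomainType) n (p : {mpoly R[n]}) :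
  injective (fun n : nat => n%:R : R) -> p != 0 -> exists y : 'I_n -> R, p.@[y] != 0.
Proof.
move=> inj; elim: n p => [|n IH] p p0.
  exists (fun _ => 0); apply: contraNneq p0 => H.
  apply/eqP/mpolyP => m; have -> : m = 0%MM by apply/mnmP => [[]].
  rewrite mcoeff0 -[RHS]H mevalE.
  case: (boolP (0%MM \in msupp p)) => H0.
    rewrite (bigD1_seq 0%MM) ?msupp_uniq //= big_ord0 mulr1 big1 ?addr0 //.
    by move=> i /eqP []; apply/mnmP => [[]].
  rewrite (memN_msupp_eq0 H0) big1_seq // => i /andP [_ iin].
  by case/negP: H0; have <- : i = 0%MM by apply/mnmP => [[]].
have q0 : muni p != 0 by apply: contraNneq p0 => /muni_eq0 ->.
have lq : lead_coef (muni p) != 0 by rewrite lead_coef_eq0.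
have [y Hy] := IH _ lq.
pose q := map_poly (meval y) (muni p).
have qn0 : q != 0.
  by apply: contraNneq Hy => E; have := coef_map (meval y) (muni p) (size (muni p)).-1;
     rewrite -/q E coef0 => <-.
have [c Hc] := poly_nat_nonroot inj qn0.
exists (fun i : 'I_n.+1 => if insub (i : nat) is Some j then y j else c%:R).
apply: contraNneq Hc => E; rewrite -[X in _ == X]E /q muniE rmorph_sum horner_sum mevalE.
apply/eqP/eq_bigr => m _.
rewrite /= map_polyZ /= map_polyXn hornerZ hornerXn.
rewrite mevalZ mevalX -mulrA big_ord_recr /= insubN -?leqNgt //; congr (_ * (_ * _)).
apply: eq_bigr => i _; rewrite mnmE.
by rewrite insubT // => Hi; congr (y _ ^+ _); apply: val_inj.
Qed.

(* Both [p] and [q] may vanish at 0, but then to the same order, which cancels. *)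
Lemma square_class_specialization (k : fieldType) (a b p q : {poly k}) :
  a.[0] != 0 -> b.[0] != 0 -> q != 0 -> a * q ^+ 2 = b * p ^+ 2 ->
  exists y, a.[0] = b.[0] * y ^+ 2.
Proof.
move=> a0 b0; have [m] := ubnP (size q); elim: m p q => // m IH p q sq q0 E.
have E0 : a.[0] * q.[0] ^+ 2 = b.[0] * p.[0] ^+ 2 by rewrite -!horner_exp -!hornerM E.
have [qz|qnz] := eqVneq q.[0] 0; last first.
  exists (p.[0] / q.[0]); rewrite expr_div_n mulrA -E0 mulfK // expf_neq0 //.
have pz : p.[0] = 0.
  move: E0; rewrite qz expr0n mulr0 => /esym/eqP.
  by rewrite mulf_eq0 (negbTE b0) expf_eq0 => /eqP.
have /factor_theorem [q1 Dq] : root q 0 by rewrite rootE qz.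
have /factor_theorem [p1 Dp] : root p 0 by rewrite rootE pz.
have q10 : q1 != 0 by apply: contraNneq q0 => H; rewrite Dq H mul0r.
have X0 : 'X - 0%:P != 0 :> {poly k} by rewrite polyXsubC_eq0.
apply: (IH p1 q1) => //.
  by move: sq; rewrite Dq size_mul // size_XsubC addn2.
apply: (mulIf (expf_neq0 2 X0)); transitivity (a * q ^+ 2); first by rewrite Dq; ring.
by rewrite E Dp; ring.
Qed.

(** * Square classes in a field of rational functions *)

Section FractionSquareClasses.
Import Num.Theory.

Lemma frac_reprE (R : idomainType) (x : {fraction R}) :
  x = (\n_(repr x))%:F / (\d_(repr x))%:F.
Proof.
have d0 := denom_ratioP (repr x).
apply: (canRL (mulfK _)); first by rewrite tofrac_eq0.
rewrite -[x in LHS]reprK; unlock tofrac; rewrite -[LHS]FracField.pi_mul.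
apply/eqmodP; rewrite /= FracField.equivfE /FracField.mulf !numden_Ratio ?oner_eq0 ?mulr1 //.
by rewrite reprK mulrC.
Qed.

Lemma fracP (R : idomainType) (x : {fraction R}) :
  exists a b : R, b != 0 /\ x = a%:F / b%:F.
Proof.
exists \n_(repr x), \d_(repr x).
by split; [exact: denom_ratioP | exact: frac_reprE].
Qed.

Lemma poly_frac_clear (R : idomainType) (p : {poly {fraction R}}) :
  exists (D : R) (P : {poly R}), D != 0 /\ D%:F *: p = map_poly (@tofrac R) P.
Proof.
elim/poly_ind: p => [|p c [D [P [D0 E]]]].
  by exists 1, 0; rewrite oner_eq0 scaler0 rmorph0.
have [a [b [b0 ->]]] := fracP c.
exists (D * b), (b *: P * 'X + (D * a)%:P); split; first by rewrite mulf_neq0.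
rewrite scalerDr rmorphD (rmorphM (map_poly (@tofrac R))) /= map_polyZ map_polyX map_polyC /= -E.
rewrite scalerA -tofracM [b * D]mulrC scalerAl; congr (_ + _).
rewrite -mul_polyC -polyCM !tofracM; congr (_%:P).
by rewrite mulrA mulrAC mulfK ?tofrac_eq0.
Qed.

(** The constant [r] certifies separability: whenever it survives a specialization to a field, the
    specialized polynomial is still coprime to its derivative. *)
Lemma frac_coprime_deriv (R : idomainType) (H : {poly R}) :
  let HF := map_poly (@tofrac R) H in coprimep HF HF^`() ->
  exists U V r, r != 0 /\ U * H + V * H^`() = r%:P.
Proof.
move=> HF /Bezout_coprimepP [[u v] /= /eqpP[[c1 c2] /= /andP[c10 c20] Buv]].
have [du [U [du0 Du]]] := poly_frac_clear u; have [dv [V [dv0 Dv]]] := poly_frac_clear v.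
have [dc [C [dc0 DC]]] := poly_frac_clear (c2 / c1)%:P.
have B : map_poly (@tofrac R) ((dv *: U) * H + (du *: V) * H^`()) = ((du * dv)%:F * (c2 / c1))%:P.
  have E : u * HF + v * HF^`() = (c2 / c1)%:P.
    apply: (scalerI c10); rewrite Buv -[1]/(1%:P) -!mul_polyC -!polyCM mulr1.
    by rewrite mulrCA mulfV ?mulr1.
  rewrite rmorphD !rmorphM /= -deriv_map /= !map_polyZ /= -/HF -Du -Dv.
  rewrite -[X in _ = _ * X]polyCM -E -!mul_polyC; ring.
pose W := (dv *: U) * H + (du *: V) * H^`().
have injF : injective (@tofrac R) by move=> x y /eqP; rewrite tofrac_eq => /eqP.
have sW : (size W <= 1)%N.
  by rewrite -(size_map_inj_poly injF) ?rmorph0 // B size_polyC_leq1.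
have W0 := size1_polyC sW.
exists (dv *: U), (du *: V), W`_0; split => //.
have : c2 / c1 != 0 by rewrite mulf_neq0 ?invr_eq0.
have : (du * dv)%:F != 0 by rewrite tofrac_eq0 mulf_neq0.
move=> d0 c0; have := mulf_neq0 d0 c0; apply: contraNneq => Wz.
by move: B; rewrite -/W W0 Wz polyC0 rmorph0 => /esym/eqP; rewrite polyC_eq0.
Qed.

Lemma meval_line n (R : comNzRingType) (y v : 'I_n -> R) (p : {mpoly R[n]}) (c : R) :
  (mmap (@polyC R) (fun i => (y i)%:P + (v i - y i) *: 'X) p).[c] =
  p.@[fun i => y i + (v i - y i) * c].
Proof.
rewrite /mmap horner_sum mevalE; apply: eq_bigr => m _.
rewrite hornerM hornerC /mmap1 horner_prod; congr (_ * _); apply: eq_bigr => i _.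
by rewrite horner_exp hornerD hornerC hornerZ hornerX.
Qed.

(** [q] may vanish at [y]. On the line from [y] to a point [v] with [q(v) <> 0] it is a nonzero
    polynomial, which reduces the claim to one variable, with [y] at parameter 0. *)
Lemma mpoly_square_class_specialization n (k : fieldType) (a b p q : {mpoly k[n]})
    (y : 'I_n -> k) : injective (fun m : nat => m%:R : k) ->
  a.@[y] != 0 -> b.@[y] != 0 -> q != 0 -> a * q ^+ 2 = b * p ^+ 2 ->
  exists z, a.@[y] = b.@[y] * z ^+ 2.
Proof.
move=> inj a0 b0 q0 E; have [v qv] := mpoly_nonroot inj q0.
pose l := mmap (@polyC k) (fun i => (y i)%:P + (v i - y i) *: 'X).
have l0 s : (l s).[0] = s.@[y].
  by rewrite meval_line; apply: meval_eq => i; rewrite mulr0 addr0.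
have l1 s : (l s).[1] = s.@[v].
  by rewrite meval_line; apply: meval_eq => i; rewrite mulr1 addrC subrK.
rewrite -!l0; apply: (@square_class_specialization _ (l a) (l b) (l p) (l q)); rewrite ?l0 //.
  by apply: contraNneq qv => ql; rewrite -l1 ql horner0.
by rewrite -!rmorphXn -!rmorphM /= E.
Qed.

Lemma square_class_clear_denominators (k : fieldType) (D n p d q : k) :
  d != 0 -> q != 0 ->
  D ^+ 2 * (n / d * (p / q) ^+ 2) * (d * q) ^+ 2 = n * d * (D * p) ^+ 2.
Proof. by move=> d0 q0; field; rewrite d0 q0. Qed.

(** [n / d] and [n * d] differ by the square of [d], so numerator times denominator represents the
    class of [e] inside [R]. *)
Lemma frac_square_class (R : idomainType) (h D : R) (e w : {fraction R}) : D != 0 ->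
  h%:F = D%:F ^+ 2 * (e * w ^+ 2) ->
  exists p q, q != 0 /\ h * q ^+ 2 = \n_(repr e) * \d_(repr e) * p ^+ 2.
Proof.
move=> D0 E; have [p [q [q0 Dw]]] := fracP w.
have := frac_reprE e; have := denom_ratioP (repr e).
move: \n_(repr e) \d_(repr e) => n d d0 De.
exists (D * p), (d * q); split; first by rewrite mulf_neq0.
apply/eqP; rewrite -tofrac_eq; apply/eqP.
have dF : d%:F != 0 by rewrite tofrac_eq0.
have qF : q%:F != 0 by rewrite tofrac_eq0.
rewrite (tofracM h) (tofracM (n * d)) !tofracXn (tofracM d) (tofracM D) (tofracM n) E Dw De.
exact: (square_class_clear_denominators D%:F n%:F p%:F dF qF).
Qed.

Lemma frac_poly_avoids_square_classes n (h : {poly {fraction {mpoly rat[n]}}})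
    (es : seq {fraction {mpoly rat[n]}}) :
  coprimep h h^`() -> (1 < size h)%N -> (forall e, e \in es -> e != 0) ->
  exists x : int, h.[x%:~R] != 0 /\ forall e y, e \in es -> h.[x%:~R] <> e * y ^+ 2.
Proof.
move=> cop sh es0.
have injQ : injective (fun m : nat => m%:R : rat) by move=> a b /eqP; rewrite eqr_nat => /eqP.
have injF : injective (@tofrac {mpoly rat[n]}) by move=> x y /eqP; rewrite tofrac_eq => /eqP.
have [D [H1 [D0 EH1]]] := poly_frac_clear h.
pose H := D *: H1.
have EH : map_poly (@tofrac {mpoly rat[n]}) H = (D%:F ^+ 2) *: h.
  by rewrite map_polyZ /= -EH1 scalerA expr2.
have DF0 : D%:F != 0 by rewrite tofrac_eq0.
have D20 : D%:F ^+ 2 != 0 by rewrite expf_neq0.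
have sH : (1 < size H)%N.
  by rewrite -(size_map_inj_poly injF) ?rmorph0 // EH size_scale.
have [|U [V [r [r0 B]]]] := @frac_coprime_deriv {mpoly rat[n]} H.
  by rewrite EH derivZ coprimepZl // coprimepZr.
pose nd (e : {fraction {mpoly rat[n]}}) : {mpoly rat[n]} := \n_(repr e) * \d_(repr e).
have nd0 e : e \in es -> nd e != 0.
  move=> /es0 e0; rewrite mulf_neq0 ?denom_ratioP //.
  by apply: contraNneq e0 => E; rewrite (frac_reprE e) E rmorph0 mul0r.
(* Off the zeros of [P], specialization keeps the degree of [H], its separability and the
   nonvanishing of every class representative. *)
pose P := r * lead_coef H * \prod_(e <- es) nd e.
have P0 : P != 0.
  rewrite !mulf_neq0 // ?lead_coef_eq0 -?size_poly_gt0 ?(ltnW sH) //.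
  by rewrite prodf_seq_neq0; apply/allP => e /nd0.
have [y] := mpoly_nonroot injQ P0; rewrite !rmorphM /= !mulf_eq0 !negb_or => /andP [/andP [ry ly] ey].
pose H0 := map_poly (meval y) H.
have sH0 : (1 < size H0)%N.
  by rewrite size_map_poly_id0.
have cop0 : coprimep H0 H0^`().
  apply/Bezout_coprimepP; exists (map_poly (meval y) U, map_poly (meval y) V) => /=.
  rewrite deriv_map -!rmorphM -rmorphD B /= map_polyC /=.
  by rewrite polyC_eqp1.
have [x [hx0 hxe]] : exists x : int, H0.[x%:~R] != 0 /\
   forall e z, e \in [seq (nd e).@[y] | e <- es] -> H0.[x%:~R] <> e * z ^+ 2.
  apply: rat_poly_avoids_square_classes => // _ /mapP [e ein ->].
  by move: ey; rewrite rmorph_prod prodf_seq_neq0 => /allP /(_ e ein).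
exists x.
have Ex : (H.[x%:~R])%:F = D%:F ^+ 2 * h.[x%:~R].
  by rewrite -hornerZ -EH -[x%:~R in RHS](rmorph_int (@tofrac {mpoly rat[n]})) horner_map.
have Ey : H0.[x%:~R] = (H.[x%:~R]).@[y].
  by rewrite -[x%:~R in LHS](rmorph_int (meval y)) horner_map.
have hy : (H.[x%:~R]).@[y] != 0 by rewrite -Ey; exact: hx0.
split.
  apply: contraNneq hx0 => E; rewrite Ey.
  by move: Ex; rewrite E mulr0 => /eqP; rewrite tofrac_eq0 => /eqP ->; rewrite rmorph0.
move=> e w ein Ew; rewrite Ew in Ex.
have [p [q [q0 EQ]]] := frac_square_class D0 Ex.
have e0 : (nd e).@[y] != 0 by move: ey; rewrite rmorph_prod prodf_seq_neq0 => /allP /(_ e ein).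
have [z Hz] := mpoly_square_class_specialization injQ hy e0 q0 EQ.
by apply: (hxe (nd e).@[y] z); [exact: map_f | rewrite Ey].
Qed.
End FractionSquareClasses.

(** * Subfields and linear disjointness *)

Section SubfieldClosure.
Variables (F : fieldType) (L : F -> Prop).
Hypothesis HL : is_subfield L.

Lemma sf1 : L 1. Proof. by case: HL. Qed.
Lemma sfB x y : L x -> L y -> L (x - y). Proof. by case: HL => _ H _; apply: H. Qed.
Lemma sf_div x y : L x -> L y -> L (x / y). Proof. by case: HL => _ _ H; apply: H. Qed.
Lemma sf0 : L 0. Proof. by rewrite -(subrr 1); apply: sfB; apply: sf1. Qed.
Lemma sfN x : L x -> L (- x). Proof. by move=> Lx; rewrite -sub0r; apply: sfB (sf0) Lx. Qed.
Lemma sfD x y : L x -> L y -> L (x + y).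
Proof. by move=> Lx Ly; rewrite -[y]opprK; apply: sfB => //; apply: sfN. Qed.
Lemma sfV x : L x -> L x^-1. Proof. by move=> Lx; rewrite -div1r; apply: sf_div (sf1) Lx. Qed.
Lemma sfM x y : L x -> L y -> L (x * y).
Proof. by move=> Lx Ly; rewrite -[y]invrK; apply: sf_div => //; apply: sfV. Qed.
Lemma sfX x n : L x -> L (x ^+ n).
Proof.
by move=> Lx; elim: n => [|n IH]; rewrite ?expr0 ?exprS; [apply: sf1|apply: sfM].
Qed.
Lemma sf_sum I (r : seq I) (P : pred I) (f : I -> F) :
  (forall i, P i -> L (f i)) -> L (\sum_(i <- r | P i) f i).
Proof. by move=> H; elim/big_ind: _ => //; [apply: sf0 | apply: sfD]. Qed.
Lemma sf_prod I (r : seq I) (P : pred I) (f : I -> F) :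
  (forall i, P i -> L (f i)) -> L (\prod_(i <- r | P i) f i).
Proof. by move=> H; elim/big_ind: _ => //; [apply: sf1 | apply: sfM]. Qed.
Lemma sf_nat n : L n%:R.
Proof. by elim: n => [|n IH]; rewrite ?mulr0n ?mulrS; [apply: sf0|apply: sfD => //; apply: sf1]. Qed.
Lemma sf_horner p x : poly_over L p -> L x -> L p.[x].
Proof.
move=> Lp Lx; rewrite horner_coef; apply: sf_sum => i _.
by apply: sfM => //; apply: sfX.
Qed.

Lemma poly_overC c : L c -> poly_over L c%:P.
Proof. by move=> Lc i; rewrite coefC; case: ifP => // _; apply: sf0. Qed.
Lemma poly_overX : poly_over L 'X.
Proof. by move=> i; rewrite coefX; case: eqP => _; [apply: sf1|apply: sf0]. Qed.
Lemma poly_overB p q : poly_over L p -> poly_over L q -> poly_over L (p - q).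
Proof. by move=> Hp Hq i; rewrite coefB; apply: sfB. Qed.
Lemma poly_overM p q : poly_over L p -> poly_over L q -> poly_over L (p * q).
Proof. by move=> Hp Hq i; rewrite coefM; apply: sf_sum => j _; apply: sfM. Qed.
Lemma poly_over_deriv p : poly_over L p -> poly_over L p^`().
Proof. by move=> Hp i; rewrite coef_deriv -mulr_natr; apply: sfM => //; apply: sf_nat. Qed.

End SubfieldClosure.

Lemma adjoin_subfield (F : fieldType) (L : F -> Prop) a : is_subfield (adjoin L a).
Proof.
split=> [M HM _ _|x y Hx Hy M HM LM Ma|x y Hx Hy M HM LM Ma]; first exact: sf1.
  by apply: sfB => //; [apply: Hx|apply: Hy].
by apply: sf_div => //; [apply: Hx|apply: Hy].
Qed.

Lemma adjoin_base (F : fieldType) (L : F -> Prop) a z : L z -> adjoin L a z.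
Proof. by move=> Lz M _ H _; apply: H. Qed.

Lemma adjoin_gen (F : fieldType) (L : F -> Prop) a : adjoin L a a.
Proof. by move=> M. Qed.

Lemma adjoin_min (F : fieldType) (L M : F -> Prop) a z :
  is_subfield M -> (forall x, L x -> M x) -> M a -> adjoin L a z -> M z.
Proof. by move=> HM LM Ma; apply. Qed.

(** Bundling the predicate and deciding membership by excluded middle turns a subfield into a
    genuine [fieldType], [sfT] below, over which polynomial division and gcd are available. *)
Record subfield (F : fieldType) := Subfield
  { subfield_pred :> F -> Prop; subfieldP : is_subfield subfield_pred }.

Definition subfield_mem (F : fieldType) (S : subfield F) : F -> bool :=
  fun x => if excluded_middle_informative (S x) then true else false.

Lemma subfield_memP (F : fieldType) (S : subfield F) x : reflect (S x) (subfield_mem S x).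
Proof. by rewrite /subfield_mem; case: excluded_middle_informative => H; constructor. Qed.

Lemma subfield_mem_closed (F : fieldType) (S : subfield F) : divring_closed (subfield_mem S).
Proof.
have HS := subfieldP S; split; first exact/subfield_memP/(sf1 HS).
  by move=> x y /subfield_memP Hx /subfield_memP Hy; apply/subfield_memP; apply: sfB.
by move=> x y /subfield_memP Hx /subfield_memP Hy; apply/subfield_memP; apply: sf_div.
Qed.

HB.instance Definition _ (F : fieldType) (S : subfield F) :=
  GRing.isDivringClosed.Build F (subfield_mem S) (subfield_mem_closed S).

Section SubfieldType.
Variables (F : fieldType) (S : subfield F).
Record sfT := SfT { sfval : F; _ : subfield_mem S sfval }.
HB.instance Definition _ := [isSub for sfval].
HB.instance Definition _ := [Choice of sfT by <:].
HB.instance Definition _ := [SubChoice_isSubComUnitRing of sfT by <:].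
HB.instance Definition _ := [SubComUnitRing_isSubIntegralDomain of sfT by <:].
HB.instance Definition _ := [SubIntegralDomain_isSubField of sfT by <:].

Definition sfv (x : sfT) : F := val x.
HB.instance Definition _ := GRing.RMorphism.copy sfv val.
Arguments sfv : simpl never.

Lemma sfvP x : S (sfv x).
Proof. exact/subfield_memP/valP. Qed.

Lemma sfv_lift x : S x -> exists y, sfv y = x.
Proof. by move=> /subfield_memP Hx; exists (SfT Hx). Qed.

Lemma poly_over_sfv p : poly_over S (map_poly sfv p).
Proof. by move=> i; rewrite coef_map; apply: sfvP. Qed.

Lemma poly_over_lift p : poly_over S p -> exists q, p = map_poly sfv q.
Proof.
move=> Hp; elim/poly_ind: p Hp => [|p c IH] Hp; first by exists 0; rewrite rmorph0.
have [q Eq] : exists q, p = map_poly sfv q.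
  by apply: IH => i; have := Hp i.+1; rewrite coefD coefMX coefC /= addr0.
have [d Ed] : exists d, sfv d = c.
  by apply: sfv_lift; have := Hp 0; rewrite coefD coefMX coefC /= add0r.
by exists (q * 'X + d%:P); rewrite rmorphD rmorphM /= map_polyX map_polyC /= Ed -Eq.
Qed.

Lemma mpoly_over_lift n (p : {mpoly F[n]}) :
  mpoly_over S p -> exists q, p = map_mpoly sfv q.
Proof.
move=> Hp; have lift m : {c : sfT | sfv c = p@_m}.
  exact/constructive_indefinite_description/sfv_lift.
exists (\sum_(m <- msupp p) sval (lift m) *: 'X_[m]).
rewrite {1}[p]mpolyE rmorph_sum; apply: eq_bigr => m _ /=.
by rewrite map_mpolyZ /= map_mpolyX (svalP (lift m)).
Qed.

Lemma mpoly_over_sfv n (p : {mpoly sfT[n]}) : mpoly_over S (map_mpoly sfv p).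
Proof. by move=> m; rewrite mcoeff_map_mpoly; apply: sfvP. Qed.
End SubfieldType.

Section LinearIndependence.
Variables (F : fieldType) (k : F -> Prop).
Hypothesis Hk : is_subfield k.

Definition indep (d : seq F) : Prop := forall b : nat -> F, (forall i, k (b i)) ->
  \sum_(i < size d) b i * d`_i = 0 -> forall i, (i < size d)%N -> b i = 0.

Definition lspan (d : seq F) (x : F) : Prop :=
  exists2 b : nat -> F, forall i, k (b i) & x = \sum_(i < size d) b i * d`_i.

Lemma lspan_cat d e x : lspan d x -> lspan (d ++ e) x.
Proof.
case=> b kb ->; exists (fun i => if (i < size d)%N then b i else 0).
  by move=> i; case: ifP => // _; apply: sf0.
rewrite size_cat big_split_ord /= [X in _ + X]big1 ?addr0 => [|i _].
  by apply: eq_bigr => i _; rewrite nth_cat ltn_ord.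
by rewrite ltnNge leq_addr mul0r.
Qed.

Lemma lspan_rcons d c : lspan (rcons d c) c.
Proof.
exists (fun i => (i == size d)%:R); first by move=> i; apply: sf_nat.
rewrite size_rcons big_ord_recr /= eqxx mul1r nth_rcons ltnn eqxx big1 ?add0r // => i _.
by rewrite ltn_eqF ?mul0r.
Qed.

Lemma indep_rcons d c : indep d -> ~ lspan d c -> indep (rcons d c).
Proof.
move=> Id nc b kb; rewrite size_rcons big_ord_recr /= nth_rcons ltnn eqxx.
rewrite (eq_bigr (fun i : 'I_(size d) => b i * d`_i)) => [E|i _]; last first.
  by rewrite nth_rcons ltn_ord.
have b0 : b (size d) = 0.
  apply: NNPP => /eqP bn; apply: nc; exists (fun i => - (b i / b (size d))).
    by move=> i; apply: sfN => //; apply: sf_div.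
  move/eqP: E; rewrite addrC addr_eq0 => /eqP E.
  apply: (mulfI bn); rewrite E mulr_sumr -sumrN; apply: eq_bigr => i _.
  by field.
move=> i; rewrite ltnS leq_eqVlt => /orP [/eqP -> //|].
by apply: Id => //; move: E; rewrite b0 mul0r addr0.
Qed.

Lemma basis_extend d (c : seq F) : indep d ->
  exists d', indep (d ++ d') /\ forall x, x \in c -> lspan (d ++ d') x.
Proof.
elim: c d => [|x c IH] d Id; first by exists [::]; rewrite cats0.
have [sx|nsx] := classic (lspan d x).
  have [d' [I' S']] := IH d Id; exists d'; split=> // y.
  by rewrite inE => /orP [/eqP ->|]; [apply: lspan_cat | apply: S'].
have [d' [I' S']] := IH _ (indep_rcons Id nsx).
exists (x :: d'); rewrite -cat_rcons; split=> // y.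
by rewrite inE => /orP [/eqP ->|]; [apply/lspan_cat/lspan_rcons | apply: S'].
Qed.
End LinearIndependence.

(** Linear disjointness of [e(F)] and [R] over [k], in terms of finite families. For [R = k(phi)] it
    is what a curve defined over [k] provides. *)
Definition lindisj (F Om : fieldType) (e : F -> Om) (k : F -> Prop) (R : Om -> Prop) :=
  forall d, indep k d -> forall x : nat -> Om, (forall i, R (x i)) ->
  \sum_(i < size d) e d`_i * x i = 0 -> forall i, (i < size d)%N -> x i = 0.

Section LinearDisjointness.
Variables (F Om : fieldType) (e : {rmorphism F -> Om}) (k : F -> Prop) (R : Om -> Prop).
Hypotheses (Hk : is_subfield k) (HR : is_subfield R) (kR : forall x, k x -> R (e x)).
Hypothesis LD : lindisj e k R.

(* The relation [sum c_i x_i = 0] is defined over [k], so [c] is a combination of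
   solutions in [k]; one of those has to satisfy the extra condition. *)
Lemma lindisj_descent r (c : nat -> F) (x y : nat -> Om) : (forall i, R (x i)) ->
  \sum_(i < r) e (c i) * x i = 0 -> \sum_(i < r) e (c i) * y i != 0 ->
  exists b : nat -> F, [/\ forall i, k (b i), \sum_(i < r) e (b i) * x i = 0
    & \sum_(i < r) e (b i) * y i != 0].
Proof.
move=> Rx Ex Ey.
have I0 : indep k [::] by move=> b kb E i; rewrite ltn0.
have [d [Id Sd]] := basis_extend Hk [seq c i | i <- iota 0 r] I0.
rewrite /= in Id Sd.
have HB i : {b : nat -> F | (forall j, k (b j)) /\
    ((i < r)%N -> c i = \sum_(j < size d) b j * d`_j)}.
  apply: constructive_indefinite_description.
  have [lt|ge] := ltnP i r; last by exists (fun _ => 0); split=> // _; apply: sf0.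
  have [|b kb Eb] := Sd (c i); last by exists b.
  by apply: map_f; rewrite mem_iota.
pose B i := sval (HB i).
have kB i j : k (B i j) by rewrite /B; case: (HB i) => b' /= [].
have swap (z : nat -> Om) : \sum_(i < r) e (c i) * z i =
    \sum_(j < size d) e d`_j * \sum_(i < r) e (B i j) * z i.
  under eq_bigr => i _ do rewrite (proj2 (svalP (HB i)) (ltn_ord i)) rmorph_sum mulr_suml.
  rewrite exchange_big /=; apply: eq_bigr => j _; rewrite mulr_sumr.
  by apply: eq_bigr => i _; rewrite rmorphM mulrCA mulrA.
have Z j : (j < size d)%N -> \sum_(i < r) e (B i j) * x i = 0.
  apply: (LD Id (x := fun j => \sum_(i < r) e (B i j) * x i)); last by rewrite -swap.
  by move=> i; apply: sf_sum => // l _; apply: sfM => //; apply: kR.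
have [j jd yj] : exists2 j, (j < size d)%N & \sum_(i < r) e (B i j) * y i != 0.
  apply: NNPP => H; move/eqP: Ey; apply; rewrite swap big1 // => j _.
  apply/eqP; rewrite mulf_eq0; apply/orP; right; apply/negPn/negP => H1; apply: H.
  by exists j.
by exists (fun i => B i j); split=> //; apply: Z.
Qed.

(** A relation of degree below [n] over [R] would contradict the independence of
    [1, a, ..., a^(n-1)] over [k], which disjointness carries over to [R]. Minimal polynomials
    therefore do not change from [k] to [R]. *)
Lemma lindisj_degree a n : algebraic_of_degree k a n -> algebraic_of_degree R (e a) n.
Proof.
case=> [[p [kp sp rp]] min]; split.
  exists (map_poly e p); rewrite size_map_poly; split=> //.
    by move=> i; rewrite coef_map; apply: kR.
  by rewrite rmorph_root.
move=> q Rq q0 rq; rewrite ltnNge; apply: contraNN q0 => sq.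
have I : indep k (mkseq (fun i => a ^+ i) n).
  move=> b kb E i; rewrite size_mkseq in E * => lt_i.
  apply: NNPP => /eqP bi.
  have q0 : \poly_(i < n) b i != 0.
    by apply: contraNneq bi => H; have := coef_poly n b i; rewrite H coef0 lt_i => ->.
  have kq : poly_over k (\poly_(i < n) b i).
    by move=> j; rewrite coef_poly; case: ifP => // _; apply: sf0.
  have rq' : root (\poly_(i < n) b i) a.
    rewrite rootE horner_poly -[X in _ == X]E; apply/eqP/eq_bigr => j _.
    by rewrite nth_mkseq.
  by have := min _ kq q0 rq'; rewrite ltnNge size_poly.
apply/eqP/polyP => i; rewrite coef0.
have [lt_i|] := ltnP i n; last by move=> /(leq_trans sq) /(nth_default 0).
apply: (LD I (x := fun i => q`_i)) => //; last by rewrite size_mkseq.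
rewrite size_mkseq; move/eqP: rq; rewrite (horner_coef_wide _ sq) => rq.
rewrite -[RHS]rq; apply: eq_bigr => j _; rewrite nth_mkseq // rmorphXn mulrC //.
Qed.

End LinearDisjointness.

(** Multiplication by the product of all denominators turns a relation between fractions into one
    between elements of [R]. *)
Lemma lindisj_frac (F Om : fieldType) (e : F -> Om) (k : F -> Prop) (R : Om -> Prop) :
  R 1 -> (forall x y, R x -> R y -> R (x * y)) -> lindisj e k R ->
  lindisj e k (fun x => exists a b, [/\ R a, R b, b != 0 & x = a / b]).
Proof.
move=> R1 RM LD d Id x Hx E.
have Hab i : {ab : Om * Om | [/\ R ab.1, R ab.2, ab.2 != 0 & x i = ab.1 / ab.2]}.
  apply: constructive_indefinite_description.
  by have [a [b H]] := Hx i; exists (a, b).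
pose b i := (sval (Hab i)).2; pose a i := (sval (Hab i)).1.
pose D := \prod_(i < size d) b i.
pose D' i := \prod_(j < size d | (j : nat) != i) b j.
have b0 i : b i != 0 by rewrite /b; case: (Hab i) => /= ? [].
have RD i : R (D' i).
  rewrite /D'; elim/big_ind: _ => // j _.
  by rewrite /b; case: (Hab j) => /= ? [].
have xD i : (i < size d)%N -> x i * D = a i * D' i.
  move=> lt_i; rewrite /D (bigD1 (Ordinal lt_i)) //= mulrA.
  have -> : x i = a i / b i by rewrite /a /b; case: (Hab i) => /= ? [].
  by rewrite mulfVK.
have D0 : D != 0 by apply/prodf_neq0 => i _.
have Z i : (i < size d)%N -> a i * D' i = 0.
  apply: (LD d Id (fun i => a i * D' i)).
    by move=> j; apply: RM => //; rewrite /a; case: (Hab j) => /= ? [].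
  have := congr1 (fun z => z * D) E; rewrite mul0r mulr_suml => {2}<-.
  by apply: eq_bigr => j _; rewrite -mulrA xD.
move=> i lt_i; apply/eqP; have /eqP := Z i lt_i.
by rewrite -xD // mulf_eq0 (negbTE D0) orbF.
Qed.

(** * Minimal polynomials *)

Definition is_minpoly (k Om : fieldType) (e : {rmorphism k -> Om}) (P : {poly k}) (a : Om) :=
  P \is monic /\ forall q, root (map_poly e q) a = (P %| q).

Section MinPoly.
Variables (k Om : fieldType) (e : {rmorphism k -> Om}) (P : {poly k}).

Lemma is_minpoly_size_gt1 a : is_minpoly e P a -> (1 < size P)%N.
Proof.
case=> mP HP; rewrite ltn_neqAle eq_sym size_poly_gt0 monic_neq0 // andbT.
by rewrite -dvdp1 -HP rmorph1 root1.
Qed.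

(** The gcd of [P] and [q] has the root [b], so it is not constant; its cofactor in [P] is then too
    small to have the root [a]. Hence [a] is a root of the gcd, and [P] divides [q]. *)
Lemma is_minpoly_conj a b : is_minpoly e P a -> root (map_poly e P) b -> is_minpoly e P b.
Proof.
case=> mP HP rb; split=> // q; apply/idP/idP => [rq|/dvdpP [r ->]]; last first.
  by rewrite rmorphM rootM rb orbT.
have P0 := monic_neq0 mP.
have rg : root (map_poly e (gcdp P q)) b by rewrite gcdp_map root_gcd rb.
have /dvdpP [s Ds] := dvdp_gcdl P q.
have /orP [rs|] : root (map_poly e s) a || root (map_poly e (gcdp P q)) a.
  by rewrite -rootM -rmorphM -Ds HP dvdpp.
  have s0 : s != 0 by apply: contraNneq P0 => E; rewrite Ds E mul0r.
  have g0 : gcdp P q != 0 by rewrite gcdp_eq0 negb_and P0.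
  have sg : (1 < size (gcdp P q))%N.
    rewrite -(size_map_poly e); apply: root_size_gt1 rg; by rewrite map_poly_eq0.
  have := rs; rewrite HP => /(dvdp_leq s0); rewrite {1}Ds size_mul //.
  by rewrite -size_poly_gt0 in s0; lia.
by rewrite HP => /dvdp_trans; apply; apply: dvdp_gcdr.
Qed.

Lemma is_minpoly_modp a q : is_minpoly e P a ->
  (map_poly e q).[a] = (map_poly e (q %% P)).[a].
Proof.
case=> _ HP; have /eqP rP : root (map_poly e P) a by rewrite HP dvdpp.
by rewrite {1}(divp_eq q P) rmorphD rmorphM hornerD hornerM rP mulr0 add0r.
Qed.

(** Inverses come from a Bezout relation [u P + v q = 1] evaluated at [a]. *)
Lemma is_minpoly_range_subfield a : is_minpoly e P a ->
  is_subfield (fun x => exists q, x = (map_poly e q).[a]).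
Proof.
move=> Pa; split=> [|x y [p ->] [q ->]|x y [p ->] [q ->]].
- by exists 1; rewrite rmorph1 hornerC.
- by exists (p - q); rewrite rmorphB !hornerE.
have [E|ne] := eqVneq (map_poly e q).[a] 0.
  by exists 0; rewrite E invr0 mulr0 rmorph0 horner0.
case: (Pa) => mP HP.
have /Bezout_eq1_coprimepP [[u v] /= E] : coprimep P q.
  rewrite coprimep_def; apply/eqP; have P0 := monic_neq0 mP.
  have /dvdpP [s Ds] := dvdp_gcdl P q.
  have rs : root (map_poly e s) a.
    have : root (map_poly e P) a by rewrite HP dvdpp.
    rewrite Ds rmorphM rootM => /orP [] // /(root_dvdp _) H; case/negP: ne.
    by apply: H; rewrite dvdp_map dvdp_gcdr.
  have s0 : s != 0 by apply: contraNneq P0 => E; rewrite Ds E mul0r.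
  have g0 : gcdp P q != 0 by rewrite gcdp_eq0 negb_and P0.
  have := rs; rewrite HP => /(dvdp_leq s0); rewrite {1}Ds size_mul //.
  by rewrite -size_poly_gt0 in s0; rewrite -size_poly_gt0 in g0; lia.
exists (p * v); rewrite rmorphM hornerM; congr (_ * _); apply: (mulIf ne).
rewrite mulVf //; have := congr1 (fun z => (map_poly e z).[a]) E.
have /eqP rP : root (map_poly e P) a by rewrite HP dvdpp.
by rewrite rmorphD !rmorphM hornerD !hornerM rP mulr0 add0r rmorph1 hornerC => ->.
Qed.

Lemma is_minpoly_separable a b : (forall m, m.+1%:R != 0 :> k) -> is_minpoly e P a ->
  root (map_poly e P) b -> ~~ root (map_poly e P^`()) b.
Proof.
move=> char0 Pa rb; have [_ ->] := is_minpoly_conj Pa rb.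
have sP := is_minpoly_size_gt1 Pa.
have P0 : P != 0 by rewrite -size_poly_gt0 ltnW.
have d0 : P^`() != 0.
  apply: contraTneq isT => E; have := coef_deriv P (size P).-2.
  have -> : (size P).-2.+1 = (size P).-1 by case: (size P) sP => [|[|]].
  rewrite E coef0 => /esym/eqP; rewrite -mulr_natr mulf_eq0 -/(lead_coef P) lead_coef_eq0 (negbTE P0).
  by case: (size P) sP => [|[|s]] //= _; rewrite (negbTE (char0 _)).
apply/negP => /(dvdp_leq d0); rewrite leqNgt lt_size_deriv //.
Qed.
End MinPoly.

Lemma minpoly_exists (F : fieldType) (S : subfield F) a n : algebraic_of_degree S a n ->
  exists P : {poly sfT S}, is_minpoly (@sfv F S) P a /\ size P = n.+1.
Proof.
case=> [[p [kp sp rp]] min]; have [q Dq] := poly_over_lift kp.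
have q0 : q != 0 by apply: contra_eq_neq sp => E; rewrite Dq E rmorph0 size_poly0.
have l0 : lead_coef q != 0 by rewrite lead_coef_eq0.
have sq : size ((lead_coef q)^-1 *: q) = n.+1.
  by rewrite size_scale ?invr_eq0 // -(size_map_poly (@sfv F S)) -Dq.
exists ((lead_coef q)^-1 *: q); split=> //; split; first by rewrite monicE lead_coefZ mulVf.
have rq : root (map_poly (@sfv F S) ((lead_coef q)^-1 *: q)) a.
  by rewrite map_polyZ rootZ ?fmorph_eq0 ?invr_eq0 // -Dq.
set P := _ *: q in sq rq *; move=> r; rewrite /dvdp.
have P0 : P != 0 by rewrite -size_poly_gt0 sq.
rewrite {1}(divp_eq r P) rmorphD rmorphM rootE hornerD hornerM (eqP rq) mulr0 add0r.
apply/idP/eqP => [rm|->]; last by rewrite rmorph0 horner0.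
apply: NNPP => /eqP m0; have := min (map_poly (@sfv F S) (r %% P)) (poly_over_sfv _).
rewrite map_poly_eq0 m0 rootE rm size_map_poly => /(_ isT isT).
by rewrite ltnNge -ltnS -sq ltn_modp P0.
Qed.

Lemma adjoinP (F : fieldType) (S : subfield F) a n x : algebraic_of_degree S a n ->
  adjoin S a x <-> exists2 p : {poly sfT S}, (size p <= n)%N & x = (map_poly (@sfv F S) p).[a].
Proof.
move=> /minpoly_exists [P [Pa sP]]; split.
  have HM := is_minpoly_range_subfield Pa.
  move=> H; have [z /sfv_lift [c <-]||p ->] := adjoin_min HM _ _ H.
  - by exists c%:P; rewrite map_polyC hornerC.
  - by exists 'X; rewrite map_polyX hornerX.
  exists (p %% P); last exact: is_minpoly_modp.
  by rewrite -ltnS -sP ltn_modp -size_poly_gt0 sP.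
case=> p _ ->; apply: (sf_horner (@adjoin_subfield _ S a)).
  by move=> i; rewrite coef_map; apply: adjoin_base; apply: sfvP.
exact: adjoin_gen.
Qed.

Lemma minpoly_split (k : fieldType) (F : closedFieldType) (e : {rmorphism k -> F}) P a :
  (forall m, m.+1%:R != 0 :> k) -> is_minpoly e P a ->
  exists rs : (size P).-1.-tuple F, uniq rs /\ map_poly e P = \prod_(z <- rs) ('X - z%:P).
Proof.
move=> char0 Pa; have [rs Drs] := closed_field_poly_normal (map_poly e P).
have mP : map_poly e P \is monic by case: Pa => mP _; rewrite map_monic.
rewrite (monicP mP) scale1r in Drs.
have srs : size rs == (size P).-1.
  by have := congr1 (fun z : {poly F} => size z) Drs; rewrite size_map_poly size_prod_XsubC => ->.
exists (Tuple srs); split=> //=.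
rewrite -separable_prod_XsubC -Drs unlock; apply/coprimepP => d dP dP'.
apply: NNPP => /negP; rewrite -size_poly_eq1 => /closed_rootP [z rz].
have := is_minpoly_separable char0 Pa (root_dvdp dP rz).
by rewrite -deriv_map (root_dvdp dP' rz).
Qed.

(** * Nonsquare values of binary quadratic forms *)

Lemma quadratic_degree (F : fieldType) (k : F -> Prop) w : is_subfield k ->
  ~ k w -> k (w ^+ 2) -> algebraic_of_degree k w 2.
Proof.
move=> Hk nkw kw2; split.
  exists ('X^2 - (w ^+ 2)%:P); split.
  - apply: poly_overB => //; first by rewrite expr2; apply: poly_overM => //; apply: poly_overX.
    exact: poly_overC.
  - by rewrite size_XnsubC.
  - by rewrite rootE hornerD hornerXn hornerN hornerC subrr.
move=> q kq q0 rq; rewrite ltnNge; apply/negP => sq; apply: nkw.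
have Dq : q = (q`_0)%:P + q`_1 *: 'X.
  by apply/polyP => i; rewrite coefD coefC coefZ coefX; case: i => [|[|i]] /=;
    rewrite ?mulr0 ?addr0 ?mulr1 ?add0r // nth_default // (leq_trans sq).
move: rq; rewrite rootE Dq hornerD hornerC hornerZ hornerX => /eqP rq.
have q1 : q`_1 != 0.
  apply: contraNneq q0 => E; rewrite Dq; move: rq; rewrite E mul0r addr0 => ->.
  by rewrite scale0r addr0.
have -> : w = - (q`_0 / q`_1).
  by apply: (mulfI q1); move/eqP: rq; rewrite addrC addr_eq0 => /eqP ->; field.
by apply: sfN => //; apply: sf_div.
Qed.

Lemma adjoin_quadratic (F : fieldType) (k : F -> Prop) w z : is_subfield k ->
  ~ k w -> k (w ^+ 2) -> adjoin k w z -> exists c d, [/\ k c, k d & z = c + d * w].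
Proof.
move=> Hk nkw kw2 /(@adjoinP _ (Subfield Hk) _ _ _ (quadratic_degree Hk nkw kw2)) [p sp ->].
exists (sfv p`_0), (sfv p`_1); split; [exact: (@sfvP _ (Subfield Hk))|exact: (@sfvP _ (Subfield Hk))|].
rewrite (horner_coef_wide _ (n := 2)) ?size_map_poly // big_ord_recl big_ord1.
by rewrite /= !coef_map /= expr0 mulr1 expr1.
Qed.

Lemma degree_exists (F : fieldType) (k : F -> Prop) a (p : {poly F}) :
  poly_over k p -> p != 0 -> root p a ->
  exists2 m, algebraic_of_degree k a m & (m < size p)%N.
Proof.
have [s] := ubnP (size p); elim: s p => // s IH p sp kp p0 rp.
have [[q [kq q0 rq lt]]|H] := classic (exists q, [/\ poly_over k q, q != 0, root q a & (size q < size p)%N]).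
  have [|m Hm lm] := IH q _ kq q0 rq; first by apply: leq_trans lt _.
  by exists m => //; apply: ltn_trans lm lt.
exists (size p).-1; last by rewrite prednK // size_poly_gt0.
split; first by exists p; split; rewrite ?prednK // size_poly_gt0.
move=> q kq q0 rq; rewrite prednK ?size_poly_gt0 // leqNgt; apply/negP => lt.
by apply: H; exists q.
Qed.

(* Induction on the degree: if some [x0 = w0^2] is not a square in [k], then passing to
   [k(w0)] lowers the degree of [a] and identifies only the classes of [1] and [x0]. *)
Lemma finite_square_classes (F : fieldType) (k : F -> Prop) a m :
  2%:R != 0 :> F -> is_subfield k -> algebraic_of_degree k a m ->
  exists es : seq F, (forall e, e \in es -> k e /\ e != 0) /\
    forall w, adjoin k a w -> k (w ^+ 2) -> w != 0 ->
      exists e y, [/\ e \in es, k y & w ^+ 2 = e * y ^+ 2].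
Proof.
move=> ch2; have [n] := ubnP m; elim: n k m => // n IH k m lm Hk Da.
have [[w0 [Lw0 kw0 w00 nkw0]]|H] := classic (exists w, [/\ adjoin k a w, k (w ^+ 2), w != 0 & ~ k w]); last first.
  exists [:: 1]; split=> [e|w Lw kw w0].
    by rewrite inE => /eqP ->; split; [exact: sf1 | exact: oner_neq0].
  exists 1, w; rewrite inE eqxx mul1r; split=> //.
  by apply: NNPP => nk; apply: H; exists w.
have H1 := @adjoin_subfield _ k w0; set k1 := adjoin k w0 in H1.
(* [w0 = p(a)] with [p] over [k] of size at most [m]. So [a] is a root of [p - w0] over [k1], a
   polynomial that is nonzero because [w0] is not in [k], and the degree drops. *)
have [m1 D1 lm1] : exists2 m1, algebraic_of_degree k1 a m1 & (m1 < m)%N.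
  have /(@adjoinP _ (Subfield Hk) _ _ _ Da) [p sp Dw] := Lw0.
  pose q := map_poly (@sfv _ (Subfield Hk)) p - w0%:P.
  have [||| m1 D1 l1] := @degree_exists _ k1 a q.
  - apply: poly_overB => //; last by apply: poly_overC => //; apply: adjoin_gen.
    by move=> i; rewrite coef_map; apply: adjoin_base; apply: (@sfvP _ (Subfield Hk)).
  - apply: contra_not_neq nkw0 => /eqP; rewrite subr_eq0 => /eqP E.
    have := congr1 (fun z : {poly F} => z`_0) E; rewrite coef_map coefC /= => <-; exact: (@sfvP _ (Subfield Hk)).
  - by rewrite rootE hornerD hornerN hornerC -Dw subrr.
  exists m1 => //; apply: leq_trans l1 _; apply: leq_trans (size_polyD _ _) _.
  rewrite geq_max size_map_poly sp size_polyN (leq_trans (size_polyC_leq1 _)) //.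
  case: m Da {lm IH sp} => // -[[r [kr /eqP/size_poly1P [c c0 ->]]]].
  by rewrite rootC (negbTE c0).
have [es' [es1 Hes]] := IH k1 m1 (leq_trans lm1 lm) H1 D1.
(* For each class [e] over [k1] one representative [x] in [k] is fixed, among the squares lying in
   that class; 1 is the default value when there is none. *)
pose good e x := exists w y, [/\ x = w ^+ 2, k (w ^+ 2), w != 0 & k1 y /\ w ^+ 2 = e * y ^+ 2].
have G e : {x : F | (k x /\ x != 0) /\ ((exists x, good e x) -> good e x)}.
  apply: constructive_indefinite_description.
  have [[x gx]|ng] := classic (exists x, good e x).
    by exists x; split=> //; case: gx => w [y [-> kw w1 _]]; rewrite expf_neq0.
  by exists 1; split=> //; split; [exact: sf1 | exact: oner_neq0].
exists (flatten [seq [:: sval (G e); sval (G e) * w0 ^+ 2] | e <- es']); split.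
  move=> e /flatten_mapP [e' _]; case: (G e') => x /= [[kx x0] _].
  rewrite !inE => /orP [] /eqP -> //.
  by split; [apply: sfM | rewrite mulf_neq0 ?expf_neq0].
move=> w Lw kw wn0.
have L1w : adjoin k1 a w.
  apply: adjoin_min Lw; [exact: adjoin_subfield | | exact: adjoin_gen].
  by move=> x kx; apply: adjoin_base; apply: adjoin_base.
have [e [y [ein ky Ew]]] := Hes w L1w (adjoin_base kw) wn0.
case Dx: (G e) => [x [[kx x0] gx]].
have Dx' : sval (G e) = x by rewrite Dx.
have [|w1 [y1 [Ex kw1 w10 [ky1 Ew1]]]] := gx; first by exists (w ^+ 2), w, y.
have [e0 y10] : e != 0 /\ y1 != 0.
  by move: (expf_neq0 2 w10); rewrite Ew1 mulf_eq0 expf_eq0 negb_or /= => /andP.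
have [c [d [kc kd Dy]]] := adjoin_quadratic Hk nkw0 kw0 (sf_div H1 ky ky1).
have Exw : w ^+ 2 = x * (c + d * w0) ^+ 2.
  by rewrite -Dy Ew Ex Ew1 expr_div_n; field; rewrite y10.
(* Expanding [(c + d w0)^2], which lies in [k], puts [2 c d w0] in [k]. As [w0] is not in [k], one
   of [c], [d] is zero, which leaves the classes of [x w0^2] and of [x]. *)
have E2 : 2%:R * (c * d) * w0 = w ^+ 2 / x - c ^+ 2 - d ^+ 2 * w0 ^+ 2.
  by rewrite Exw; field.
have [cd0|cdn] := eqVneq (c * d) 0; last first.
  case: nkw0; have c2 : 2%:R * (c * d) != 0 by rewrite mulf_neq0.
  have -> : w0 = (w ^+ 2 / x - c ^+ 2 - d ^+ 2 * w0 ^+ 2) / (2%:R * (c * d)).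
    by rewrite -E2 mulrAC mulfV // mul1r.
  apply: sf_div => //; last by apply: sfM; [| exact: sf_nat | apply: sfM].
  apply: sfB => //; first by apply: sfB => //; [apply: sf_div | apply: sfX].
  by apply: sfM => //; apply: sfX.
move/eqP: cd0; rewrite mulf_eq0 => /orP [] /eqP z0.
  exists (x * w0 ^+ 2), d; split=> //; last by rewrite Exw z0; ring.
  by apply/flatten_mapP; exists e => //; rewrite Dx' !inE eqxx orbT.
exists x, c; split=> //; last by rewrite Exw z0; ring.
by apply/flatten_mapP; exists e => //; rewrite Dx' !inE eqxx.
Qed.

(** * Norms as symmetric functions of the conjugates *)

Lemma mmap_mesym (R S : comNzRingType) (f : {rmorphism R -> S}) m (v : 'I_m -> S) k :
  mmap f v (mesym m R k) = (mesym m S k).@[v].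
Proof.
rewrite /mesym !rmorph_sum; apply: eq_bigr => h _.
rewrite !rmorph_prod; apply: eq_bigr => i _.
by rewrite /= mevalXU mmapX mmap1U.
Qed.

Lemma symmetric_prod_horner (R : comNzRingType) m (G : {poly R}) :
  \prod_(i < m) (map_poly (@mpolyC m R) G).['X_i] \is symmetric.
Proof.
apply/issymP => s; rewrite rmorph_prod /=.
rewrite [RHS](reindex_inj (@perm_inj _ s)) /=; apply: eq_bigr => i _.
rewrite -horner_map /= -map_poly_comp /=.
rewrite (eq_map_poly (g := @mpolyC m R)); last by move=> c /=; rewrite /msym mmapC.
by rewrite /msym mmapX mmap1U.
Qed.

(** The product is symmetric in the roots, hence a polynomial in the coefficients of [P]. A ring [R]
    is allowed so that the statement serves both for norms of field elements and, with
    [R = {poly k}], for norms of polynomials. *)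
Lemma prod_horner_roots (R : comNzRingType) (S : idomainType) (f : {rmorphism R -> S})
    m (rs : m.-tuple S) (P G : {poly R}) :
  map_poly f P = \prod_(z <- rs) ('X - z%:P) ->
  exists r, f r = \prod_(z <- rs) (map_poly f G).[z].
Proof.
move=> EP; have [t [Et _]] := sym_fundamental (symmetric_prod_horner m G).
exists t.@[fun i : 'I_m => (-1) ^+ i.+1 * P`_(m - i.+1)].
have -> : \prod_(z <- rs) (map_poly f G).[z] =
   mmap f (tnth rs) (\prod_(i < m) (map_poly (@mpolyC m R) G).['X_i]).
  rewrite rmorph_prod big_tuple; apply: eq_bigr => i _ /=.
  rewrite -horner_map /= -map_poly_comp /= mmapX mmap1U.
  by rewrite (eq_map_poly (g := f)) // => c /=; rewrite mmapC.
rewrite -Et /comp_mpoly mevalE [X in _ = mmap f (tnth rs) X]/mmap !rmorph_sum.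
apply: eq_bigr => M _; rewrite !rmorphM; congr (_ * _); first by rewrite /= mmapC.
rewrite /mmap1 !rmorph_prod; apply: eq_bigr => i _.
rewrite !rmorphXn /=; congr (_ ^+ _); rewrite tnth_map tnth_ord_tuple mmap_mesym.
have := mroots_coeff rs (inord i.+1); rewrite -EP coef_map /= inordK ?ltnS //.
by rewrite rmorphM rmorphXn rmorphN1 => ->; rewrite mulrA -exprMn mulrN1 opprK expr1n mul1r.
Qed.

Lemma nat_inj_of_char0 (R : nzRingType) : (forall m, m.+1%:R != 0 :> R) ->
  injective (fun m : nat => m%:R : R).
Proof.
move=> H a b; wlog lt : a b / (a <= b)%N => [W|].
  by case/orP: (leq_total a b) => l E; [|symmetry]; apply: W.
move=> /eqP; rewrite eq_sym -subr_eq0 -natrB // => /eqP E.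
apply/eqP; rewrite eqn_leq lt /= -subn_eq0; case D: (b - a)%N E => [|m] // /eqP.
by rewrite (negbTE (H m)).
Qed.

Lemma frac_mpoly_char0 u m : m.+1%:R != 0 :> {fraction {mpoly rat[u]}}.
Proof.
rewrite -(rmorph_nat (@tofrac {mpoly rat[u]})) tofrac_eq0 -(rmorph_nat (@mpolyC u rat)) mpolyC_eq0.
by rewrite Num.Theory.pnatr_eq0.
Qed.

Lemma minpoly_exists_rmorph (k Om : fieldType) (e : {rmorphism k -> Om}) a :
  algebraicOver e a -> exists P, is_minpoly e P a.
Proof.
case=> p; have [s] := ubnP (size p); elim: s p => // s IH p sp p0 rp.
have [[q [q0 rq lt]]|H] := classic (exists q, [/\ q != 0, root (map_poly e q) a & (size q < size p)%N]).
  by apply: (IH q) => //; apply: leq_trans lt _.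
have l0 : lead_coef p != 0 by rewrite lead_coef_eq0.
exists ((lead_coef p)^-1 *: p); split; first by rewrite monicE lead_coefZ mulVf.
move=> q; rewrite dvdpZl ?invr_eq0 //; apply/idP/idP => [rq|/dvdpP [r ->]]; last first.
  by rewrite rmorphM rootM rp orbT.
rewrite /dvdp; apply: contraT => m0; case: H; exists (q %% p); split=> //; last by rewrite ltn_modp.
move: rq; rewrite {1}(divp_eq q p) rmorphD rmorphM !rootE hornerD hornerM.
by move/eqP: rp => ->; rewrite mulr0 add0r.
Qed.

(** A common root [z] of [f] and [f'] gives [c = - d z] and [b = d z^2], hence [c^2 = b d]. Since
    [d] may be zero, the degree may be one; a constant [f] would have [c = d = 0]. *)
Lemma separable_quadratic (F : closedFieldType) (b c d : F) : 2%:R != 0 :> F ->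
  c ^+ 2 != b * d ->
  let f := b%:P + 2%:R *: (c *: 'X) + d *: 'X^2 in separable_poly f /\ (1 < size f)%N.
Proof.
move=> ch2 disc f; split.
  rewrite unlock; apply/coprimepP => g gf gf'.
  apply: NNPP => /negP; rewrite -size_poly_eq1 => /closed_rootP [z rz].
  have := root_dvdp gf rz; have := root_dvdp gf' rz.
  rewrite /f !rootE !derivD derivC !derivZ derivX derivXn !hornerE /= !hornerE.
  move=> /eqP E1 /eqP E2; case/eqP: disc.
  have E3 : c = - (d * z).
    by apply: (mulfI ch2); apply/eqP; rewrite -subr_eq0; apply/eqP; rewrite -[RHS]E1; ring.
  have E4 : b = d * z ^+ 2.
    by apply/eqP; rewrite -subr_eq0; apply/eqP; rewrite -[RHS]E2 E3; ring.
  by rewrite E3 E4; ring.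
rewrite ltnNge; apply: contraNN disc => sf.
have c0 : c = 0.
  have := nth_default 0 sf; rewrite /f !coefD !coefZ coefC coefX coefXn /= !mulr0 !mulr1 addr0 add0r.
  by move/eqP; rewrite mulf_eq0 (negbTE ch2) => /eqP.
have d0 : d = 0.
  have := nth_default 0 (leq_trans sf (leqnSn 1)).
  by rewrite /f !coefD !coefZ coefC coefX coefXn /= !mulr0 !mulr1 !add0r.
by rewrite c0 d0 expr0n mulr0.
Qed.

Lemma separable_prod (F : fieldType) (I : eqType) (r : seq I) (g : I -> {poly F}) :
  uniq r -> (forall i, i \in r -> separable_poly (g i)) ->
  (forall i j, i \in r -> j \in r -> i != j -> coprimep (g i) (g j)) ->
  separable_poly (\prod_(i <- r) g i).
Proof.
elim: r => [|i r IH] /=; first by rewrite big_nil unlock derivC coprimep0 eqpxx.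
case/andP=> ni Ur sg cg; rewrite big_cons separable_mul sg ?mem_head //= IH //=; first last.
- by move=> a b ar br; apply: cg; rewrite inE ?ar ?br orbT.
- by move=> a ar; apply: sg; rewrite inE ar orbT.
rewrite coprimep_sym big_seq; elim/big_ind: _ => [|p q cp cq|j jr].
- by rewrite coprime1p.
- by rewrite coprimepMl cp.
by apply: cg; rewrite ?mem_head ?inE ?jr ?orbT //; apply: contraNneq ni => <-.
Qed.

Lemma rmorph_quadratic (A B : comNzRingType) (rho : {rmorphism A -> B}) b c d s :
  rho (b + 2%:R * (c * s) + d * s ^+ 2) = rho b + 2%:R * (rho c * rho s) + rho d * rho s ^+ 2.
Proof. by rewrite !rmorphD !rmorphM rmorph_nat. Qed.

(** Two variables are at work: the inner one, in the coefficient ring [{poly k}], is the variable of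
    the norm; the outer one stands for the conjugate [z], so that [s] becomes [X + j z]. *)
Lemma norm_quadratic_poly (k F : fieldType) (iota : {rmorphism k -> F}) m (rs : m.-tuple F)
    (P bh ch dh : {poly k}) (j : nat) :
  map_poly iota P = \prod_(z <- rs) ('X - z%:P) ->
  let ev z p := (map_poly iota p).[z] in
  exists hh, map_poly iota hh = \prod_(z <- rs)
    (((ev z bh)%:P + 2%:R *: (ev z ch *: 'X) + ev z dh *: 'X^2) \Po ('X + (j%:R * z)%:P)).
Proof.
move=> Drs ev.
  pose s : {poly {poly k}} := ('X)%:P + j%:R *: 'X.
  pose lft (p : {poly k}) : {poly {poly k}} := map_poly polyC p.
  pose G := lft bh + 2%:R * (lft ch * s) + lft dh * s ^+ 2.
  have EP : map_poly (map_poly iota) (lft P) =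
      \prod_(z <- map_tuple polyC rs) ('X - z%:P).
    rewrite /lft -map_poly_comp (eq_map_poly (g := polyC \o iota)); last first.
      by move=> y /=; rewrite map_polyC.
    by rewrite map_poly_comp Drs map_prod_XsubC big_map.
  have [hh Dhh] := prod_horner_roots G EP; exists hh; rewrite Dhh big_map.
  apply: eq_bigr => z _; rewrite /G.
  pose rho : {rmorphism {poly {poly k}} -> {poly F}} :=
    horner_eval z%:P \o map_poly (map_poly iota).
  have lz p : rho (lft p) = (ev z p)%:P.
    rewrite /= /horner_eval /lft -map_poly_comp (eq_map_poly (g := polyC \o iota)); last first.
      by move=> y /=; rewrite map_polyC.
    by rewrite map_poly_comp horner_map.
  have sz : rho s = 'X + (j%:R * z)%:P.
    rewrite /= /horner_eval /s rmorphD /= map_polyZ map_polyC /= !map_polyX.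
    by rewrite hornerD hornerC hornerZ hornerX rmorph_nat polyCM polyC_natr.
  rewrite -[LHS]/(rho G) /G rmorph_quadratic !lz sz.
  rewrite !comp_polyD !comp_polyZ comp_polyC comp_polyX comp_Xn_poly.
  by rewrite -!mul_polyC polyC_natr.
Qed.

Lemma horner_map_line (k F : fieldType) (iota : {rmorphism k -> F}) c (j : nat) z :
  (map_poly iota (c%:P + j%:R *: 'X)).[z] = iota c + j%:R * z.
Proof.
by rewrite rmorphD /= map_polyC map_polyZ map_polyX !hornerE rmorph_nat.
Qed.

Section NonsquareValue.
Variables (F : closedFieldType) (u : nat).
Notation kk := {fraction {mpoly rat[u]}}.
Variables (iota : {rmorphism kk -> F}) (beta : F) (K : F -> Prop).
Hypothesis beta_alg : algebraicOver iota beta.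
Hypothesis K_def : forall x, K x <-> adjoin (fun z => exists r, z = iota r) beta x.

Let ev (z : F) : {rmorphism {poly kk} -> F} := horner_eval z \o map_poly iota.

Lemma base_char0 m : m.+1%:R != 0 :> F.
Proof. by rewrite -(rmorph_nat iota) fmorph_eq0 frac_mpoly_char0. Qed.

Lemma base_subfield : is_subfield K.
Proof.
have H := @adjoin_subfield _ (fun z => exists r, z = iota r) beta.
split; first by apply/K_def; apply: (sf1 H).
  by move=> x y /K_def Hx /K_def Hy; apply/K_def; apply: (sfB H).
by move=> x y /K_def Hx /K_def Hy; apply/K_def; apply: (sf_div H).
Qed.

Lemma base_poly x : K x -> exists g, x = ev beta g.
Proof.
have [P Pb] := minpoly_exists_rmorph beta_alg.
move/K_def => H; apply: (adjoin_min (is_minpoly_range_subfield Pb) _ _ H).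
  by move=> _ [r ->]; exists r%:P; rewrite map_polyC hornerC.
by exists 'X; rewrite map_polyX hornerX.
Qed.

Lemma base_ev g : K (ev beta g).
Proof.
apply: (sf_horner base_subfield); last by apply/K_def; apply: adjoin_gen.
by move=> i; rewrite coef_map; apply/K_def; apply: adjoin_base; exists g`_i.
Qed.

(* The norm to the ground field of the values at [x + j * beta], as a polynomial in [x],
   is separable for a suitable integer [j], hence takes infinitely many square classes. *)
Lemma nonsquare_value n alpha (b c d : F) : algebraic_of_degree K alpha n ->
  K b -> K c -> K d -> c ^+ 2 != b * d ->
  exists2 s, K s & forall w, adjoin K alpha w -> w ^+ 2 <> b + 2%:R * (c * s) + d * s ^+ 2.
Proof.
move=> Da Kb Kc Kd disc; apply: NNPP => Hno.
have HK := base_subfield.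
have ch2 : 2%:R != 0 :> F := base_char0 1.
have Hsq s : K s -> exists2 w, adjoin K alpha w & w ^+ 2 = b + 2%:R * (c * s) + d * s ^+ 2.
  move=> Ks; apply: NNPP => H; apply: Hno; exists s => // w Lw E.
  by apply: H; exists w.
have [es [es1 Hes]] := finite_square_classes ch2 HK Da.
have [P Pb] := minpoly_exists_rmorph beta_alg.
have [rs [Urs Drs]] := minpoly_split (@frac_mpoly_char0 u) Pb.
have [_ evb] := Pb.
have rsP z : z \in rs -> is_minpoly iota P z.
  by move=> zr; apply: (is_minpoly_conj Pb); rewrite Drs root_prod_XsubC.
have br : beta \in rs.
  by rewrite -root_prod_XsubC -Drs evb dvdpp.
have conj g h z : z \in rs -> ev beta g = ev beta h -> ev z g = ev z h.
  move=> /rsP [_ Pz] /eqP; rewrite -subr_eq0 -rmorphB => E.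
  apply/eqP; rewrite -subr_eq0 -rmorphB; move: E.
  by rewrite /= /horner_eval -!rootE evb Pz.
have conj0 g z : z \in rs -> ev beta g != 0 -> ev z g != 0.
  move=> zr; apply: contra_neq => E; have [_ Pz] := rsP z zr.
  have : root (map_poly iota g) z by rewrite rootE; apply/eqP; exact: E.
  by rewrite Pz -evb rootE => /eqP.
have [bh Db] := base_poly Kb; have [ch Dc] := base_poly Kc; have [dh Dd] := base_poly Kd.
pose f z := (ev z bh)%:P + 2%:R *: (ev z ch *: 'X) + ev z dh *: 'X^2.
have fdisc z : z \in rs -> ev z ch ^+ 2 != ev z bh * ev z dh.
  move=> zr; rewrite -subr_eq0 -rmorphXn -rmorphM -rmorphB; apply: conj0 => //.
  by rewrite rmorphB rmorphXn rmorphM -Db -Dc -Dd subr_eq0.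
have fsep z : z \in rs -> separable_poly (f z) /\ (1 < size (f z))%N.
  by move=> zr; apply: separable_quadratic => //; apply: fdisc.
have f0 z : z \in rs -> f z != 0.
  by case/fsep => _ s1; rewrite -size_poly_gt0 ltnW.
pose R z := sval (closed_field_poly_normal (f z)).
have DR z : f z = lead_coef (f z) *: \prod_(r <- R z) ('X - r%:P).
  by rewrite /R; case: closed_field_poly_normal.
(* A root [r] of [f z] and a root [r'] of [f z'] give the same root [r - j z = r' - j z'] of the
   shifted polynomials exactly when this linear factor vanishes at [j]. Off the zeros of [Q] the
   shifts are pairwise coprime. *)
pose Q := \prod_(z <- rs) \prod_(z' <- rs | z' != z) \prod_(r <- R z) \prod_(r' <- R z')
  ((r - r')%:P + (z' - z) *: 'X).
have Q0 : Q != 0.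
  rewrite prodf_seq_neq0; apply/allP => z zr /=.
  rewrite prodf_seq_neq0; apply/allP => z' z'r /=; apply/implyP => ne.
  rewrite prodf_seq_neq0; apply/allP => r rr /=.
  rewrite prodf_seq_neq0; apply/allP => r' rr' /=.
  rewrite -size_poly_gt0 addrC size_addl size_scale ?subr_eq0 // size_polyX //.
  by rewrite (leq_ltn_trans (size_polyC_leq1 _)).
have [j Hj] := poly_nat_nonroot (nat_inj_of_char0 base_char0) Q0.
pose g z := f z \Po ('X + (j%:R * z)%:P).
have gsep z : z \in rs -> separable_poly (g z).
  move=> zr; have [fz _] := fsep z zr; move: fz; rewrite !unlock.
  move/Bezout_eq1_coprimepP => [[U V] /= E]; apply/Bezout_eq1_coprimepP.
  exists (U \Po ('X + (j%:R * z)%:P), V \Po ('X + (j%:R * z)%:P)) => /=.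
  have dX : ('X + (j%:R * z)%:P : {poly F})^`() = 1 by rewrite derivD derivX derivC addr0.
  rewrite /g deriv_comp dX mulr1 -!comp_polyM -comp_polyD E.
  by rewrite comp_polyC.
have gcop z z' : z \in rs -> z' \in rs -> z != z' -> coprimep (g z) (g z').
  move=> zr z'r ne; apply/coprimepP => d' dg dg'; apply: NNPP => /negP.
  rewrite -size_poly_eq1 => /closed_rootP [t rt].
  have := root_dvdp dg rt; have := root_dvdp dg' rt.
  have lin q : ('X + q%:P : {poly F}).[t] = t + q by rewrite hornerD hornerX hornerC.
  rewrite /g !rootE !horner_comp !lin.
  set r := t + j%:R * z; set r' := t + j%:R * z' => rr' rr.
  have fR y q : y \in rs -> (f y).[q] == 0 -> q \in R y.
    move=> yr; rewrite DR hornerZ mulf_eq0 lead_coef_eq0 (negbTE (f0 _ yr)) /=.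
    by rewrite -rootE root_prod_XsubC.
  case/negP: Hj; rewrite /Q horner_prod prodf_seq_eq0; apply/hasP; exists z => //=.
  rewrite horner_prod prodf_seq_eq0; apply/hasP; exists z' => //=; rewrite eq_sym ne /=.
  rewrite horner_prod prodf_seq_eq0; apply/hasP; exists r => /=; first exact: fR.
  rewrite horner_prod prodf_seq_eq0; apply/hasP; exists r' => /=; first exact: fR.
  by rewrite hornerD hornerC hornerZ hornerX /r /r'; apply/eqP; ring.
have hsep : separable_poly (\prod_(z <- rs) g z) by apply: separable_prod.
have hsize : (1 < size (\prod_(z <- rs) g z)%R)%N.
  have d0 : \prod_(z <- rs) g z != 0.
    by move: hsep; apply: contraTneq => ->; rewrite unlock deriv0 coprimep0 eqp01.
  have sb : (1 < size (g beta))%N by rewrite /g size_comp_poly2 ?size_XaddC //; case: (fsep _ br).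
  by apply: leq_trans sb _; apply: dvdp_leq d0 _; rewrite (big_rem beta) //= dvdp_mulr.
have [hh Dh] : exists hh : {poly kk}, map_poly iota hh = \prod_(z <- rs) g z.
  exact: (norm_quadratic_poly bh ch dh j Drs).
have norm (p : {poly kk}) : {r | iota r = \prod_(z <- rs) ev z p}.
  apply: constructive_indefinite_description; exact: prod_horner_roots Drs.
have lift (y : F) : {p | K y -> y = ev beta p}.
  apply: constructive_indefinite_description; have [/base_poly [p Dp]|nK] := classic (K y).
    by exists p.
  by exists 0.
have hhsep : coprimep hh hh^`().
  by move: hsep; rewrite unlock -Dh deriv_map coprimep_map.
have hhsize : (1 < size hh)%N by move: hsize; rewrite -Dh size_map_poly.
(* The classes in [es] belong to [K]. Their norms belong to the ground field, and those are the
   classes that the values of the norm polynomial have to avoid. *)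
have [e|x [hx0 Hx]] := @frac_poly_avoids_square_classes u hh
     [seq sval (norm (sval (lift e))) | e <- es] hhsep hhsize.
  case/mapP => e' ein ->; have [Ke' e'0] := es1 _ ein.
  rewrite -(fmorph_eq0 iota) (svalP (norm _)) prodf_seq_neq0; apply/allP => z zr /=.
  by apply: conj0 => //; rewrite -(svalP (lift e') Ke').
pose s := iota x%:~R + j%:R * beta.
have Ks : K s.
  by rewrite /s -horner_map_line; exact: base_ev.
have fbe : f beta = b%:P + 2%:R *: (c *: 'X) + d *: 'X^2.
  by rewrite /f -Db -Dc -Dd.
have fb y : (f beta).[y] = b + 2%:R * (c * y) + d * y ^+ 2.
  by rewrite fbe !hornerE.
have hval : iota hh.[x%:~R] = \prod_(z <- rs) (f z).[iota x%:~R + j%:R * z].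
  rewrite -horner_map Dh horner_prod; apply: eq_bigr => z _.
  by rewrite /g horner_comp; congr (f z).[_]; rewrite hornerD hornerX hornerC.
have fs0 : (f beta).[s] != 0.
  move: hx0; rewrite -(fmorph_eq0 iota) hval prodf_seq_neq0 => /allP /(_ _ br).
  by [].
have [w Lw Ew] := Hsq s Ks; rewrite -fb in Ew.
have Kw : K (w ^+ 2).
  rewrite Ew; apply: (sf_horner HK) => //.
  move=> i; rewrite fbe !coefD !coefZ coefC coefX coefXn.
  apply: (sfD HK); first apply: (sfD HK).
  - by case: eqP => _ //; apply: (sf0 HK).
  - by apply: (sfM HK); [exact: sf_nat HK _ | apply: (sfM HK) => //; exact: sf_nat HK _].
  - by apply: (sfM HK) => //; exact: sf_nat HK _.
have w0 : w != 0 by move: fs0; rewrite -Ew expf_eq0.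
have [e [y [ein Ky E]]] := Hes w Lw Kw w0.
have Ke := proj1 (es1 e ein).
(* From [f(s) = w^2 = e y^2] in [K], taking norms gives the excluded value [N(e) N(y)^2]. The factor
   at each [z] is obtained by transporting the equation at [beta]. *)
case: (Hx (sval (norm (sval (lift e)))) (sval (norm (sval (lift y))))); first exact: map_f.
apply: (fmorph_inj iota); rewrite hval rmorphM rmorphXn !(svalP (norm _)) -prodrXl -big_split /=.
rewrite big_seq [RHS]big_seq; apply: eq_bigr => z zr.
pose t : {poly kk} := (x%:~R)%:P + j%:R *: 'X.
have evt z' : ev z' t = iota x%:~R + j%:R * z' by exact: horner_map_line.
pose v := bh + 2%:R * (ch * t) + dh * t ^+ 2.
have evv z' : ev z' v = (f z').[iota x%:~R + j%:R * z'].
  rewrite /v rmorph_quadratic evt /f.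
  by rewrite !hornerD hornerC !hornerZ hornerX hornerXn.
rewrite -evv; have -> : ev z v = ev z (sval (lift e) * sval (lift y) ^+ 2).
  apply: conj => //; rewrite evv -/s -Ew E rmorphM rmorphXn.
  by rewrite -(svalP (lift e) Ke) -(svalP (lift y) Ky).
by rewrite rmorphM rmorphXn.
Qed.
End NonsquareValue.

(** * Values of rational functions *)

Definition cst (F : fieldType) (c : F) : {fraction {poly F}} := c%:P%:F.
HB.instance Definition _ (F : fieldType) :=
  GRing.RMorphism.copy (@cst F) (@tofrac _ \o @polyC F).
Arguments cst : simpl never.

Lemma mpoly_at_paramE (F : fieldType) N (p : {mpoly F[N]}) phi :
  mpoly_at_param p phi = mmap (@cst F) phi p.
Proof. by []. Qed.

Lemma map_cst_X (F : fieldType) (p : {poly F}) : (map_poly (@cst F) p).['X%:F] = p%:F.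
Proof.
by rewrite (map_poly_comp (@tofrac {poly F}) polyC) horner_map /= -[_.['X]]/(p \Po 'X) comp_polyXr.
Qed.

Lemma frac_eq (R : idomainType) (a b c d : R) : b != 0 -> d != 0 ->
  (a%:F / b%:F = c%:F / d%:F) <-> a * d = c * b.
Proof.
move=> b0 d0; split=> [/eqP|/eqP].
  by rewrite eqr_div ?tofrac_eq0 // -!tofracM tofrac_eq => /eqP.
by rewrite -tofrac_eq !tofracM -eqr_div ?tofrac_eq0 // => /eqP.
Qed.

Lemma frac_coprime (F : fieldType) (r : {fraction {poly F}}) :
  exists p q : {poly F}, [/\ q != 0, coprimep p q & r = p%:F / q%:F].
Proof.
have [a [b [b0 ->]]] := fracP r; set g := gcdp a b.
have g0 : g != 0 by rewrite gcdp_eq0 negb_and b0 orbT.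
have ga : a = (a %/ g) * g by rewrite divpK ?dvdp_gcdl.
have gb : b = (b %/ g) * g by rewrite divpK ?dvdp_gcdr.
have b1 : b %/ g != 0 by apply: contraNneq b0 => E; rewrite gb E mul0r.
exists (a %/ g), (b %/ g); split=> //; first by apply: coprimep_div_gcd; rewrite b0 orbT.
by apply/(frac_eq _ _ b0 b1); rewrite [X in X * _ = _]ga [X in _ = _ * X]gb; ring.
Qed.

Section RatfunValue.
Variables (F E : fieldType) (e : {rmorphism F -> E}).
Implicit Types (r : {fraction {poly F}}) (s v : E).
Local Notation rv := (ratfun_value e).

Lemma map_neq0_neq0 (q : {poly F}) s : (map_poly e q).[s] != 0 -> q != 0.
Proof. by apply: contraNneq => ->; rewrite rmorph0 horner0. Qed.

Lemma rv_frac p q s : (map_poly e q).[s] != 0 ->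
  rv (p%:F / q%:F) s ((map_poly e p).[s] / (map_poly e q).[s]).
Proof. by exists p, q. Qed.

Lemma rv_eval p q s v : q != 0 -> rv (p%:F / q%:F) s v ->
  v * (map_poly e q).[s] = (map_poly e p).[s].
Proof.
move=> q0 [p' [q' [E1 q'0 ->]]].
have q'0' := map_neq0_neq0 q'0; move/(frac_eq _ _ q0 q'0'): E1 => E1.
by apply: (mulIf q'0); rewrite mulrAC mulfVK // -!hornerM -!rmorphM E1 .
Qed.

Lemma rv_fun r s v v' : rv r s v -> rv r s v' -> v = v'.
Proof.
move=> [p [q [-> q0 ->]]] /(rv_eval (map_neq0_neq0 q0)) <-.
by rewrite mulfK.
Qed.

Lemma rv_poly p s : rv p%:F s (map_poly e p).[s].
Proof. by exists p, 1; rewrite (rmorph1 (map_poly e)) (hornerC 1) oner_neq0 tofrac1 !divr1. Qed.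

Lemma rv_cst c s : rv (cst c) s (e c).
Proof. by have := rv_poly c%:P s; rewrite map_polyC hornerC. Qed.

Lemma rv_X s : rv 'X%:F s s.
Proof. by have := rv_poly 'X s; rewrite map_polyX hornerX. Qed.

Lemma rv_mul r r' s v v' : rv r s v -> rv r' s v' -> rv (r * r') s (v * v').
Proof.
move=> [p [q [-> q0 ->]]] [p' [q' [-> q'0 ->]]]; exists (p * p'), (q * q').
by rewrite !rmorphM !hornerM mulf_neq0 // !mulf_div.
Qed.

Lemma rv_add r r' s v v' : rv r s v -> rv r' s v' -> rv (r + r') s (v + v').
Proof.
move=> [p [q [-> q0 ->]]] [p' [q' [-> q'0 ->]]]; exists (p * q' + p' * q), (q * q').
have q0' := map_neq0_neq0 q0; have q'0' := map_neq0_neq0 q'0.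
by rewrite !rmorphD !rmorphM hornerD !hornerM mulf_neq0 // !addf_div ?tofrac_eq0.
Qed.

Lemma rv_opp r s v : rv r s v -> rv (- r) s (- v).
Proof.
move=> /(rv_mul (rv_cst (-1) s)); rewrite rmorphN1 mulN1r.
by rewrite rmorphN1 mulN1r.
Qed.

Lemma rv_inv r s v : v != 0 -> rv r s v -> rv r^-1 s v^-1.
Proof.
move=> v0 [p [q [-> q0 Dv]]]; exists q, p; rewrite Dv !invf_div; split=> //.
by apply: contraNneq v0 => H; rewrite Dv H mul0r.
Qed.

Lemma rv_exp r s v n : rv r s v -> rv (r ^+ n) s (v ^+ n).
Proof.
move=> H; elim: n => [|n IH]; last by rewrite !exprS; apply: rv_mul.
by have := rv_cst 1 s; rewrite !rmorph1.
Qed.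

Lemma rv_sum I (l : seq I) (P : pred I) (f : I -> {fraction {poly F}}) (g : I -> E) s :
  (forall i, P i -> rv (f i) s (g i)) ->
  rv (\sum_(i <- l | P i) f i) s (\sum_(i <- l | P i) g i).
Proof.
move=> H; elim/big_ind2: _ => //; last by move=> *; apply: rv_add.
by have := rv_cst 0 s; rewrite !rmorph0.
Qed.

Lemma rv_mpoly N (p : {mpoly F[N]}) phi (x : 'I_N -> E) s :
  (forall j, rv (phi j) s (x j)) -> rv (mpoly_at_param p phi) s (mmap e x p).
Proof.
move=> H; rewrite mpoly_at_paramE /mmap; apply: rv_sum => m _.
apply: rv_mul; first exact: rv_cst.
rewrite /mmap1; elim/big_ind2: _ => [|*|i _].
- by have := rv_cst 1 s; rewrite !rmorph1.
- exact: rv_mul.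
- exact: rv_exp.
Qed.

Definition transcendental s := forall p : {poly F}, p != 0 -> (map_poly e p).[s] != 0.

Lemma rv_eq0 r s : transcendental s -> rv r s 0 -> r = 0.
Proof.
move=> ts; have [p [q [q0 ->]]] := fracP r => /(rv_eval q0) /esym/eqP.
rewrite mul0r; have [->|p0] := eqVneq p 0; first by rewrite tofrac0 mul0r.
by rewrite (negbTE (ts _ p0)).
Qed.

(** The simple extension [F(s)] inside [E]. *)
Definition gen s v := exists r, rv r s v.

Lemma gen_subfield s : is_subfield (gen s).
Proof.
split=> [|x y [r Hr] [r' Hr']|x y [r Hr] [r' Hr']].
- by exists (cst 1); rewrite -(rmorph1 e); apply: rv_cst.
- by exists (r - r'); apply: rv_add => //; apply: rv_opp.
have [->|y0] := eqVneq y 0; last by exists (r / r'); apply: rv_mul => //; apply: rv_inv.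
by exists (cst 0); rewrite invr0 mulr0 -(rmorph0 e); apply: rv_cst.
Qed.

Lemma gen_cst s c : gen s (e c).
Proof. by exists (cst c); apply: rv_cst. Qed.

Lemma gen_self s : gen s s.
Proof. by exists 'X%:F; apply: rv_X. Qed.

Lemma gen_mpoly s N (p : {mpoly F[N]}) (x : 'I_N -> E) :
  (forall j, gen s (x j)) -> gen s (mmap e x p).
Proof.
move=> H; have Hs := gen_subfield s; apply: (sf_sum Hs) => m _; apply: (sfM Hs) (gen_cst _ _) _.
by apply: (sf_prod Hs) => i _; apply: (sfX Hs).
Qed.
End RatfunValue.

Lemma transcendental_X (F : fieldType) : transcendental (@cst F) 'X%:F.
Proof. by move=> p p0; rewrite map_cst_X tofrac_eq0. Qed.

(** [F] is algebraically closed, so [p(y)] is a constant times a product of factors [y - z], none of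
    which is zero. *)
Lemma transcendental_nonconst (F : closedFieldType) (y : {fraction {poly F}}) :
  (forall c, y <> cst c) -> transcendental (@cst F) y.
Proof.
move=> H p p0; have [rs ->] := closed_field_poly_normal p.
rewrite map_polyZ hornerZ mulf_neq0 ?fmorph_eq0 ?lead_coef_eq0 //.
rewrite rmorph_prod horner_prod prodf_seq_neq0; apply/allP => z _ /=.
by rewrite map_polyXsubC hornerXsubC subr_eq0; apply/eqP/H.
Qed.

Lemma rv_cofinite (F : fieldType) (r : {fraction {poly F}}) :
  exists2 q : {poly F}, q != 0 & forall s, q.[s] != 0 -> exists v, ratfun_value id r s v.
Proof.
have [p [q [q0 ->]]] := fracP r; exists q => // s qs.
exists (p.[s] / q.[s]); have := @rv_frac F F idfun p q s.
by rewrite !map_poly_id //; apply.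
Qed.

Lemma rv_zeros (F : fieldType) (r : {fraction {poly F}}) : r != 0 ->
  exists2 p : {poly F}, p != 0 & forall s, ratfun_value id r s 0 -> p.[s] = 0.
Proof.
have [p [q [q0 ->]]] := fracP r => r0; exists p.
  by apply: contraNneq r0 => ->; rewrite tofrac0 mul0r.
move=> s /(@rv_eval F F idfun _ _ _ _ q0).
by rewrite mul0r map_poly_id.
Qed.

Lemma rv_mpoly_id (F : fieldType) N (p : {mpoly F[N]}) phi (x : 'rV[F]_N) s :
  param_point phi s x -> ratfun_value id (mpoly_at_param p phi) s p.@[x 0].
Proof. by move=> H; apply: (@rv_mpoly F F idfun). Qed.

Lemma poly_size2 (R : nzRingType) (p : {poly R}) : (size p <= 2)%N -> p = p`_1 *: 'X + (p`_0)%:P.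
Proof.
move=> sp; apply/polyP => i; rewrite coefD coefC coefZ coefX.
case: i => [|[|i]] /=; rewrite ?mulr0 ?add0r ?mulr1 ?addr0 // nth_default //.
by rewrite (leq_trans sp).
Qed.

Lemma homogenization (Om : fieldType) (P : {poly Om}) (a b : Om) e :
  (size P <= e.+1)%N -> b != 0 ->
  \sum_(i < e.+1) P`_i * a ^+ i * b ^+ (e - i) = P.[a / b] * b ^+ e.
Proof.
move=> sP b0; rewrite (horner_coef_wide _ sP) mulr_suml; apply: eq_bigr => i _.
rewrite expr_div_n -!mulrA; congr (_ * (_ * _)).
have ie : (i <= e)%N by rewrite -ltnS.
have -> : b ^+ e = b ^+ i * b ^+ (e - i) by rewrite -exprD subnKC.
by rewrite mulKf // expf_neq0.
Qed.

(* Write [tau = A/B] and [X = p(tau)/q(tau)] in lowest terms and let [e] be the larger of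
   the degrees of [p] and [q]. Then [sum_i (p_i - q_i X) A^i B^(e-i) = 0], hence [B]
   divides [p_e - q_e X] and [A] divides [p_0 - q_0 X]. *)
Lemma gen_moebius (F : fieldType) (tau : {fraction {poly F}}) :
  gen (@cst F) tau 'X%:F ->
  exists a b c d : F, [/\ a * d - b * c != 0, c *: 'X + d%:P != 0
    & tau = (a *: 'X + b%:P)%:F / (c *: 'X + d%:P)%:F].
Proof.
case=> r Hr; have [p [q [q0 cpq Dr]]] := frac_coprime r.
have [A [B [B0 cAB Dt]]] := frac_coprime tau.
move: Hr; rewrite Dr => /(rv_eval q0) E.
have BF0 : B%:F != 0 by rewrite tofrac_eq0.
pose e := (maxn (size p) (size q)).-1.
have se : e.+1 = maxn (size p) (size q).
  by rewrite prednK // leq_max orbC size_poly_gt0 q0.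
pose l i : {poly F} := (p`_i)%:P - q`_i *: 'X.
have l0 i : l i = 0 -> p`_i = 0 /\ q`_i = 0.
  move=> E0; have := congr1 (fun z : {poly F} => z`_0) E0.
  have := congr1 (fun z : {poly F} => z`_1) E0.
  rewrite /l !coefB !coefZ !coefX ![(_%:P)`__]coefC ?coef0 /= mulr0 mulr1 subr0 sub0r.
  by move/eqP; rewrite oppr_eq0 => /eqP -> ->.
have S : \sum_(i < e.+1) l i * A ^+ i * B ^+ (e - i) = 0.
  apply/eqP; rewrite -tofrac_eq0 rmorph_sum /=.
  pose PP := map_poly (@cst F) p - 'X%:F *: map_poly (@cst F) q.
  have sP : (size PP <= e.+1)%N.
    rewrite se (leq_trans (size_polyD _ _)) // size_polyN geq_max.
    rewrite size_map_poly leq_maxl (leq_trans (size_scale_leq _ _)) //.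
    by rewrite size_map_poly leq_maxr.
  rewrite (eq_bigr (fun i : 'I_e.+1 => PP`_i * A%:F ^+ i * B%:F ^+ (e - i))) => [|i _].
    rewrite (homogenization _ sP BF0) -Dt hornerD hornerN hornerZ E subrr mul0r //.
  rewrite (tofracM (_ * _)) (tofracM (l i)) !tofracXn; congr (_ * _ * _).
  by rewrite /PP coefB coefZ !coef_map /= /cst tofracB -mul_polyC mulrC tofracM.
have le0 : l e != 0.
  apply/eqP => /l0 [pe qe].
  have [le|lt] := leqP (size p) (size q).
    move: se; rewrite (maxn_idPr le) => se; case/eqP: q0; apply/eqP.
    by rewrite -lead_coef_eq0 /lead_coef -se /= qe.
  move: se; rewrite (maxn_idPl (ltnW lt)) => se.
  have p0 : p != 0 by rewrite -size_poly_gt0 -se.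
  by case/eqP: p0; apply/eqP; rewrite -lead_coef_eq0 /lead_coef -se /= pe.
have l00 : l 0 != 0.
  apply/eqP => /l0 [p0 qz].
  have rp : root p 0 by rewrite rootE horner_coef0 p0.
  have rq : root q 0 by rewrite rootE horner_coef0 qz.
  by have := coprimep_root cpq rp; rewrite -rootE rq.
have sl i : (size (l i) <= 2)%N.
  rewrite (leq_trans (size_polyD _ _)) // geq_max size_polyN (leq_trans (size_polyC_leq1 _)) //.
  by rewrite (leq_trans (size_scale_leq _ _)) // size_polyX.
have sB : (size B <= 2)%N.
  apply: leq_trans (sl e); apply: dvdp_leq le0 _.
  rewrite -(@Gauss_dvdpl _ _ (A ^+ e) _) ?coprimep_expr 1?coprimep_sym //.
  move: S; rewrite big_ord_recr /= subnn expr0 mulr1 addrC => /eqP.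
  rewrite addr_eq0 => /eqP ->; rewrite -mulN1r dvdp_mull //.
  elim/big_ind: _ => [|*|i _]; [exact: dvdp0 | exact: dvdp_add |].
  have : (0 < e - i)%N by rewrite subn_gt0.
  by case: (e - i)%N => // k _; rewrite dvdp_mull // exprS dvdp_mulr.
have sA : (size A <= 2)%N.
  apply: leq_trans (sl 0); apply: dvdp_leq l00 _.
  rewrite -(@Gauss_dvdpl _ _ (B ^+ e) _) ?coprimep_expr //.
  move: S; rewrite big_ord_recl /= subn0 expr0 mulr1 => /eqP.
  rewrite addr_eq0 => /eqP ->; rewrite -mulN1r dvdp_mull //.
  elim/big_ind: _ => [|*|i _]; [exact: dvdp0 | exact: dvdp_add |].
  by rewrite dvdp_mulr // dvdp_mull // exprS dvdp_mulr.
exists A`_1, A`_0, B`_1, B`_0; rewrite -!poly_size2 //; split=> //.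
(* A zero determinant makes [A] and [B] proportional. Being coprime they are then constants, so
   [tau] is a constant [v], and [X q(v) = p(v)] forces [p] and [q] to share the root [v]. *)
apply/eqP => det.
have cA : B`_1 *: A = A`_1 *: B.
  rewrite [A in LHS]poly_size2 // [B in RHS]poly_size2 // !scalerDr !scalerA.
  move/eqP: det; rewrite subr_eq0 => /eqP det.
  by rewrite [A`_1 * B`_1]mulrC -!(mul_polyC _ _%:P) -!polyCM det [B`_1 * A`_0]mulrC.
have c0 : B`_1 = 0.
  apply: NNPP => /eqP c0.
  have dBA : B %| A.
    have -> : A = (A`_1 / B`_1) *: B by rewrite mulrC -scalerA -cA scalerA mulVf // scale1r.
    by rewrite -mul_polyC dvdp_mull.
  have := coprimep_dvdr; have := cAB; rewrite coprimep_sym /coprimep => /eqP.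
  have /eqp_size -> : gcdp B A %= B by rewrite /eqp dvdp_gcdl dvdp_gcd dvdpp dBA.
  by move=> s1; case/eqP: c0; rewrite nth_default // s1.
have a0 : A`_1 = 0.
  by move/eqP: cA; rewrite c0 scale0r eq_sym scale_poly_eq0 (negbTE B0) orbF => /eqP.
have tc : tau = cst (A`_0 / B`_0).
  have EA : A = (A`_0)%:P by rewrite {1}(poly_size2 sA) a0 scale0r add0r.
  have EB : B = (B`_0)%:P by rewrite {1}(poly_size2 sB) c0 scale0r add0r.
  by rewrite Dt fmorph_div /= /cst -EA -EB.
move: E; rewrite tc !horner_map /=; set v := _ / _ => E.
have EX : 'X * q.[v]%:P = p.[v]%:P by apply/eqP; rewrite -tofrac_eq tofracM; apply/eqP.
have qv : q.[v] = 0 by have := congr1 (fun z : {poly F} => z`_1) EX; rewrite mulrC coefCM coefX coefC mulr1.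
have pv : p.[v] = 0 by have := congr1 (fun z : {poly F} => z`_0) EX; rewrite qv mulr0 coef0 coefC.
have := coprimep_root cpq (_ : root p v); rewrite rootE pv qv eqxx => /(_ isT).
by [].
Qed.

(** * The derivation of [F(t)] *)

Section FracDerivation.
Variable F : fieldType.
Implicit Types (p q a b : {poly F}) (x y : {fraction {poly F}}).

(** The quotient rule applied to a chosen representative; [frac_deriv_frac] gives the independence
    of the choice. *)
Definition frac_deriv x : {fraction {poly F}} :=
  let n := \n_(repr x) in let d := \d_(repr x) in
  (n^`() * d - n * d^`())%:F / (d ^+ 2)%:F.

Lemma frac_deriv_frac a b : b != 0 ->
  frac_deriv (a%:F / b%:F) = (a^`() * b - a * b^`())%:F / (b ^+ 2)%:F.
Proof.
move=> b0; rewrite /frac_deriv; set x := a%:F / b%:F.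
have := frac_reprE x; have := denom_ratioP (repr x).
move: \n_(repr x) \d_(repr x) => n d d0 /(frac_eq _ _ b0 d0) E.
apply/(frac_eq _ _); rewrite ?expf_neq0 //.
have E' := congr1 (@deriv F) E; rewrite !derivM in E'.
have E1 : n^`() * b = a^`() * d + a * d^`() - n * b^`().
  by rewrite E'; ring.
have -> : (n^`() * d - n * d^`()) * b ^+ 2 = (n^`() * b) * b * d - (n * b) * d^`() * b by ring.
rewrite E1; have -> : (a^`() * d + a * d^`() - n * b^`()) * b * d - n * b * d^`() * b =
   (a^`() * d + a * d^`()) * b * d - (n * b) * (b^`() * d + d^`() * b) by ring.
by rewrite -E; ring.
Qed.

Lemma deriv_mul_identity (k : fieldType) (a b c d a' b' c' d' : k) : b != 0 -> d != 0 ->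
  ((a' * c + a * c') * (b * d) - (a * c) * (b' * d + b * d')) / (b * d) ^+ 2 =
  (a' * b - a * b') / b ^+ 2 * (c / d) + (a / b) * ((c' * d - c * d') / d ^+ 2).
Proof. by move=> b0 d0; field; rewrite d0 b0. Qed.

Lemma frac_derivM x y : frac_deriv (x * y) = frac_deriv x * y + x * frac_deriv y.
Proof.
have [a [b [b0 ->]]] := fracP x; have [c [d [d0 ->]]] := fracP y.
have bF : b%:F != 0 by rewrite tofrac_eq0.
have dF : d%:F != 0 by rewrite tofrac_eq0.
rewrite mulf_div -(tofracM a) -(tofracM b) !frac_deriv_frac ?mulf_neq0 //.
rewrite !derivM !tofracXn !tofracB !tofracM !tofracD !tofracM.
exact: (deriv_mul_identity a%:F c%:F a^`()%:F b^`()%:F c^`()%:F d^`()%:F bF dF).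
Qed.

Lemma frac_derivD x y : frac_deriv (x + y) = frac_deriv x + frac_deriv y.
Proof.
have [a [b [b0 ->]]] := fracP x; have [c [d [d0 ->]]] := fracP y.
have bd0 : b * d != 0 by rewrite mulf_neq0.
have -> : a%:F / b%:F = (a * d)%:F / (b * d)%:F by apply/frac_eq => //; ring.
have -> : c%:F / d%:F = (c * b)%:F / (b * d)%:F by apply/frac_eq => //; ring.
rewrite -mulrDl -tofracD !frac_deriv_frac // -mulrDl -tofracD derivD.
by congr (_%:F / _); ring.
Qed.

Lemma frac_deriv_poly p : frac_deriv p%:F = p^`()%:F.
Proof.
have -> : p%:F = p%:F / 1%:F by rewrite tofrac1 divr1.
rewrite frac_deriv_frac ?oner_neq0 // expr1n -[1]/(1%:P) derivC mulr0 subr0 mulr1.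
by rewrite tofrac1 divr1.
Qed.

Lemma frac_deriv_cst (c : F) : frac_deriv (cst c) = 0.
Proof. by rewrite /cst frac_deriv_poly derivC tofrac0. Qed.

Lemma frac_deriv_horner p y :
  frac_deriv (map_poly (@cst F) p).[y] = (map_poly (@cst F) p^`()).[y] * frac_deriv y.
Proof.
elim/poly_ind: p => [|p c IH].
  by rewrite deriv0 rmorph0 horner0 mul0r -(rmorph0 (@cst F)) frac_deriv_cst.
rewrite derivMXaddC !rmorphD !rmorphM /= !map_polyX map_polyC !hornerD !hornerM !hornerX hornerC.
rewrite frac_derivD frac_derivM frac_deriv_cst IH addr0.
by rewrite (mulrDl _ _ (frac_deriv y)) addrC; congr (_ + _); rewrite mulrAC.
Qed.
End FracDerivation.

(** * The function field of a parametrized curve *)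

Section ParamVanishing.
Variables (F : fieldType).
Hypothesis char0 : forall m, m.+1%:R != 0 :> F.
Variables (N : nat) (phi : 'I_N -> {fraction {poly F}}).

Lemma param_point_cofinite :
  exists2 q : {poly F}, q != 0 & forall s, q.[s] != 0 -> exists x, param_point phi s x.
Proof.
have Hq j : {q : {poly F} | q != 0 /\ forall s, q.[s] != 0 -> exists v, ratfun_value id (phi j) s v}.
  apply: constructive_indefinite_description.
  by have [q q0 Hq] := rv_cofinite (phi j); exists q.
exists (\prod_j sval (Hq j)); first by apply/prodf_neq0 => j _; case: (svalP (Hq j)).
move=> s; rewrite horner_prod => /prodf_neq0 H.
have Hv j : {v | ratfun_value id (phi j) s v}.
  apply: constructive_indefinite_description.
  by case: (svalP (Hq j)) => _; apply; apply: H.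
by exists (\row_j sval (Hv j)) => j; rewrite mxE; apply: svalP.
Qed.

Lemma poly_cofinite_eq0 (p q : {poly F}) : q != 0 -> (forall s, q.[s] != 0 -> p.[s] = 0) -> p = 0.
Proof.
move=> q0 H; apply: NNPP => /eqP p0.
have inj := nat_inj_of_char0 char0.
have [n] := poly_nat_nonroot inj (mulf_neq0 p0 q0).
by rewrite hornerM mulf_eq0 negb_or => /andP [pn /H E]; rewrite E eqxx in pn.
Qed.

(** All but finitely many parameters give a point, whereas a nonzero rational function has finitely
    many zeros; in characteristic zero the field is infinite. *)
Lemma param_vanishing (p : {mpoly F[N]}) :
  mpoly_at_param p phi = 0 <-> (forall s x, param_point phi s x -> p.@[x 0] = 0).
Proof.
split=> [E s x /(@rv_mpoly_id _ _ p)|H].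
  rewrite E => H; apply: (@rv_fun F F idfun _ _ _ _ H).
  by have := @rv_cst F F idfun 0 s; rewrite rmorph0.
apply: NNPP => /eqP /rv_zeros [e e0 He].
have [q q0 Hq] := param_point_cofinite.
case/eqP: e0; apply: (poly_cofinite_eq0 q0) => s /Hq [x Hx]; apply: He.
by rewrite -(H s x Hx); apply: rv_mpoly_id.
Qed.

Lemma param_closure_vanishing (C : affset F N) (p : {mpoly F[N]}) :
  eq_affset C (param_closure phi) -> (mpoly_at_param p phi = 0 <-> vanishes_on C p).
Proof.
move=> HC; rewrite param_vanishing; split=> [H x /HC Hx|H s x Hx].
  by apply: Hx => y [s Hs]; apply: H Hs.
by apply: H; apply/HC => q; apply; exists s.
Qed.
End ParamVanishing.

Section MpolyOver.
Variables (F : fieldType) (k : F -> Prop).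
Hypothesis Hk : is_subfield k.

Lemma mpoly_overC N c : k c -> mpoly_over k (c%:MP_[N]).
Proof. by move=> kc m; rewrite mcoeffC; apply: (sfM Hk) => //; apply: (sf_nat Hk). Qed.

Lemma mpoly_overB N (p q : {mpoly F[N]}) : mpoly_over k p -> mpoly_over k q -> mpoly_over k (p - q).
Proof. by move=> Hp Hq m; rewrite mcoeffB; apply: (sfB Hk). Qed.

Lemma mpoly_overM N (p q : {mpoly F[N]}) : mpoly_over k p -> mpoly_over k q -> mpoly_over k (p * q).
Proof.
move=> Hp Hq; set S := Subfield Hk.
have [p' ->] := @mpoly_over_lift _ S _ _ Hp; have [q' ->] := @mpoly_over_lift _ S _ _ Hq.
by rewrite -rmorphM; apply: (@mpoly_over_sfv _ S).
Qed.

Lemma mpoly_over_sum N I (r : seq I) (P : pred I) (f : I -> {mpoly F[N]}) :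
  (forall i, P i -> mpoly_over k (f i)) -> mpoly_over k (\sum_(i <- r | P i) f i).
Proof. by move=> H m; rewrite raddf_sum; apply: (sf_sum Hk) => i Pi; apply: H. Qed.

Lemma mpoly_span_decomposition N (d : seq F) (c : {mpoly F[N]}) :
  (forall m, m \in msupp c -> lspan k d c@_m) ->
  exists cl : nat -> {mpoly F[N]}, (forall l, mpoly_over k (cl l)) /\
    c = \sum_(l < size d) d`_l *: cl l.
Proof.
move=> H; have HB m : {b : nat -> F | (forall i, k (b i)) /\
    (m \in msupp c -> c@_m = \sum_(i < size d) b i * d`_i)}.
  apply: constructive_indefinite_description.
  have [/H [b kb E]|nm] := boolP (m \in msupp c); first by exists b.
  by exists (fun _ => 0); split=> // _; apply: (sf0 Hk).
exists (fun l => \sum_(m <- msupp c) sval (HB m) l *: 'X_[m]); split=> [l|].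
  move=> m'; rewrite raddf_sum /=; apply: (sf_sum Hk) => m _.
  rewrite mcoeffZ mcoeffX; apply: (sfM Hk); last exact: (sf_nat Hk).
  by case: (svalP (HB m)).
rewrite {1}[c]mpolyE [RHS](eq_bigr (fun l : 'I_(size d) => \sum_(m <- msupp c) (sval (HB m) l * d`_l) *: 'X_[m])).
  rewrite exchange_big /= big_seq [RHS]big_seq; apply: eq_bigr => m ms.
  by rewrite -scaler_suml; case: (svalP (HB m)) => _ /(_ ms) <-.
by move=> l _; rewrite scaler_sumr; apply: eq_bigr => m _; rewrite scalerA mulrC.
Qed.
End MpolyOver.

Section FunctionField.
Variables (F : fieldType) (k : F -> Prop).
Hypothesis Hk : is_subfield k.

(* [k[phi]] and [k(phi)] inside [F(t)] *)
Definition param_ring N (phi : 'I_N -> {fraction {poly F}}) (x : {fraction {poly F}}) :=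
  exists2 G : {mpoly F[N]}, mpoly_over k G & x = mpoly_at_param G phi.

Definition param_field N (phi : 'I_N -> {fraction {poly F}}) (x : {fraction {poly F}}) :=
  exists a b, [/\ param_ring phi a, param_ring phi b, b != 0 & x = a / b].

Definition poly_ring (x : {fraction {poly F}}) := exists2 p, poly_over k p & x = p%:F.

Lemma frac_subfield (Om : fieldType) (R : Om -> Prop) :
  R 1 -> (forall x y, R x -> R y -> R (x - y)) -> (forall x y, R x -> R y -> R (x * y)) ->
  is_subfield (fun x => exists a b, [/\ R a, R b, b != 0 & x = a / b]).
Proof.
move=> R1 RB RM; have R0 : R 0 by rewrite -(subrr 1); apply: RB.
split=> [|x y [a [b [Ra Rb b0 ->]]] [c [d [Rc Rd d0 ->]]]|x y [a [b [Ra Rb b0 ->]]] [c [d [Rc Rd d0 ->]]]].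
- by exists 1, 1; rewrite oner_neq0 divr1.
- exists (a * d - c * b), (b * d); rewrite mulf_neq0 // -[- (c / d)]mulNr addf_div // mulNr.
  by split=> //; [apply: RB; apply: RM | apply: RM].
have [->|c0] := eqVneq c 0; first by exists 0, 1; rewrite oner_neq0 !(mul0r, invr0, mulr0).
exists (a * d), (b * c); rewrite mulf_neq0 // invf_div mulf_div.
by split=> //; apply: RM.
Qed.

Variables (N : nat) (phi : 'I_N -> {fraction {poly F}}).

Lemma param_ring1 : param_ring phi 1.
Proof.
exists 1; first by rewrite -mpolyC1; apply: (mpoly_overC Hk); apply: sf1.
by rewrite mpoly_at_paramE rmorph1.
Qed.

Lemma param_ringB x y : param_ring phi x -> param_ring phi y -> param_ring phi (x - y).
Proof.
move=> [G kG ->] [H kH ->]; exists (G - H); first exact: (mpoly_overB Hk).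
by rewrite !mpoly_at_paramE rmorphB.
Qed.

Lemma param_ringM x y : param_ring phi x -> param_ring phi y -> param_ring phi (x * y).
Proof.
move=> [G kG ->] [H kH ->]; exists (G * H); first exact: (mpoly_overM Hk).
by rewrite !mpoly_at_paramE rmorphM.
Qed.

Lemma param_field_subfield : is_subfield (param_field phi).
Proof. exact: (frac_subfield param_ring1 param_ringB param_ringM). Qed.

Lemma param_field_ring x : param_ring phi x -> param_field phi x.
Proof. by move=> Rx; exists x, 1; rewrite oner_neq0 divr1; split=> //; apply: param_ring1. Qed.

Lemma param_field_cst c : k c -> param_field phi (cst c).
Proof.
move=> kc; apply: param_field_ring; exists c%:MP; first exact: (mpoly_overC Hk).
by rewrite mpoly_at_paramE mmapC.
Qed.

Lemma param_field_gen j : param_field phi (phi j).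
Proof.
apply: param_field_ring; exists 'X_j; last by rewrite mpoly_at_paramE mmapX mmap1U.
by move=> m; rewrite mcoeffX; apply: (sf_nat Hk).
Qed.

Hypothesis char0 : forall m, m.+1%:R != 0 :> F.

(* The ideal of [C] has generators over [k]; expanding the cofactors in a [k]-independent
   family that contains [d] shows that it contains every component of its members. *)
Lemma param_field_lindisj (C : affset F N) : eq_affset C (param_closure phi) ->
  defined_over k C -> lindisj (@cst F) k (param_field phi).
Proof.
move=> HC [GG kGG HI]; apply: lindisj_frac; [exact: param_ring1|exact: param_ringM|].
move=> d Id x Hx E.
have HG i : {G : {mpoly F[N]} | mpoly_over k G /\ x i = mpoly_at_param G phi}.
  by apply: constructive_indefinite_description; have [G kG xG] := Hx i; exists G.
pose G i := sval (HG i).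
have kG i : mpoly_over k (G i) by rewrite /G; case: (HG i) => ? [].
have xG i : x i = mpoly_at_param (G i) phi by rewrite /G; case: (HG i) => ? [].
pose p := \sum_(i < size d) d`_i *: G i.
have /(param_closure_vanishing char0 p HC) /HI [s sG Ep] : mpoly_at_param p phi = 0.
  rewrite mpoly_at_paramE rmorph_sum -[RHS]E; apply: eq_bigr => i _ /=.
  by rewrite mmapZ xG mpoly_at_paramE.
pose cs := flatten [seq [seq cg.1@_m | m <- msupp cg.1] | cg <- s].
have [d' [Id' Sd']] := basis_extend Hk cs Id; set e := d ++ d' in Id' Sd'.
have Hcl (c : {mpoly F[N]}) : {cl : nat -> {mpoly F[N]} | (forall l, mpoly_over k (cl l)) /\
    ((exists g, (c, g) \in s) -> c = \sum_(l < size e) e`_l *: cl l)}.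
  apply: constructive_indefinite_description.
  have [[g cs']|nc] := classic (exists g, (c, g) \in s); last first.
    exists (fun _ => 0); split=> // l m; rewrite mcoeff0; exact: (sf0 Hk).
  have [|cl [kcl Ecl]] := @mpoly_span_decomposition F k Hk N e c; last by exists cl.
  by move=> m ms; apply: Sd'; apply/flatten_mapP; exists (c, g) => //; apply: map_f.
pose cl c := sval (Hcl c).
pose G' l := if (l < size d)%N then G l else 0.
pose H l := \sum_(cg <- s) cl cg.1 l * cg.2.
have Eq : \sum_(l < size e) e`_l *: (G' l - H l) = 0.
  under eq_bigr => l _ do rewrite scalerBr.
  rewrite sumrB; apply/eqP; rewrite subr_eq0; apply/eqP.
  transitivity p.
    rewrite /e size_cat big_split_ord /= [X in _ + X]big1 ?addr0 => [|i _].
      by apply: eq_bigr => i _; rewrite nth_cat /G' ltn_ord.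
    by rewrite /G' ltnNge leq_addr scaler0.
  rewrite Ep; transitivity (\sum_(cg <- s) \sum_(l < size e) e`_l *: (cl cg.1 l * cg.2)).
    rewrite big_seq [RHS]big_seq; apply: eq_bigr => -[c g] cgs /=.
    have [_ Ec] := svalP (Hcl c); rewrite {1}Ec; last by exists g.
    by rewrite mulr_suml; apply: eq_bigr => l _; rewrite scalerAl.
  rewrite exchange_big; apply: eq_bigr => l _; rewrite /H scaler_sumr //.
have kGH l : mpoly_over k (G' l - H l).
  apply: (mpoly_overB Hk).
    by rewrite /G'; case: ifP => // _ m; rewrite mcoeff0; apply: (sf0 Hk).
  move=> m; rewrite /H big_seq; apply: (mpoly_over_sum Hk) => -[c g] cgs.
  by apply: (mpoly_overM Hk); [rewrite /cl; case: (Hcl c) => ? [] | apply: kGG; apply: (sG _ cgs)].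
move=> i lt_i.
have GH : G i = H i.
  apply/eqP; rewrite -subr_eq0; apply/eqP/mpolyP => m; rewrite mcoeff0.
  have le : (i < size e)%N by rewrite /e size_cat ltn_addr.
  have := Id' (fun l => (G' l - H l)@_m) (fun l => kGH l m) _ i le.
  rewrite {2}/G' lt_i; apply; have := congr1 (fun z : {mpoly F[N]} => z@_m) Eq.
  rewrite mcoeff0 raddf_sum /= => E0; rewrite -[RHS]E0; apply: eq_bigr => l _.
  by rewrite mcoeffZ mulrC.
rewrite xG; apply/(param_closure_vanishing char0 _ HC)/HI; rewrite GH.
exists [seq (cl cg.1 i, cg.2) | cg <- s]; last by rewrite big_map.
by move=> _ /mapP [[c g] /sG Hg ->].
Qed.
End FunctionField.

Lemma ratfun_over_frac (F : fieldType) (k : F -> Prop) (x : {fraction {poly F}}) :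
  ratfun_over k x <-> exists a b, [/\ poly_ring k a, poly_ring k b, b != 0 & x = a / b].
Proof.
split=> [[p [q [kp kq q0 ->]]]|[a [b [[p kp ->] [q kq ->] q0 ->]]]].
  by exists p%:F, q%:F; rewrite tofrac_eq0; split=> //; [exists p|exists q].
by exists p, q; rewrite tofrac_eq0 in q0.
Qed.

Section RatfunOver.
Variables (F : fieldType) (k : F -> Prop).
Hypothesis Hk : is_subfield k.

Lemma poly_ring1 : poly_ring k 1.
Proof. by exists 1; [apply: (poly_overC Hk); apply: sf1 | rewrite tofrac1]. Qed.

Lemma poly_ringB x y : poly_ring k x -> poly_ring k y -> poly_ring k (x - y).
Proof.
by move=> [p kp ->] [q kq ->]; exists (p - q); [apply: (poly_overB Hk) | rewrite tofracB].
Qed.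

Lemma poly_ringM x y : poly_ring k x -> poly_ring k y -> poly_ring k (x * y).
Proof.
by move=> [p kp ->] [q kq ->]; exists (p * q); [apply: (poly_overM Hk) | rewrite tofracM].
Qed.

Lemma ratfun_over_subfield : is_subfield (@ratfun_over F k).
Proof.
have [H1 HB HD] := frac_subfield poly_ring1 poly_ringB poly_ringM.
split; first exact/ratfun_over_frac.
  by move=> x y /ratfun_over_frac Hx /ratfun_over_frac Hy; apply/ratfun_over_frac/HB.
by move=> x y /ratfun_over_frac Hx /ratfun_over_frac Hy; apply/ratfun_over_frac/HD.
Qed.

Lemma ratfun_over_poly p : poly_over k p -> ratfun_over k p%:F.
Proof.
exists p, 1; rewrite oner_neq0 tofrac1 divr1; split=> //.
by apply: (poly_overC Hk); apply: sf1.
Qed.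

Lemma ratfun_over_cst c : k c -> ratfun_over k (cst c).
Proof. by move=> kc; apply/ratfun_over_poly/(poly_overC Hk). Qed.

Lemma ratfun_over_X : ratfun_over k 'X%:F.
Proof. exact/ratfun_over_poly/(poly_overX Hk). Qed.

Lemma ratfun_over_lindisj : lindisj (@cst F) k (@ratfun_over F k).
Proof.
have LD : lindisj (@cst F) k (poly_ring k).
  move=> d Id x Hx E.
  have Hp i : {p | poly_over k p /\ x i = p%:F}.
    by apply: constructive_indefinite_description; have [p kp xp] := Hx i; exists p.
  pose p i := sval (Hp i).
  have kp i : poly_over k (p i) by rewrite /p; case: (Hp i) => ? [].
  have xp i : x i = (p i)%:F by rewrite /p; case: (Hp i) => ? [].
  have E' : \sum_(i < size d) d`_i *: p i = 0.
    apply/eqP; rewrite -tofrac_eq0 rmorph_sum -[X in _ == X]E; apply/eqP.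
    by apply: eq_bigr => i _ /=; rewrite xp /cst -tofracM mul_polyC.
  move=> i lt_i; rewrite xp; apply/eqP; rewrite tofrac_eq0; apply/eqP/polyP => m.
  rewrite coef0; apply: (Id (fun l => (p l)`_m)) lt_i => [l|]; first exact: kp.
  have := congr1 (fun z : {poly F} => z`_m) E'; rewrite coef0 coef_sum => E0; rewrite -[RHS]E0.
  by apply: eq_bigr => l _; rewrite coefZ mulrC.
move=> d Id x Hx; apply: (lindisj_frac poly_ring1 poly_ringM LD Id).
by move=> i; apply/ratfun_over_frac.
Qed.
End RatfunOver.

(** * Conjugation *)

Lemma poly_lift_rmorph (A B : nzRingType) (g : {rmorphism A -> B}) (p : {poly B}) :
  (forall i, exists q, p`_i = g q) -> exists ph, p = map_poly g ph.
Proof.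
elim/poly_ind: p => [|p c IH] Hp; first by exists 0; rewrite rmorph0.
have [q Eq] : exists q, p = map_poly g q.
  by apply: IH => i; have := Hp i.+1; rewrite coefD coefMX coefC /= addr0.
have [d Ed] : exists d, c = g d.
  by have := Hp 0; rewrite coefD coefMX coefC /= add0r.
by exists (q * 'X + d%:P); rewrite rmorphD rmorphM /= map_polyX map_polyC /= -Ed -Eq.
Qed.

Lemma eq_monic_dvdp (K : fieldType) (p q : {poly K}) :
  p \is monic -> q \is monic -> p %| q -> size p = size q -> q = p.
Proof.
move=> mp mq pq spq; apply/eqP; rewrite -eqp_monic // eqp_sym -dvdp_size_eqp //.
by rewrite spq.
Qed.

Lemma is_minpoly_eq (k Om : fieldType) (e : {rmorphism k -> Om}) P a q1 q2 :
  is_minpoly e P a -> (map_poly e q1).[a] = (map_poly e q2).[a] <-> P %| (q1 - q2).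
Proof.
case=> _ <-; rewrite rootE rmorphB hornerD hornerN subr_eq0.
by split=> [->|/eqP].
Qed.

Section SubfieldMap.
Variables (F Om : fieldType) (e : {rmorphism F -> Om}) (S : subfield F) (T : subfield Om).
Hypothesis ST : forall x, S x -> T (e x).

Definition sfmap (x : sfT S) : sfT T := SfT (introT (subfield_memP T _) (ST (sfvP x))).

Lemma sfv_sfmap x : sfv (sfmap x) = e (sfv x). Proof. by []. Qed.

Lemma sfv_inj (L : fieldType) (R : subfield L) : injective (@sfv L R).
Proof. exact: val_inj. Qed.

Lemma sfmap_zmod : zmod_morphism sfmap.
Proof. by move=> x y; apply: sfv_inj; rewrite [RHS]rmorphB !sfv_sfmap !rmorphB. Qed.

Lemma sfmap_monoid : monoid_morphism sfmap.
Proof.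
split; first by apply: sfv_inj; rewrite sfv_sfmap !rmorph1.
by move=> x y; apply: sfv_inj; rewrite [RHS]rmorphM !sfv_sfmap !rmorphM.
Qed.

HB.instance Definition _ := GRing.isZmodMorphism.Build (sfT S) (sfT T) sfmap sfmap_zmod.
HB.instance Definition _ := GRing.isMonoidMorphism.Build (sfT S) (sfT T) sfmap sfmap_monoid.
End SubfieldMap.

Section Conjugates.
Variables (F : closedFieldType) (S : subfield F) (T : subfield {fraction {poly F}}).
Hypothesis char0 : forall m, m.+1%:R != 0 :> F.
Hypothesis ST : forall x, S x -> T (cst x).

(** An element of [S(alpha)] or [T(alpha)] is represented by a polynomial: evaluation at [alpha]
    recovers the element, and evaluation at another root [z] gives its conjugate. *)
Definition evF (z : F) : {rmorphism {poly sfT S} -> F} := horner_eval z \o map_poly (@sfv F S).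
Definition evT (z : F) : {rmorphism {poly sfT T} -> {fraction {poly F}}} :=
  horner_eval (cst z) \o map_poly (@sfv _ T).
Definition liftST (u : {poly {poly sfT S}}) : {poly {poly sfT T}} :=
  map_poly (map_poly (sfmap ST)) u.

Lemma evT_sfmap z q : evT z (map_poly (sfmap ST) q) = cst (evF z q).
Proof. by rewrite /= /horner_eval -horner_map /= -!map_poly_comp. Qed.

Lemma evT_liftST z u th :
  evT z (liftST u).[th] = (map_poly (@cst F) (map_poly (evF z) u)).[evT z th].
Proof.
rewrite -horner_map /liftST -!map_poly_comp; congr (_.[_]).
by apply: eq_map_poly => q /=; rewrite -evT_sfmap.
Qed.

Lemma evT_C z c : evT z c%:P = sfv c.
Proof. by rewrite /= /horner_eval map_polyC hornerC. Qed.

Variables (alpha : F) (n : nat).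
Hypothesis Da : algebraic_of_degree S alpha n.
Hypothesis LD : lindisj (@cst F) S T.

(** By disjointness the minimal polynomial of [alpha] over [T] is the image of the one over [S]. So
    each of its [n] roots gives a conjugation that is well defined on both fields. *)
Lemma conjugates : exists rs : n.-tuple F, [/\ uniq rs,
   forall z, z \in rs -> forall e1 e2, evT alpha e1 = evT alpha e2 -> evT z e1 = evT z e2
 & forall z, z \in rs -> forall e1 e2, evF alpha e1 = evF alpha e2 -> evF z e1 = evF z e2].
Proof.
have [P [Pa sP]] := minpoly_exists Da.
have ch0 m : m.+1%:R != 0 :> sfT S.
  by rewrite -(inj_eq (@sfv_inj _ S)) rmorph_nat rmorph0.
have [rs [Urs Drs]] := minpoly_split ch0 Pa.
have srs : size rs == n by rewrite size_tuple sP.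
have [PT [PTa sPT]] := minpoly_exists (lindisj_degree (subfieldP S) ST LD Da).
have EP : map_poly (sfmap ST) P = PT.
  have := is_minpoly_size_gt1 PTa.
  case: PTa => mPT HPT s1.
  have rP : root (map_poly (@sfv _ T) (map_poly (sfmap ST) P)) (cst alpha).
    rewrite rootE; apply/eqP; have := evT_sfmap alpha P; rewrite /= /horner_eval => ->.
    by have [_ HP] := Pa; have /eqP -> := etrans (HP P) (dvdpp P); rewrite rmorph0.
  have mP : map_poly (sfmap ST) P \is monic by case: Pa => mP _; rewrite map_monic.
  rewrite HPT in rP.
  apply: (eq_monic_dvdp mPT mP rP).
  rewrite sPT.
  rewrite size_map_poly.
  by rewrite sP.
exists (Tuple srs); split=> //= z zr e1 e2.
  have rz : root (map_poly (@sfv _ T) PT) (cst z).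
    rewrite rootE -EP; apply/eqP; have := evT_sfmap z P; rewrite /= /horner_eval => ->.
    have /eqP -> : root (map_poly (@sfv _ S) P) z by rewrite Drs root_prod_XsubC.
    by rewrite rmorph0.
  by move/(is_minpoly_eq _ _ PTa) => H; apply/(is_minpoly_eq _ _ (is_minpoly_conj PTa rz)).
have rz : root (map_poly (@sfv _ S) P) z by rewrite Drs root_prod_XsubC.
by move/(is_minpoly_eq _ _ Pa) => H; apply/(is_minpoly_eq _ _ (is_minpoly_conj Pa rz)).
Qed.

Definition over_alpha (x : {fraction {poly F}}) := exists q, x = evT alpha q.

Lemma over_alpha_subfield : is_subfield over_alpha.
Proof.
have [PT [PTa sPT]] := minpoly_exists (lindisj_degree (subfieldP S) ST LD Da).
exact: (is_minpoly_range_subfield PTa).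
Qed.

Lemma over_alpha_T x : T x -> over_alpha x.
Proof. by move=> /sfv_lift [y <-]; exists y%:P; rewrite evT_C. Qed.

Lemma adjoin_evF c : adjoin S alpha c -> exists q, c = evF alpha q.
Proof. by move=> /(adjoinP _ Da) [q _ ->]; exists q. Qed.

Lemma over_alpha_cst c : adjoin S alpha c -> over_alpha (cst c).
Proof.
move=> /adjoin_evF [q ->]; exists (map_poly (sfmap ST) q).
by rewrite evT_sfmap.
Qed.

Lemma over_alpha_horner p x : poly_over (adjoin S alpha) p -> over_alpha x ->
  over_alpha (map_poly (@cst F) p).[x].
Proof.
move=> Lp Ex; apply: (sf_horner over_alpha_subfield) => // i.
by rewrite coef_map; apply: over_alpha_cst.
Qed.

Lemma over_alpha_mpoly N (p : {mpoly F[N]}) phi : mpoly_over (adjoin S alpha) p ->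
  (forall j, over_alpha (phi j)) -> over_alpha (mpoly_at_param p phi).
Proof.
move=> Lp Hphi; have HE := over_alpha_subfield.
rewrite mpoly_at_paramE; apply: (sf_sum HE) => m _; apply: (sfM HE).
  exact: over_alpha_cst.
by apply: (sf_prod HE) => i _; apply: (sfX HE).
Qed.

Lemma over_alpha_small x : over_alpha x ->
  exists2 q : {poly sfT T}, (size q <= n)%N & x = evT alpha q.
Proof.
have [PT [PTa sPT]] := minpoly_exists (lindisj_degree (subfieldP S) ST LD Da).
case=> q ->; exists (q %% PT); last exact: is_minpoly_modp.
by rewrite -ltnS -sPT ltn_modp -size_poly_gt0 sPT.
Qed.

Lemma evT_expand (q : {poly sfT T}) : (size q <= n)%N -> evT alpha q = \sum_(i < n) cst (alpha ^+ i) * sfv q`_i.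
Proof.
move=> sq; rewrite /= /horner_eval (@horner_coef_wide _ n) ?size_map_poly //.
by apply: eq_bigr => i _; rewrite coef_map /= rmorphXn mulrC.
Qed.

Lemma poly_lift_adjoin u : poly_over (adjoin S alpha) u ->
  exists uh, u = map_poly (evF alpha) uh.
Proof. by move=> Lu; apply: poly_lift_rmorph => i; apply: adjoin_evF. Qed.
End Conjugates.

(** Lagrange interpolation. It recovers the components along the powers of [alpha] from the
    conjugates; since the nodes are constants, so are the weights [c z], and every [F]-space
    containing the conjugates contains the components. *)
Lemma interpolation_coef (F : fieldType) (rs : seq F) (h : {poly {fraction {poly F}}}) i :
  uniq rs -> (size h <= size rs)%N ->
  exists c : F -> F, h`_i = \sum_(z <- rs) cst (c z) * h.[cst z].
Proof.
move=> Urs sh.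
pose l z : {poly F} := \prod_(y <- rs | y != z) ((z - y)^-1 *: ('X - y%:P)).
have lz z : z \in rs -> (l z).[z] = 1.
  move=> zr; rewrite /l horner_prod big1 // => y ne.
  by rewrite hornerZ hornerXsubC mulVf // subr_eq0 eq_sym.
have ly z y : y \in rs -> y != z -> (l z).[y] = 0.
  move=> yr ne; rewrite /l horner_prod; apply/eqP; rewrite prodf_seq_eq0; apply/hasP.
  by exists y => //=; rewrite ne hornerZ hornerXsubC subrr mulr0 eqxx.
have sl z : z \in rs -> (size (l z) <= size rs)%N.
  move=> zr; rewrite /l scaler_prod (leq_trans (size_scale_leq _ _)) //.
  rewrite -big_filter size_prod_XsubC size_filter.
  rewrite -(count_predC (pred1 z)) addnC -addn1 leq_add2l.
  by rewrite -has_count has_pred1.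
pose g := \sum_(z <- rs) h.[cst z] *: map_poly (@cst F) (l z).
suff Eg : h = g.
  exists (fun z => (l z)`_i); rewrite {1}Eg /g coef_sum; apply: eq_bigr => z _.
  by rewrite coefZ coef_map /= mulrC.
apply/eqP; rewrite -subr_eq0; apply: contraT => ne.
have inj : injective (@cst F) by apply: fmorph_inj.
have := @max_poly_roots _ _ [seq cst z | z <- rs] ne.
rewrite size_map map_inj_uniq // Urs => /(_ _ isT) H.
have : (size rs < size (h - g)%R)%N.
  apply: H; apply/allP => _ /mapP [y yr ->]; rewrite rootE hornerD hornerN subr_eq0 /g horner_sum.
  rewrite (bigD1_seq y) //= hornerZ horner_map /= lz // rmorph1 mulr1 big1_seq ?addr0 // => z /andP [ne' zr].
  by rewrite hornerZ horner_map /= ly 1?eq_sym // rmorph0 mulr0.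
have sg : (size g <= size rs)%N.
  rewrite /g big_seq; elim/big_ind: _ => [|p q sp sq|z zr]; first by rewrite size_poly0.
    by rewrite (leq_trans (size_polyD _ _)) // geq_max sp.
  by rewrite (leq_trans (size_scale_leq _ _)) // size_map_poly sl.
by rewrite ltnNge (leq_trans (size_polyD _ _)) // geq_max sh size_polyN.
Qed.

Lemma subfield_mpoly_at_param (F : fieldType) (R : {fraction {poly F}} -> Prop) N
    (p : {mpoly F[N]}) phi : is_subfield R -> (forall m, R (cst p@_m)) ->
  (forall j, R (phi j)) -> R (mpoly_at_param p phi).
Proof.
move=> HR Rp Rphi; rewrite mpoly_at_paramE; apply: (sf_sum HR) => m _.
apply: (sfM HR); first exact: Rp.
by apply: (sf_prod HR) => i _; apply: (sfX HR).
Qed.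

Lemma deriv_eq0_const (F : fieldType) (p : {poly F}) :
  (forall m, m.+1%:R != 0 :> F) -> p^`() = 0 -> (size p <= 1)%N.
Proof.
move=> char0 E; rewrite leqNgt; apply/negP => sp.
have := congr1 (fun z : {poly F} => z`_(size p).-2) E; rewrite coef_deriv coef0.
have -> : (size p).-2.+1 = (size p).-1 by case: (size p) sp => [|[|]].
have p0 : p != 0 by rewrite -size_poly_gt0 ltnW.
move/eqP; rewrite -mulr_natr mulf_eq0 -/(lead_coef p) lead_coef_eq0 (negbTE p0) /=.
by case: (size p) sp => [|[|s]] //= _; rewrite (negbTE (char0 s)).
Qed.

Lemma frac_deriv_eq0 (F : fieldType) (x : {fraction {poly F}}) :
  (forall m, m.+1%:R != 0 :> F) -> frac_deriv x = 0 -> exists c, x = cst c.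
Proof.
move=> char0; have [p [q [q0 cpq ->]]] := frac_coprime x.
rewrite frac_deriv_frac // => /eqP; rewrite mulf_eq0 invr_eq0 !tofrac_eq0 expf_eq0 (negbTE q0) /= orbF.
rewrite subr_eq0 => /eqP E.
have dq : q^`() = 0.
  apply/eqP; apply: contraT => q'0; have : q %| q^`().
    by rewrite -(@Gauss_dvdpr _ q^`() p q) 1?coprimep_sym // -E dvdp_mull.
  move/(dvdp_leq q'0); rewrite leqNgt lt_size_deriv //.
have dp : p^`() = 0.
  by move/eqP: E; rewrite dq mulr0 mulf_eq0 (negbTE q0) orbF => /eqP.
have Dp := size1_polyC (deriv_eq0_const char0 dp); have Dq := size1_polyC (deriv_eq0_const char0 dq).
by exists (p`_0 / q`_0); rewrite fmorph_div /= /cst -Dp -Dq.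
Qed.

(** In the application [U = u(tau)], [V = v(tau)] and [f = phi_j = U / V]. The chain rule and the
    conjugated quotient rule combine to show that the conjugate [g] of [phi_j' t^i] satisfies
    [g tau' = phi_j' tau^i]. *)
Lemma deriv_quotient_transport (k : fieldType) (U V U' V' f Df Dt tk g : k) : V != 0 ->
  U = f * V -> U' * Dt = Df * V + f * (V' * Dt) -> g * V ^+ 2 = (U' * V - U * V') * tk ->
  g * Dt = Df * tk.
Proof.
move=> V0 EU EU' Eg; apply: (mulIf (expf_neq0 2 V0)).
have -> : g * Dt * V ^+ 2 = (g * V ^+ 2) * Dt by ring.
rewrite Eg EU; have -> : (U' * V - f * V * V') * tk * Dt = ((U' * Dt) * V - f * V * (V' * Dt)) * tk by ring.
by rewrite EU'; ring.
Qed.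

(** Here [tau = A / B], with derivative [D / B^2] for the determinant [D]. The bound [i <= 2] lets
    [B^2] absorb the denominator of [tau^i]. *)
Lemma moebius_transport (k : fieldType) (A B D g f : k) i : B != 0 -> D != 0 -> (i <= 2)%N ->
  g * (D / B ^+ 2) = f * (A / B) ^+ i -> g = f * (A ^+ i * B ^+ (2 - i) / D).
Proof.
move=> B0 D0 i2 E; have -> : g = g * (D / B ^+ 2) * (B ^+ 2 / D) by field; rewrite B0 D0.
rewrite E; case: i i2 {E} => [|[|[|i]]] // _.
- by rewrite -[(2 - 0)%N]/2%N; field; rewrite B0 D0.
- by rewrite -[(2 - 1)%N]/1%N; field; rewrite B0 D0.
- by rewrite -[(2 - 2)%N]/0%N; field; rewrite B0 D0.
Qed.

Lemma size_form_bound (R : idomainType) (A B : {poly R}) i :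
  (size A <= 2)%N -> (size B <= 2)%N -> (i <= 2)%N -> (size (A ^+ i * B ^+ (2 - i))%R <= 3)%N.
Proof.
move=> sA sB i2; rewrite (leq_trans (size_polyMleq _ _)) //.
have := size_poly_exp_leq A i; have := size_poly_exp_leq B (2 - i).
have hA : ((size A).-1 * i <= i)%N by rewrite -{2}[i]mul1n leq_mul2r -subn1 leq_subLR sA orbT.
have hB : ((size B).-1 * (2 - i) <= 2 - i)%N.
  by rewrite -{2}[(2 - i)%N]mul1n leq_mul2r -subn1 leq_subLR sB orbT.
move: (size (A ^+ i)) (size (B ^+ (2 - i))) hA hB.
by move: (_ * i)%N (_ * (2 - i))%N; lia.
Qed.

Lemma rmorph_mul_sqr (A B : comNzRingType) (rho : {rmorphism A -> B}) g v :
  rho (g * v ^+ 2) = rho g * rho v ^+ 2.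
Proof. by rewrite rmorphM rmorphXn. Qed.

Lemma rmorph_wronskian (A B : comNzRingType) (rho : {rmorphism A -> B}) u v u' v' t i :
  rho ((u' * v - u * v') * t ^+ i) = (rho u' * rho v - rho u * rho v') * rho t ^+ i.
Proof. by rewrite rmorphM rmorphB !rmorphM rmorphXn. Qed.

Section RationalCurve.
Variables (F : closedFieldType) (k : F -> Prop) (alpha : F) (n : nat).
Hypothesis char0 : forall m, m.+1%:R != 0 :> F.
Hypothesis Hk : is_subfield k.
Hypothesis Da : algebraic_of_degree k alpha n.
Let L := adjoin k alpha.
Let HL : is_subfield L. Proof. exact: adjoin_subfield. Qed.
Let S := Subfield Hk.

Section Conjugation.
Variables (T : subfield {fraction {poly F}}) (rs : seq F).
Hypothesis kT : forall x, S x -> T (cst x).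
Hypothesis LD : lindisj (@cst F) k T.
Hypothesis conjT : forall z, z \in rs ->
  forall e1 e2 : {poly sfT T}, evT T alpha e1 = evT T alpha e2 -> evT T z e1 = evT T z e2.
Variables (t : {fraction {poly F}}) (th : {poly sfT T}).
Hypothesis Dth : t = evT T alpha th.
Hypothesis tr_t : transcendental (@cst F) t.

Lemma conj_neq0 z e : z \in rs -> evT T alpha e != 0 -> evT T z e != 0.
Proof.
move=> zr e0; have HE := over_alpha_subfield kT Da LD.
have [q Dq] : over_alpha T alpha (evT T alpha e)^-1 by apply: (sfV HE); exists e.
have : evT T z (q * e) = evT T z 1.
  by apply: conjT zr _ _ _; rewrite rmorphM rmorph1 -Dq mulVf.
rewrite rmorphM rmorph1; apply: contra_eq_neq => ->.
by rewrite mulr0 eq_sym oner_neq0.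
Qed.

Definition conj_value (y : F) (w : {poly {poly sfT S}}) : {fraction {poly F}} :=
  (map_poly (@cst F) (map_poly (evF S y) w)).[evT T y th].

(** An equation [u(t) = x v(t)] with [x] in [T] is preserved because conjugation fixes [T]. The
    denominator stays nonzero because [v(t)] has an inverse in [T(alpha)], which is conjugated along
    with it. *)
Lemma conj_quotient (uh vh : {poly {poly sfT S}}) x z : z \in rs -> T x ->
  map_poly (evF S alpha) vh != 0 -> conj_value alpha uh = x * conj_value alpha vh ->
  conj_value z vh != 0 /\ conj_value z uh = x * conj_value z vh.
Proof.
move=> zr /sfv_lift [xh Dx] v0 E; split.
  rewrite /conj_value -(evT_liftST kT); apply: conj_neq0 => //.
  by rewrite evT_liftST -Dth; apply: tr_t.
rewrite /conj_value -!(evT_liftST kT) -Dx -(evT_C z) -rmorphM.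
apply: conjT => //; rewrite rmorphM evT_C Dx.
by rewrite !evT_liftST.
Qed.

(** Conjugation fixes [x] and sends [t] to [tau], so [x = r(t)] becomes an expression of [x] as a
    rational function of [tau]. *)
Lemma conj_gen z x : z \in rs -> T x -> (exists r, ratfun_over L r /\ ratfun_value (@cst F) r t x) ->
  gen (@cst F) (evT T z th) x.
Proof.
move=> zr Tx [r [[u [v [Lu Lv v0 ->]]] /(rv_eval v0) E]].
have [uh Du] := @poly_lift_adjoin _ S _ _ Da u Lu.
have [vh Dv] := @poly_lift_adjoin _ S _ _ Da v Lv.
have [||p0 Ep] := @conj_quotient uh vh x z zr Tx.
- by rewrite -Dv.
- by rewrite /conj_value -Du -Dv -Dth E.
exists ((map_poly (evF S z) uh)%:F / (map_poly (evF S z) vh)%:F).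
exists (map_poly (evF S z) uh), (map_poly (evF S z) vh); split=> //.
by rewrite -[X in X / _]/(conj_value z uh) Ep mulfK.
Qed.
End Conjugation.

Variables (N : nat) (C : affset F N) (phi : 'I_N -> {fraction {poly F}}).
Hypothesis C_over : defined_over k C.
Hypothesis C_phi : eq_affset C (param_closure phi).
Hypothesis phi_over : forall j, ratfun_over L (phi j).
Variables (P Q : {mpoly F[N]}).
Hypothesis Q0 : mpoly_at_param Q phi != 0.
Hypothesis PQ : mpoly_at_param P phi / mpoly_at_param Q phi = 'X%:F.

Let T := Subfield (param_field_subfield Hk phi).
Let kT : forall x, S x -> T (cst x). Proof. exact: (param_field_cst Hk). Qed.
Let LD : lindisj (@cst F) k T. Proof. exact: (param_field_lindisj Hk char0 C_phi C_over). Qed.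

(** The coefficients of [P] and [Q] are in [F], not in [L]. Along an [L]-independent family,
    [P(phi) = X Q(phi)] splits into relations with coefficients in [L], because [F] and [L(t)] are
    disjoint over [L]. One of them has a nonzero denominator and gives [X]. *)
Lemma parameter_over_alpha : over_alpha T alpha 'X%:F.
Proof.
have I0 : indep L [::] by move=> b kb E i; rewrite ltn0.
have [d [Id Sd]] := basis_extend HL ([seq P@_m | m <- msupp P] ++ [seq Q@_m | m <- msupp Q]) I0.
rewrite /= in Id Sd.
have [m mP|Pl [LPl DP]] := @mpoly_span_decomposition _ _ HL N d P.
  by apply: Sd; rewrite mem_cat; apply/orP; left; apply: map_f.
have [m mQ|Ql [LQl DQ]] := @mpoly_span_decomposition _ _ HL N d Q.
  by apply: Sd; rewrite mem_cat; apply/orP; right; apply: map_f.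
have HR := ratfun_over_subfield HL.
have Rphi p : mpoly_over L p -> ratfun_over L (mpoly_at_param p phi).
  move=> Lp; apply: subfield_mpoly_at_param => // m.
  exact: (ratfun_over_cst HL).
have Z l : (l < size d)%N -> mpoly_at_param (Pl l) phi - 'X%:F * mpoly_at_param (Ql l) phi = 0.
  apply: (ratfun_over_lindisj HL Id (x := fun l => _ - 'X%:F * _)) => [j|].
    apply: (sfB HR); first exact: Rphi.
    by apply: (sfM HR); [apply: (ratfun_over_X HL) | apply: Rphi].
  under eq_bigr => j _ do rewrite mulrBr mulrCA -!(mmapZ _ (@cst F)).
  rewrite sumrB -mulr_sumr -!(rmorph_sum (mmap (@cst F) phi)) /= -DP -DQ.
  by rewrite -PQ -!mpoly_at_paramE mulfVK // subrr.
have [l lt_l Ql0] : exists2 l, (l < size d)%N & mpoly_at_param (Ql l) phi != 0.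
  apply: NNPP => H; move/eqP: Q0; apply; rewrite mpoly_at_paramE DQ rmorph_sum big1 // => l _.
  rewrite /= mmapZ; apply/eqP; rewrite mulf_eq0; apply/orP; right.
  by apply/negPn/negP => H1; apply: H; exists l.
have HE := over_alpha_subfield kT Da LD.
have Ephi j : over_alpha T alpha (phi j) by apply/over_alpha_T/(param_field_gen Hk).
have -> : 'X%:F = mpoly_at_param (Pl l) phi / mpoly_at_param (Ql l) phi.
  by apply/esym/(canLR (mulfK Ql0))/eqP; rewrite -subr_eq0 Z.
by apply: (sf_div HE); apply: (over_alpha_mpoly kT Da LD).
Qed.

Lemma nonconstant_component : exists j, forall c, phi j <> cst c.
Proof.
apply: NNPP => H.
have Hc j : {c | phi j = cst c}.
  apply: constructive_indefinite_description; apply: NNPP => nc.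
  by apply: H; exists j => c E; apply: nc; exists c.
have E p : mpoly_at_param p phi = cst p.@[fun j => sval (Hc j)].
  rewrite mpoly_at_paramE /mmap mevalE rmorph_sum; apply: eq_bigr => m _.
  rewrite rmorphM rmorph_prod; congr (_ * _); apply: eq_bigr => j _.
  by rewrite rmorphXn /= -(svalP (Hc j)).
move: PQ; rewrite !E -fmorph_div /= /cst => /eqP; rewrite tofrac_eq => /eqP EX.
by have := congr1 (fun z : {poly F} => z`_1) EX; rewrite coefC coefX /= => /eqP; rewrite eq_sym oner_eq0.
Qed.

Lemma ratfun_value_X (r : {fraction {poly F}}) : ratfun_value (@cst F) r 'X%:F r.
Proof.
have [p [q [q0 ->]]] := fracP r; exists p, q.
by rewrite !map_cst_X tofrac_eq0.
Qed.

(* The anticanonical space: conjugation sends [f' X^i] to [f' tau^i / tau'], and as [tau]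
   is a Moebius function of [X] this lies again in [f' F[X]_(<= 2)]. *)
Lemma anticanonical_space : exists2 f' : {fraction {poly F}}, f' != 0 &
  forall i, (i <= 2)%N -> exists g : nat -> {fraction {poly F}},
    (forall l, param_field k phi (g l) /\ exists2 q : {poly F}, (size q <= 3)%N & g l = f' * q%:F) /\
    f' * 'X%:F ^+ i = \sum_(l < n) cst (alpha ^+ l) * g l.
Proof.
have [j nc] := nonconstant_component.
exists (frac_deriv (phi j)).
  by apply/eqP => /(frac_deriv_eq0 char0) [c]; apply: nc.
move=> i i2; have [th Dth] := parameter_over_alpha.
have [rs [Urs conjT conjF]] := conjugates char0 kT Da LD.
have HE := over_alpha_subfield kT Da LD.
have [u [v [Lu Lv v0 Duv]]] := phi_over j.
have poly_E p : poly_over L p -> over_alpha T alpha p%:F.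
  by move=> Lp; rewrite -map_cst_X; apply: (over_alpha_horner kT Da LD) => //; exists th.
have Ef' : over_alpha T alpha (frac_deriv (phi j)).
  rewrite Duv frac_deriv_frac //; apply: (sf_div HE); apply: poly_E.
    by apply: (poly_overB HL); apply: (poly_overM HL) => //; apply: (poly_over_deriv HL).
  by rewrite expr2; apply: (poly_overM HL).
have [|gh sg Dg] := over_alpha_small kT Da LD (x := frac_deriv (phi j) * 'X%:F ^+ i).
  by apply: (sfM HE) => //; apply: (sfX HE); exists th.
have [uh Du] := @poly_lift_adjoin _ S _ _ Da u Lu.
have [vh Dv] := @poly_lift_adjoin _ S _ _ Da v Lv.
have key z : z \in rs -> exists2 q : {poly F}, (size q <= 3)%N &
    evT T z gh = frac_deriv (phi j) * q%:F.
  move=> zr; set tau := evT T z th.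
  (* All [phi l] are fixed by conjugation, so they lie in [F(tau)], and with them
     [X = P(phi) / Q(phi)]. This is what forces [tau] to be a Moebius function of [X]. *)
  have Xtau : gen (@cst F) tau 'X%:F.
    have genphi l : gen (@cst F) tau (phi l).
      apply: (conj_gen kT LD conjT Dth (@transcendental_X F) zr).
        exact: (param_field_gen Hk).
      by exists (phi l); split; [exact: phi_over | exact: ratfun_value_X].
    by rewrite -PQ; apply: (sf_div (gen_subfield _ _)); apply: gen_mpoly.
  have [a [b [c [d [det cd0 Dtau]]]]] := gen_moebius Xtau.
  have v0' : map_poly (evF S alpha) vh != 0 by rewrite -Dv.
  have [|V0 EU] := conj_quotient kT LD conjT Dth (@transcendental_X F)
     zr (param_field_gen Hk phi j) v0' (uh := uh).
    rewrite /conj_value -Du -Dv -Dth !map_cst_X Duv mulfVK ?tofrac_eq0 //.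
  set uz := map_poly (evF S z) uh in EU; set vz := map_poly (evF S z) vh in V0 EU.
  have Eg : evT T z gh * (map_poly (@cst F) vz).[tau] ^+ 2 =
     ((map_poly (@cst F) uz^`()).[tau] * (map_poly (@cst F) vz).[tau] -
      (map_poly (@cst F) uz).[tau] * (map_poly (@cst F) vz^`()).[tau]) * tau ^+ i.
    (* Multiplied by [v^2], the quotient rule for [phi_j = u / v] is an equation between polynomial
       expressions over [T] at [alpha], a form to which conjugation applies directly. *)
    pose lf w := (liftST kT w).[th].
    pose e1 := gh * lf vh ^+ 2; pose e2 := (lf uh^`() * lf vh - lf uh * lf vh^`()) * th ^+ i.
    have E12 : evT T alpha e1 = evT T alpha e2.
      rewrite /e1 /e2 rmorph_mul_sqr rmorph_wronskian /lf !(evT_liftST kT) -Dth -!(deriv_map (evF S alpha)).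
      rewrite -Du -Dv !map_cst_X -Dg Duv frac_deriv_frac // tofracXn.
      by rewrite mulrAC divfK ?expf_neq0 ?tofrac_eq0 // tofracB !tofracM.
    have := conjT z zr e1 e2 E12.
    by rewrite /e1 /e2 rmorph_mul_sqr rmorph_wronskian /lf !(evT_liftST kT) -!(deriv_map (evF S z)).
  have ED := congr1 (@frac_deriv F) EU.
  rewrite /conj_value frac_derivM !frac_deriv_horner in ED.
  have Dt := deriv_quotient_transport V0 EU ED Eg.
  have Dtau' : frac_deriv tau = (a * d - b * c)%:P%:F / (c *: 'X + d%:P)%:F ^+ 2.
    rewrite Dtau frac_deriv_frac // -tofracXn; congr (_%:F / _).
    rewrite !derivD !derivZ derivX !derivC !addr0 -!mul_polyC polyCB !polyCM; ring.
  rewrite Dtau' [in RHS]Dtau in Dt.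
  have BF : (c *: 'X + d%:P)%:F != 0 by rewrite tofrac_eq0.
  have DF : (a * d - b * c)%:P%:F != 0 by rewrite tofrac_eq0 polyC_eq0.
  have := moebius_transport BF DF i2 Dt.
  set A : {poly F} := a *: 'X + b%:P; set B : {poly F} := c *: 'X + d%:P => Hgh.
  have sA : (size A <= 2)%N.
    rewrite (leq_trans (size_polyD _ _)) // geq_max (leq_trans (size_polyC_leq1 _)) // andbT.
    by rewrite (leq_trans (size_scale_leq _ _)) // size_polyX.
  have sB : (size B <= 2)%N.
    rewrite (leq_trans (size_polyD _ _)) // geq_max (leq_trans (size_polyC_leq1 _)) // andbT.
    by rewrite (leq_trans (size_scale_leq _ _)) // size_polyX.
  exists ((a * d - b * c)^-1 *: (A ^+ i * B ^+ (2 - i))).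
    by rewrite (leq_trans (size_scale_leq _ _)) // size_form_bound.
  rewrite Hgh -mul_polyC tofracM (tofracM (A ^+ i)) !tofracXn; congr (_ * _).
  by rewrite mulrC -[X in _ = X * _]/(cst _) fmorphV.
exists (fun l => sfv gh`_l); split=> [l|]; last by rewrite Dg (evT_expand _ sg).
split; first exact: (@sfvP _ T).
have [c Dc] := @interpolation_coef F rs (map_poly (@sfv _ T) gh) l Urs
  (leq_trans (leq_trans (eq_leq (size_map_poly _ _)) sg) (eq_leq (esym (size_tuple rs)))).
rewrite coef_map in Dc.
have Hq z : {q : {poly F} | z \in rs -> (size q <= 3)%N /\ evT T z gh = frac_deriv (phi j) * q%:F}.
  apply: constructive_indefinite_description.
  have [/key [q sq Eq]|nz] := boolP (z \in rs); first by exists q.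
  by exists 0.
exists (\sum_(z <- rs) c z *: sval (Hq z)).
  rewrite big_seq; elim/big_ind: _ => [|p q sp sq|z zr]; first by rewrite size_poly0.
    by rewrite (leq_trans (size_polyD _ _)) // geq_max sp.
  by rewrite (leq_trans (size_scale_leq _ _)) //; case: (svalP (Hq z) zr).
rewrite -[LHS]/(sfv gh`_l) Dc rmorph_sum mulr_sumr big_seq [RHS]big_seq; apply: eq_bigr => z zr.
have [_ Eq] := svalP (Hq z) zr.
rewrite -[X in cst _ * X = _]/(evT T z gh) [X in cst _ * X = _]Eq.
by rewrite /= -mul_polyC tofracM mulrCA.
Qed.
End RationalCurve.

(** * The conic model *)

Section ConicNormalForm.
Variables (F : closedFieldType) (Om : fieldType) (e : {rmorphism F -> Om}).
Variables (k : F -> Prop) (T : Om -> Prop) (f0 f1 : Om).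
Hypotheses (Hk : is_subfield k) (HT : is_subfield T) (kT : forall x, k x -> T (e x)).
Hypothesis ch2 : 2%:R != 0 :> F.

Definition comb (g0 g1 g2 x : Om) := exists a b c, x = e a * g0 + e b * g1 + e c * g2.

(** In the application [f0 = f'] and [f1 = f' X]: as combinations of the [g_i], they allow the
    parameter [X] to be recovered as their quotient. *)
Definition frame (g0 g1 g2 : Om) :=
  [/\ [/\ T g0, T g1 & T g2],
      forall x y z, e x * g0 + e y * g1 + e z * g2 = 0 -> [/\ x = 0, y = 0 & z = 0],
      comb g0 g1 g2 f0 & comb g0 g1 g2 f1].

Lemma frame_swap01 g0 g1 g2 : frame g0 g1 g2 -> frame g1 g0 g2.
Proof.
case=> [[T0 T1 T2] I [a [b [c Ef]]] [a' [b' [c' Ef']]]]; split=> //.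
- by move=> x y z E; have [|-> -> ->] := I y x z; first by rewrite -[RHS]E; ring.
- by exists b, a, c; rewrite Ef; ring.
- by exists b', a', c'; rewrite Ef'; ring.
Qed.

Lemma frame_swap12 g0 g1 g2 : frame g0 g1 g2 -> frame g0 g2 g1.
Proof.
case=> [[T0 T1 T2] I [a [b [c Ef]]] [a' [b' [c' Ef']]]]; split=> //.
- by move=> x y z E; have [|-> -> ->] := I x z y; first by rewrite -[RHS]E; ring.
- by exists a, c, b; rewrite Ef; ring.
- by exists a', c', b'; rewrite Ef'; ring.
Qed.

Lemma frame_scale g0 g1 g2 l : k l -> l != 0 -> frame g0 g1 g2 -> frame (e l * g0) g1 g2.
Proof.
move=> kl l0 [[T0 T1 T2] I [a [b [c Ef]]] [a' [b' [c' Ef']]]].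
have el0 : e l != 0 by rewrite fmorph_eq0.
split.
- by split=> //; apply: (sfM HT) => //; apply: kT.
- move=> x y z E; have [|/eqP] := I (x * l) y z; first by rewrite -[RHS]E rmorphM; ring.
  by rewrite mulf_eq0 (negbTE l0) orbF => /eqP -> -> ->.
- by exists (a / l), b, c; rewrite Ef fmorph_div; field.
- by exists (a' / l), b', c'; rewrite Ef' fmorph_div; field.
Qed.

Lemma frame_add g0 g1 g2 l : k l -> frame g0 g1 g2 -> frame (g0 + e l * g1) g1 g2.
Proof.
move=> kl [[T0 T1 T2] I [a [b [c Ef]]] [a' [b' [c' Ef']]]]; split.
- by split=> //; apply: (sfD HT) => //; apply: (sfM HT) => //; apply: kT.
- move=> x y z E; have [|x0 yl0 z0] := I x (x * l + y) z.
    by rewrite -[RHS]E rmorphD rmorphM; ring.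
  by move: yl0; rewrite x0 mul0r add0r.
- by exists a, (b - a * l), c; rewrite Ef rmorphB rmorphM; ring.
- by exists a', (b' - a' * l), c'; rewrite Ef' rmorphB rmorphM; ring.
Qed.

Definition form (a0 a1 a2 a3 a4 a5 : F) (g0 g1 g2 : Om) :=
  e a0 * g0 ^+ 2 + e a1 * g1 ^+ 2 + e a2 * g2 ^+ 2 + e a3 * (g0 * g1)
  + e a4 * (g0 * g2) + e a5 * (g1 * g2).

Definition on_conic (P : F -> F -> F -> F -> F -> F -> Prop) := exists g0 g1 g2 a0 a1 a2 a3 a4 a5,
  [/\ frame g0 g1 g2, [/\ k a0, k a1 & k a2], [/\ k a3, k a4 & k a5],
      form a0 a1 a2 a3 a4 a5 g0 g1 g2 = 0 & P a0 a1 a2 a3 a4 a5].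

Lemma conic_leading g0 g1 g2 a0 a1 a2 a3 a4 a5 :
  frame g0 g1 g2 -> k a0 -> k a1 -> k a2 -> k a3 -> k a4 -> k a5 ->
  form a0 a1 a2 a3 a4 a5 g0 g1 g2 = 0 ->
  ~ [/\ [/\ a0 = 0, a1 = 0 & a2 = 0] & [/\ a3 = 0, a4 = 0 & a5 = 0]] ->
  on_conic (fun a0 _ _ _ _ _ => a0 != 0).
Proof.
move=> Hf k0 k1 k2 k3 k4 k5 E nz.
have mix h0 h1 h2 b3 b4 b5 : frame h0 h1 h2 -> k b3 -> k b4 -> k b5 -> b3 != 0 ->
    form 0 0 0 b3 b4 b5 h0 h1 h2 = 0 -> on_conic (fun a0 _ _ _ _ _ => a0 != 0).
  move=> Hh k3' k4' k5' b30 E'.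
  (* Writing [h1 = h1' + h0] turns [b3 h0 h1] into [b3 h0^2 + b3 h0 h1'], so a form with mixed terms
     only acquires a square. *)
  exists h0, (h1 + e (- 1) * h0), h2, b3, 0, 0, b3, (b4 + b5), b5; split=> //.
  - apply/frame_swap01/frame_add; last exact: frame_swap01.
    by apply: (sfN Hk); apply: (sf1 Hk).
  - by split=> //; apply: (sf0 Hk).
  - by split=> //; apply: (sfD Hk).
  - by rewrite -[RHS]E' /form !rmorph0 rmorphD rmorphN1; ring.
have [z0|n0] := eqVneq a0 0; last by exists g0, g1, g2, a0, a1, a2, a3, a4, a5.
have [z1|n1] := eqVneq a1 0; last first.
  exists g1, g0, g2, a1, a0, a2, a3, a5, a4; split=> //; first exact: frame_swap01.
  by rewrite -[RHS]E /form; ring.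
have [z2|n2] := eqVneq a2 0; last first.
  exists g2, g1, g0, a2, a1, a0, a5, a4, a3; split=> //.
    by apply/frame_swap01/frame_swap12/frame_swap01.
  by rewrite -[RHS]E /form; ring.
rewrite z0 z1 z2 in E.
have [z3|n3] := eqVneq a3 0; last exact: mix Hf k3 k4 k5 n3 E.
have [z4|n4] := eqVneq a4 0; last first.
  apply: (mix _ _ _ _ _ _ (frame_swap12 Hf) k4 k3 k5 n4).
  by rewrite -[RHS]E /form; ring.
have [z5|n5] := eqVneq a5 0; last first.
  apply: (mix _ _ _ _ _ _ (frame_swap12 (frame_swap01 Hf)) k5 k3 k4 n5).
  by rewrite -[RHS]E /form; ring.
by case: nz.
Qed.

(** Completion of the square in [g0], after multiplication by [4 a0] to avoid denominators. With
    zero discriminant the form would split over the algebraically closed [F] into two linear forms,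
    and one of them would be a relation between the independent [g_i]. *)
Lemma conic_normal_form : on_conic (fun a0 _ _ _ _ _ => a0 != 0) ->
  exists g0 g1 g2 b c d, [/\ frame g0 g1 g2, [/\ k b, k c & k d], c ^+ 2 != b * d
    & g0 ^+ 2 = e b * g1 ^+ 2 + 2%:R * (e c * (g1 * g2)) + e d * g2 ^+ 2].
Proof.
case=> g0 [g1 [g2 [a0 [a1 [a2 [a3 [a4 [a5 [Hf [k0 k1 k2] [k3 k4 k5] E n0]]]]]]]]].
have k2' : k 2%:R by apply: (sf_nat Hk).
have k4' : k 4%:R by apply: (sf_nat Hk).
pose h := e (2%:R * a0) * g0 + e a3 * g1 + e a4 * g2.
pose b := a3 ^+ 2 - 4%:R * (a0 * a1); pose c := a3 * a4 - 2%:R * (a0 * a5).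
pose d := a4 ^+ 2 - 4%:R * (a0 * a2).
have Fh : frame h g1 g2.
  apply: frame_swap12; apply: frame_add => //; apply: frame_swap12; apply: frame_add => //.
  by apply: frame_scale => //; [apply: (sfM Hk) | rewrite mulf_neq0].
have Eh : h ^+ 2 = e b * g1 ^+ 2 + 2%:R * (e c * (g1 * g2)) + e d * g2 ^+ 2.
  apply/eqP; rewrite -subr_eq0; apply/eqP.
  transitivity (4%:R * e a0 * form a0 a1 a2 a3 a4 a5 g0 g1 g2); last by rewrite E mulr0.
  by rewrite /h /b /c /d /form; ring.
exists h, g1, g2, b, c, d; split=> //.
  by split; [apply: (sfB Hk); [apply: (sfX Hk)|] | apply: (sfB Hk) | apply: (sfB Hk); [apply: (sfX Hk)|]];
    do ? apply: (sfM Hk).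
apply/eqP => disc; have [_ I _ _] := Fh.
have sq (x : F) : exists r, r ^+ 2 = x.
  have := @solve_monicpoly F 2 (fun i => if i == 0%N then x else 0) isT.
  case=> r Er; exists r; rewrite Er big_ord_recl big_ord1 /= expr0 mulr1 mul0r addr0 //.
have [b0|bn] := eqVneq b 0.
  have c0 : c = 0 by move/eqP: disc; rewrite b0 mul0r expf_eq0 /= => /eqP.
  have [r Er] := sq d.
  have : (h - e r * g2) * (h + e r * g2) = 0.
    by rewrite -subr_sqr exprMn -rmorphXn Er Eh b0 c0 !rmorph0; ring.
  move/eqP; rewrite mulf_eq0 => /orP [] /eqP E0.
    have [|/eqP] := I 1 0 (- r); first by rewrite rmorph1 rmorph0 rmorphN -[RHS]E0; ring.
    by rewrite oner_eq0.
  have [|/eqP] := I 1 0 r; first by rewrite rmorph1 rmorph0 -[RHS]E0; ring.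
  by rewrite oner_eq0.
have [r Er] := sq b.
have r0 : r != 0 by apply: contraNneq bn => z; rewrite -Er z expr0n.
have : (e r * h - (e b * g1 + e c * g2)) * (e r * h + (e b * g1 + e c * g2)) = 0.
  rewrite -subr_sqr exprMn -rmorphXn Er Eh.
  have -> : e b * (e b * g1 ^+ 2 + 2%:R * (e c * (g1 * g2)) + e d * g2 ^+ 2) - (e b * g1 + e c * g2) ^+ 2 =
    (e b * e d - e c ^+ 2) * g2 ^+ 2 by ring.
  by rewrite -rmorphM -rmorphXn disc subrr mul0r.
move/eqP; rewrite mulf_eq0 => /orP [] /eqP E0.
  have [|/eqP] := I r (- b) (- c); first by rewrite !rmorphN -[RHS]E0; ring.
  by rewrite (negbTE r0).
have [|/eqP] := I r b c; first by rewrite -[RHS]E0; ring.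
by rewrite (negbTE r0).
Qed.
End ConicNormalForm.

Definition rVcoef (R : nzRingType) m (p : {poly R}) : 'rV[R]_m := \row_(i < m) p`_i.

Lemma rVcoef_inj (R : nzRingType) m (p : {poly R}) : (size p <= m)%N -> rVcoef m p = 0 -> p = 0.
Proof.
move=> sp E; apply/polyP => i; rewrite coef0.
have [lt_i|le] := ltnP i m; last by rewrite nth_default // (leq_trans sp).
by have := congr1 (fun A : 'rV[R]_m => A 0 (Ordinal lt_i)) E; rewrite !mxE.
Qed.

Lemma rVcoef_sum (R : nzRingType) m I (r : seq I) (c : I -> R) (q : I -> {poly R}) :
  rVcoef m (\sum_(i <- r) c i *: q i) = \sum_(i <- r) c i *: rVcoef m (q i).
Proof.
apply/rowP => j; rewrite mxE coef_sum summxE; apply: eq_bigr => i _.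
by rewrite coefZ !mxE.
Qed.

Lemma size_lincomb_leq (R : nzRingType) I (r : seq I) (c : I -> R) (p : I -> {poly R}) m :
  (forall i, (size (p i) <= m)%N) -> (size (\sum_(i <- r) c i *: p i)%R <= m)%N.
Proof.
move=> sp; elim/big_ind: _ => [|a b sa sb|i _]; first by rewrite size_poly0.
  by rewrite (leq_trans (size_polyD _ _)) // geq_max sa.
by rewrite (leq_trans (size_scale_leq _ _)).
Qed.

Lemma sum_delta (K : nzRingType) m (c : nat -> K) (i0 : 'I_m) :
  \sum_(i < m) c i * (i == i0 :> nat)%:R = c i0.
Proof.
rewrite (bigD1 i0) //= eqxx mulr1 big1 ?addr0 // => i ne.
by rewrite val_eqE (negbTE ne) mulr0.
Qed.

(** [1], [X] and [X^2] are combinations of the [q i l], so their coefficient rows have full rank and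
    three independent ones can be selected. *)
Lemma quadratic_basis (F : fieldType) n (alpha : nat -> F) (q : 'I_3 -> 'I_n -> {poly F}) :
  (forall i l, size (q i l) <= 3)%N ->
  (forall i : 'I_3, 'X^i = \sum_(l < n) alpha l *: q i l) ->
  exists s : 'I_3 -> 'I_3 * 'I_n,
    (\matrix_(i < 3) rVcoef 3 (q (s i).1 (s i).2)) \in unitmx.
Proof.
move=> sq Eq; pose I : finType := ('I_3 * 'I_n)%type.
pose A : 'M[F]_(#|I|, 3) := \matrix_(r < #|I|) rVcoef 3 (q (enum_val r).1 (enum_val r).2).
have fA : row_full A.
  rewrite -sub1mx; apply/row_subP => i.
  have -> : row i 1%:M = \sum_(l < n) alpha l *: row (enum_rank ((i, l) : I)) A.
    transitivity (rVcoef 3 ('X^i : {poly F})).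
      by apply/rowP => j; rewrite !mxE coefXn eq_sym.
    rewrite Eq rVcoef_sum; apply: eq_bigr => l _; congr (_ *: _).
    by rewrite rowK enum_rankK.
  by apply: summx_sub => l _; apply: scalemx_sub; apply: row_sub.
exists (fun i => enum_val (fullrankfun fA i)).
have := fullrowsub_unit fA; congr (_ \in unitmx).
by apply/row_matrixP => i; rewrite row_rowsub !rowK.
Qed.

Section ConicModel.
Variables (F : closedFieldType) (k : F -> Prop) (alpha : F) (n : nat).
Hypothesis char0 : forall m, m.+1%:R != 0 :> F.
Hypothesis Hk : is_subfield k.
Hypothesis Da : algebraic_of_degree k alpha n.
Variables (N : nat) (C : affset F N) (phi : 'I_N -> {fraction {poly F}}).
Hypothesis C_over : defined_over k C.
Hypothesis C_phi : eq_affset C (param_closure phi).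
Hypothesis phi_over : forall j, ratfun_over (adjoin k alpha) (phi j).
Variables (P Q : {mpoly F[N]}).
Hypothesis Q0 : mpoly_at_param Q phi != 0.
Hypothesis PQ : mpoly_at_param P phi / mpoly_at_param Q phi = 'X%:F.

Lemma conic_model : exists f' g0 g1 g2 b c d, [/\ f' != 0,
  frame (@cst F) (param_field k phi) f' (f' * 'X%:F) g0 g1 g2,
  [/\ k b, k c & k d], c ^+ 2 != b * d
  & g0 ^+ 2 = cst b * g1 ^+ 2 + 2%:R * (cst c * (g1 * g2)) + cst d * g2 ^+ 2].
Proof.
have [f' f0 Hf] := anticanonical_space char0 Hk Da C_over C_phi phi_over Q0 PQ.
exists f'.
have Hg (i : 'I_3) : {gq : (nat -> {fraction {poly F}}) * (nat -> {poly F}) |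
    (forall l, [/\ param_field k phi (gq.1 l), (size (gq.2 l) <= 3)%N & gq.1 l = f' * (gq.2 l)%:F]) /\
    f' * 'X%:F ^+ i = \sum_(l < n) cst (alpha ^+ l) * gq.1 l}.
  apply: constructive_indefinite_description.
  have [g [Hg Eg]] := Hf i (ltn_ord i).
  have Hq l : {q : {poly F} | (size q <= 3)%N /\ g l = f' * q%:F}.
    by apply: constructive_indefinite_description; case: (Hg l) => _ [q]; exists q.
  exists (g, fun l => sval (Hq l)); split=> // l /=.
  by case: (Hg l) => Tg _; case: (svalP (Hq l)).
pose g i l := (sval (Hg i)).1 l; pose q i l := (sval (Hg i)).2 l.
have gT i l : param_field k phi (g i l) by case: (proj1 (svalP (Hg i)) l).
have sq i l : (size (q i l) <= 3)%N by case: (proj1 (svalP (Hg i)) l).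
have gq i l : g i l = f' * (q i l)%:F by case: (proj1 (svalP (Hg i)) l).
have Eq (i : 'I_3) : 'X^i = \sum_(l < n) (alpha ^+ l) *: q i l.
  apply/eqP; rewrite -tofrac_eq rmorph_sum /= tofracXn; apply/eqP; apply: (mulfI f0).
  rewrite (proj2 (svalP (Hg i))) mulr_sumr; apply: eq_bigr => l _.
  by rewrite -[(sval (Hg i)).1 l]/(g i l) gq -mul_polyC tofracM mulrCA.
have [s] := quadratic_basis (fun i (l : 'I_n) => sq i l) Eq.
set M := \matrix_(i < 3) _ => uM.
pose p i := q (s i).1 (s i).2; pose h i := g (s i).1 (s i).2.
have hp i : h i = f' * (p i)%:F by apply: gq.
have sp i : (size (p i) <= 3)%N by apply: sq.
have comb_h (x : 'I_3 -> F) : \sum_i cst (x i) * h i = f' * (\sum_i x i *: p i)%:F.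
  rewrite rmorph_sum mulr_sumr; apply: eq_bigr => i _.
  by rewrite hp /= -mul_polyC tofracM mulrCA.
have MvE (x : 'I_3 -> F) : (\row_i x i) *m M = rVcoef 3 (\sum_i x i *: p i).
  by rewrite rVcoef_sum mulmx_sum_row; apply: eq_bigr => i _; rewrite mxE rowK.
have sum3 (x : 'I_3 -> F) : \sum_i cst (x i) * h i =
    cst (x ord0) * h ord0 + cst (x 1) * h 1 + cst (x ord_max) * h ord_max.
  rewrite !big_ord_recl big_ord0 addr0 addrA; congr (_ + cst (x _) * h _ + cst (x _) * h _);
  exact: val_inj.
have span (r : {poly F}) : (size r <= 3)%N -> comb (@cst F) (h ord0) (h 1) (h ord_max) (f' * r%:F).
  move=> sr; pose x := rVcoef 3 r *m invmx M.
  exists (x 0 ord0), (x 0 1), (x 0 ord_max).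
  rewrite -(sum3 (fun i => x 0 i)) comb_h; congr (_ * _%:F).
  apply/eqP; rewrite -subr_eq0; apply/eqP; apply: (@rVcoef_inj _ 3).
    rewrite (leq_trans (size_polyD _ _)) // geq_max sr size_polyN.
    exact: size_lincomb_leq.
  have -> : rVcoef 3 (r - \sum_i x 0 i *: p i) = rVcoef 3 r - rVcoef 3 (\sum_i x 0 i *: p i).
    by apply/rowP => j; rewrite !mxE coefB.
  rewrite -MvE; have -> : \row_i x 0 i = x by apply/rowP => j; rewrite mxE.
  by rewrite /x mulmxKV // subrr.
have Fh : frame (@cst F) (param_field k phi) f' (f' * 'X%:F) (h ord0) (h 1) (h ord_max).
  split; [by split; apply: gT | | by have := span 1; rewrite tofrac1 mulr1; apply; rewrite size_poly1
    | by apply: span; rewrite size_polyX].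
  move=> x y z E; pose v (i : 'I_3) := [:: x; y; z]`_i.
  have : \sum_i v i *: p i = 0.
    apply/eqP; rewrite -tofrac_eq0; apply/eqP; apply: (mulfI f0).
    by rewrite -comb_h sum3 mulr0 -[RHS]E.
  move=> V0; have := MvE v; rewrite V0.
  have -> : rVcoef 3 (0 : {poly F}) = 0 by apply/rowP => j; rewrite !mxE coef0.
  move=> /(congr1 (fun A => A *m invmx M)); rewrite mulmxK // mul0mx => R0.
  have R i : v i = 0 by have := congr1 (fun A : 'rV[F]_3 => A 0 i) R0; rewrite !mxE.
  by split; [have := R ord0 | have := R 1 | have := R ord_max].
have kT c : k c -> param_field k phi (cst c) by apply: (param_field_cst Hk).
have HT := param_field_subfield Hk phi.
have [|g0 [g1 [g2 [b [c [d [H1 H2 H3 H4]]]]]]] := @conic_normal_form _ _ (@cst F) _ _ f' (f' * 'X%:F) Hk HT kT (char0 1); last first.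
  by exists g0, g1, g2, b, c, d.
(* The six products of the three sections lie in a space of dimension 5. *)
pose pr (i : nat) := nth 0 [:: p ord0 ^+ 2; p 1 ^+ 2; p ord_max ^+ 2; p ord0 * p 1; p ord0 * p ord_max; p 1 * p ord_max] i.
pose hr (i : nat) := nth 0 [:: h ord0 ^+ 2; h 1 ^+ 2; h ord_max ^+ 2; h ord0 * h 1; h ord0 * h ord_max; h 1 * h ord_max] i.
have hpr i : hr i = f' ^+ 2 * (pr i)%:F.
  rewrite /hr /pr !hp; case: i => [|[|[|[|[|[|i]]]]]] /=; rewrite ?tofracM; try ring.
  by rewrite !nth_nil tofrac0 mulr0.
have spr i : (size (pr i) <= 5)%N.
  have S2 a b : (size (p a * p b)%R <= 5)%N.
    have := size_polyMleq (p a) (p b); have := sp a; have := sp b.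
    by move: (size (p a)) (size (p b)) (size _); lia.
  rewrite /pr; case: i => [|[|[|[|[|[|i]]]]]] //=; rewrite ?expr2 ?S2 //.
  by rewrite nth_nil size_poly0.
pose A : 'M[F]_(6, 5) := \matrix_(i < 6) rVcoef 5 (pr i).
have [v vA v0] : exists2 v : 'rV_6, v *m A = 0 & v != 0.
  have : kermx A != 0.
    by rewrite kermx_eq0 /row_free neq_ltn (leq_ltn_trans (rank_leq_col _)).
  case/rowV0Pn => v /sub_kermxP vA v0; by exists v.
have [i0 vi0] : exists i, v 0 i != 0.
  apply: NNPP => H; case/eqP: v0; apply/rowP => i; rewrite mxE; apply: NNPP => /eqP vi.
  by apply: H; exists i.
pose cv (i : nat) : F := if insub i is Some j then v 0 (j : 'I_6) else 0.
have cvE (i : 'I_6) : cv i = v 0 i by rewrite /cv valK.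
have Tr i : param_field k phi (hr i).
  have T2 a b : param_field k phi (h a * h b) by apply: (sfM HT); apply: gT.
  rewrite /hr; case: i => [|[|[|[|[|[|i]]]]]] /=; rewrite ?expr2; try exact: T2.
  by rewrite nth_nil; apply: (sf0 HT).
(* The test vector [y] singles out an index with nonzero coefficient, so the relation over [k] is
   again nontrivial. *)
have [||bb [kb Eb nb]] := lindisj_descent Hk HT kT (param_field_lindisj Hk char0 C_phi C_over)
   (r := 6) (c := cv) (y := fun i => (i == i0 :> nat)%:R) Tr.
- have -> : \sum_(i < 6) cst (cv i) * hr i = f' ^+ 2 * (\sum_(i < 6) v 0 i *: pr i)%:F.
    rewrite rmorph_sum mulr_sumr; apply: eq_bigr => i _.
    by rewrite hpr cvE /= -mul_polyC tofracM mulrCA.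
  have -> : \sum_(i < 6) v 0 i *: pr i = 0; last by rewrite tofrac0 mulr0.
  apply: (@rVcoef_inj _ 5); first exact: size_lincomb_leq.
  rewrite rVcoef_sum -[RHS]vA mulmx_sum_row; apply: eq_bigr => i _.
  by rewrite rowK.
- by rewrite (sum_delta (fun i => cst (cv i))) cvE fmorph_eq0.
rewrite (sum_delta (fun i => cst (bb i))) fmorph_eq0 in nb.
apply: (conic_leading Hk HT kT Fh (kb 0) (kb 1) (kb 2) (kb 3) (kb 4) (kb 5)).
  by rewrite -[RHS]Eb !big_ord_recl big_ord0 /form /hr /= addr0 !addrA.
case=> -[z0 z1 z2] [z3 z4 z5]; case/eqP: nb.
by case: (i0) => [] [|[|[|[|[|[|i]]]]]].
Qed.
End ConicModel.

(** Projection from the point [(eta : 1 : s)] of the conic. With [h = g2 - s g1] one has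
    [g0 = eta g1 + w h] and [g2 = s g1 + h]; the terms in [g1^2] cancel and the equation becomes
    linear in [g1 / h]. *)
Lemma conic_parametrization (K : fieldType) (eta b c d s g0 g1 g2 w : K) :
  2%:R != 0 :> K ->
  g2 - s * g1 != 0 -> eta ^+ 2 = b + 2%:R * (c * s) + d * s ^+ 2 ->
  g0 ^+ 2 = b * g1 ^+ 2 + 2%:R * (c * (g1 * g2)) + d * g2 ^+ 2 ->
  w = (g0 - eta * g1) / (g2 - s * g1) ->
  (2%:R * (eta * w - (c + d * s))) * (g1 / (g2 - s * g1)) = d - w ^+ 2.
Proof.
set h := g2 - s * g1 => ch2 h0 Eeta Eg Dw.
have E1 : w * h = g0 - eta * g1 by rewrite Dw mulfVK.
have E0 : g0 = w * h + eta * g1 by rewrite E1 subrK.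
have E2 : g2 = h + s * g1 by rewrite /h subrK.
apply: (mulIf h0); rewrite -[LHS]mulrA divfK //; apply: (mulIf h0).
have := Eg; rewrite E0 E2 => Eg'.
apply/eqP; rewrite -subr_eq0; apply/eqP.
transitivity ((w * h + eta * g1) ^+ 2 - (b * g1 ^+ 2 + 2%:R * (c * (g1 * (h + s * g1))) + d * (h + s * g1) ^+ 2)
  - (eta ^+ 2 - (b + 2%:R * (c * s) + d * s ^+ 2)) * g1 ^+ 2); first by ring.
by rewrite Eg' Eeta !subrr mul0r subr0.
Qed.

Lemma degenerate_moebius (F K : fieldType) (e : {rmorphism F -> K}) (a b c d : F) (x w : K) :
  e c * x + e d != 0 -> a * d = b * c -> e a * x + e b = w * (e c * x + e d) ->
  exists v, w = e v.
Proof.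
move=> cd0 det E; have [c0|cn] := eqVneq c 0.
  have dn : e d != 0 by move: cd0; rewrite c0 rmorph0 mul0r add0r.
  have a0 : a = 0.
    by apply/eqP; move/eqP: det; rewrite c0 mulr0 mulf_eq0 => /orP [//|/eqP d0]; move: dn; rewrite d0 rmorph0 eqxx.
  exists (b / d); apply: (mulIf dn); rewrite fmorph_div divfK //.
  by move: E; rewrite c0 a0 !rmorph0 !mul0r !add0r.
have en : e c != 0 by rewrite fmorph_eq0.
exists (a / c); apply: (mulIf cd0); rewrite -E fmorph_div.
apply: (mulfI en); rewrite [RHS]mulrA [e c * (_ / _)]mulrC divfK //.
have := congr1 e det; rewrite !rmorphM => detK.
apply/eqP; rewrite -subr_eq0; apply/eqP.
by transitivity (e b * e c - e a * e d); [ring | rewrite detK subrr].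
Qed.

Lemma tofrac_linear (F : fieldType) (p q : F) :
  cst p * 'X%:F + cst q = (p *: 'X + q%:P)%:F :> {fraction {poly F}}.
Proof. by rewrite tofracD -mul_polyC tofracM. Qed.

Lemma moebius_det (F : fieldType) (a b c d : F) (w : {fraction {poly F}}) :
  (forall l, w <> cst l) -> ~ [/\ a = 0, b = 0, c = 0 & d = 0] ->
  cst a * 'X%:F + cst b = w * (cst c * 'X%:F + cst d) ->
  a * d - b * c != 0 /\ c *: 'X + d%:P != 0.
Proof.
move=> nw nz E.
have lin0 p q : p *: 'X + q%:P = 0 :> {poly F} -> p = 0 /\ q = 0.
  move=> E0; have := congr1 (fun z : {poly F} => z`_0) E0.
  have := congr1 (fun z : {poly F} => z`_1) E0.
  by rewrite !coefD !coefZ !coefX ![(_%:P)`__]coefC ?coef0 /= mulr0 mulr1 addr0 add0r => -> ->.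
have cd0 : c *: 'X + d%:P != 0.
  apply/eqP => /[dup] Ecd /lin0 [c0 d0]; move: E; rewrite !tofrac_linear Ecd tofrac0 mulr0 => /eqP.
  by rewrite tofrac_eq0 => /eqP /lin0 [a0 b0]; apply: nz.
split=> //; apply/eqP => /eqP; rewrite subr_eq0 => /eqP det.
have cdF : cst c * 'X%:F + cst d != 0 by rewrite tofrac_linear tofrac_eq0.
have [v Dv] := degenerate_moebius cdF det E; exact: (nw v).
Qed.

(** A constant value [l] of the projection would be a linear relation between the [g_i], nontrivial
    since [g0] has coefficient 1. *)
Lemma linear_dependence (R : comNzRingType) (g0 g1 g2 eta l s : R) :
  l * (g2 - s * g1) = g0 - eta * g1 ->
  1 * g0 + (- eta + l * s) * g1 + - l * g2 = 0.
Proof.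
move=> E; transitivity (g0 - eta * g1 - l * (g2 - s * g1)); first by ring.
by rewrite E subrr.
Qed.

Lemma rmorph_conic (R S : comNzRingType) (e : {rmorphism R -> S}) (b c d s : R) :
  e (b + 2%:R * (c * s) + d * s ^+ 2) = e b + 2%:R * (e c * e s) + e d * e s ^+ 2.
Proof. by rewrite !rmorphD !rmorphM rmorph_nat -expr2. Qed.

Lemma split_div (K : fieldType) (x y e h : K) : x / h = (x - e * y) / h + e * (y / h).
Proof. by rewrite mulrBl mulrA subrK. Qed.

Lemma div_div_cancel (K : fieldType) (x y h : K) : x != 0 -> h != 0 -> x * y / h / (x / h) = y.
Proof. by move=> x0 h0; rewrite invf_div mulrA divfK // mulrAC mulfV // mul1r. Qed.

(** * Projection of the conic and descent to the quadratic extension *)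

Section Reparametrization.
Variables (F : closedFieldType) (k k' : F -> Prop) (alpha : F) (n : nat).
Hypothesis char0 : forall m, m.+1%:R != 0 :> F.
Hypotheses (Hk : is_subfield k) (Hk' : is_subfield k') (kk' : forall x, k x -> k' x).
Hypothesis Da : algebraic_of_degree k alpha n.
Variables (N : nat) (C : affset F N) (phi : 'I_N -> {fraction {poly F}}).
Hypothesis C_over : defined_over k C.
Hypothesis C_phi : eq_affset C (param_closure phi).
Hypothesis phi_over : forall j, ratfun_over (adjoin k alpha) (phi j).
Variables (f' g0 g1 g2 : {fraction {poly F}}) (b c d s eta : F).
Hypothesis f0 : f' != 0.
Hypothesis Fg : frame (@cst F) (param_field k phi) f' (f' * 'X%:F) g0 g1 g2.
Hypotheses (kb : k b) (kc : k c) (kd : k d) (ks : k s) (keta : k' eta).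
Hypothesis eta0 : eta != 0.
Hypothesis Eg : g0 ^+ 2 = cst b * g1 ^+ 2 + 2%:R * (cst c * (g1 * g2)) + cst d * g2 ^+ 2.
Hypothesis Eeta : eta ^+ 2 = b + 2%:R * (c * s) + d * s ^+ 2.

Let h := g2 - cst s * g1.
Let w := (g0 - cst eta * g1) / h.

Lemma frame_indep x y z : cst x * g0 + cst y * g1 + cst z * g2 = 0 -> [/\ x = 0, y = 0 & z = 0].
Proof. by case: Fg => _ H _ _; apply: H. Qed.

Lemma reparam_den : h != 0.
Proof.
apply/eqP => E; have [|_ _ /eqP] := @frame_indep 0 (- s) 1.
  by rewrite -[RHS]E /h rmorph0 rmorphN rmorph1 mul0r add0r mul1r mulNr addrC.
by rewrite oner_eq0.
Qed.

Lemma reparam_nonconst l : w <> cst l.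
Proof.
move=> E; have [|/eqP] := @frame_indep 1 (- eta + l * s) (- l); last by rewrite oner_eq0.
have E' : cst l * (g2 - cst s * g1) = g0 - cst eta * g1 by rewrite -E; apply: (divfK reparam_den).
by rewrite rmorph1 rmorphD rmorphM !rmorphN; apply: linear_dependence E'.
Qed.

Let tr_w : transcendental (@cst F) w.
Proof. exact/transcendental_nonconst/reparam_nonconst. Qed.

Lemma param_field_sub x : param_field k phi x -> param_field k' phi x.
Proof.
have sub y : param_ring k phi y -> param_ring k' phi y.
  by case=> G kG ->; exists G => // m; apply/kk'/kG.
by case=> p [q [/sub Hp /sub Hq q0 ->]]; exists p, q.
Qed.

Lemma reparam_field : param_field k' phi w.
Proof.
have HT := param_field_subfield Hk' phi; case: Fg => -[T0 T1 T2] _ _ _.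
have kT := @param_field_cst F k' Hk' N phi.
apply: (sf_div HT); apply: (sfB HT); try exact: param_field_sub;
by apply: (sfM HT); [apply: kT; try exact: kk' | apply: param_field_sub].
Qed.

(** The projection formula makes every [g_i / h] rational in [w]. As [f'] and [f' X] are
    combinations of the [g_i], their quotient [X] is rational in [w] too. *)
Lemma parameter_gen : gen (@cst F) w 'X%:F.
Proof.
have HG := gen_subfield (@cst F) w; have h0 := reparam_den.
have ch2 : 2%:R != 0 :> {fraction {poly F}} by rewrite -(rmorph_nat (@cst F)) fmorph_eq0.
have E : cst eta ^+ 2 = cst b + 2%:R * (cst c * cst s) + cst d * cst s ^+ 2.
  by rewrite -rmorphXn Eeta; apply: rmorph_conic.
have := conic_parametrization ch2 h0 E Eg (erefl w); rewrite -/h; set l := _ * (_ - _) => EQ.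
(* If [l] were zero, [w] would be the constant [(c + d s) / eta]; the division relies on [eta] being
   nonzero. *)
have l0 : l != 0.
  apply: mulf_neq0; first exact: ch2.
  apply/eqP => /eqP; rewrite subr_eq0 => /eqP E1.
  apply: (@reparam_nonconst ((c + d * s) / eta)).
  have en : cst eta != 0 by rewrite fmorph_eq0.
  have Ev : eta * ((c + d * s) / eta) = c + d * s by rewrite mulrC divfK.
  apply: (mulfI en); rewrite E1 -[RHS]rmorphM Ev.
  symmetry; etransitivity; [exact: rmorphD | congr (_ + _); exact: rmorphM].
have Gc y : gen (@cst F) w (cst y) by apply: gen_cst.
have Gw : gen (@cst F) w w by apply: gen_self.
have Gl : gen (@cst F) w l.
  apply: (sfM HG); first by apply: (sf_nat HG).
  by apply: (sfB HG); [apply: (sfM HG) | apply: (sfD HG) => //; apply: (sfM HG)].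
have G1 : gen (@cst F) w (g1 / h).
  have -> : g1 / h = (cst d - w ^+ 2) / l by rewrite -EQ [l * _]mulrC; symmetry; exact: (mulfK l0).
  by apply: (sf_div HG) => //; apply: (sfB HG) => //; apply: (sfX HG).
have G0 : gen (@cst F) w (g0 / h).
  have -> : g0 / h = w + cst eta * (g1 / h) by exact: split_div.
  by apply: (sfD HG) => //; apply: (sfM HG).
have G2 : gen (@cst F) w (g2 / h).
  have -> : g2 / h = 1 + cst s * (g1 / h).
    by rewrite -[1](divff h0); exact: split_div.
  by apply: (sfD HG); [apply: (sf1 HG) | apply: (sfM HG)].
have Gcomb x : comb (@cst F) g0 g1 g2 x -> gen (@cst F) w (x / h).
  case=> [p [q [r ->]]]; rewrite !mulrDl -!mulrA.
  by apply: (sfD HG); first apply: (sfD HG); apply: (sfM HG); first [exact: Gc | exact: G0 | exact: G1 | exact: G2].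
case: Fg => _ _ /Gcomb Hf /Gcomb HfX.
have := sf_div HG HfX Hf; rewrite (div_div_cancel _ f0 h0); apply.
Qed.

Lemma adjoin_mono x : adjoin k alpha x -> adjoin k' alpha x.
Proof.
apply: adjoin_min; [exact: adjoin_subfield | | exact: adjoin_gen].
by move=> y /kk' ky; apply: adjoin_base.
Qed.

Lemma phi_over' j : ratfun_over (adjoin k' alpha) (phi j).
Proof.
have [p [q [Lp Lq q0 ->]]] := phi_over j; exists p, q.
by split=> // i; apply: adjoin_mono.
Qed.

Lemma param_field_ratfun_over x : param_field k' phi x -> ratfun_over (adjoin k' alpha) x.
Proof.
have HL := @adjoin_subfield _ k' alpha; have HR := ratfun_over_subfield HL.
have sub y : param_ring k' phi y -> ratfun_over (adjoin k' alpha) y.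
  case=> G kG ->; apply: subfield_mpoly_at_param => // [m|j]; last exact: phi_over'.
  by apply: (ratfun_over_cst HL); apply: adjoin_base.
by case=> p [q [/sub Hp /sub Hq _ ->]]; apply: (sf_div HR).
Qed.

(** [gen_moebius] only gives coefficients in [F]. The relation [a X + b = w (c X + d)] is linear in
    them, with entries in [k'(alpha)(t)], so it descends to [k'(alpha)]. The new determinant is
    nonzero because [w] is not constant. *)
Lemma reparam_moebius : exists a1 b1 c1 d1 : F,
  [/\ [/\ adjoin k' alpha a1, adjoin k' alpha b1, adjoin k' alpha c1 & adjoin k' alpha d1],
      a1 * d1 - b1 * c1 != 0 &
      cst a1 * 'X%:F + cst b1 = w * (cst c1 * 'X%:F + cst d1)].
Proof.
have [a1 [b1 [c1 [d1 [det cd0 Dw]]]]] := gen_moebius parameter_gen.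
have HL := @adjoin_subfield _ k' alpha; have HR := ratfun_over_subfield HL.
have Rw := param_field_ratfun_over reparam_field.
have RX := ratfun_over_X HL.
pose x (i : nat) := nth 0 [:: 'X%:F; 1; - (w * 'X%:F); - w] i.
pose cc (i : nat) := nth 0 [:: a1; b1; c1; d1] i.
have Rx i : ratfun_over (adjoin k' alpha) (x i).
  case: i => [|[|[|[|i]]]] //=.
  - exact: (sf1 HR).
  - by apply: (sfN HR); apply: (sfM HR).
  - exact: (sfN HR).
  - by rewrite /x nth_default //; apply: (sf0 HR).
have E : cst a1 * 'X%:F + cst b1 = w * (cst c1 * 'X%:F + cst d1).
  by rewrite !tofrac_linear Dw; symmetry; apply: divfK; rewrite tofrac_eq0.
have [i0 i0n] : exists i0 : 'I_4, cc i0 != 0.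
  apply: NNPP => H; have Z i : (i < 4)%N -> cc i = 0.
    by move=> lt; apply: NNPP => /eqP ne; apply: H; exists (Ordinal lt).
  by move: det; rewrite [a1](Z 0%N) // [b1](Z 1%N) // !mul0r subrr eqxx.
have four (v : nat -> F) : \sum_(i < 4) cst (v i) * x i =
    (cst (v 0%N) * 'X%:F + cst (v 1%N)) - w * (cst (v 2) * 'X%:F + cst (v 3)).
  rewrite !big_ord_recl big_ord0 /x /= addr0 mulr1 !mulrN mulrDr opprD !addrA.
  by rewrite [w * (_ * _)]mulrCA [w * cst _]mulrC.
have [||v [Lv Ev nv]] := lindisj_descent HL HR (@ratfun_over_cst F _ HL) (ratfun_over_lindisj HL)
   (r := 4) (c := cc) (y := fun i => (i == i0 :> nat)%:R) Rx.
- by rewrite four E subrr.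
- by rewrite (sum_delta (fun i => cst (cc i))) fmorph_eq0.
rewrite (sum_delta (fun i => cst (v i))) fmorph_eq0 in nv.
rewrite four in Ev; move/eqP: Ev; rewrite subr_eq0 => /eqP Ev.
exists (v 0%N), (v 1%N), (v 2), (v 3); split=> //.
have [] // := moebius_det reparam_nonconst _ Ev.
case=> v0 v1 v2 v3; case/eqP: nv.
by case: (i0) => [] [|[|[|[|i]]]].
Qed.

(** Since [X] lies in [F(w)], so does [phi_j]. The relation [p(w) = phi_j q(w)] then descends from
    [F] to [k'], because [w] and [phi_j] lie in [k'(phi)], which is disjoint from [F]. *)
Lemma phi_reparam j : exists r, ratfun_over k' r /\ ratfun_value (@cst F) r w (phi j).
Proof.
have HG := gen_subfield (@cst F) w.
have [u [v [v0 Dphi]]] := fracP (phi j).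
have Gp (p : {poly F}) : gen (@cst F) w p%:F.
  rewrite -map_cst_X; apply: (sf_horner HG); last exact: parameter_gen.
  by move=> i; rewrite coef_map; apply: gen_cst.
have [r0 Hr0] : gen (@cst F) w (phi j).
  by rewrite Dphi; apply: (sf_div HG); apply: Gp.
have [p [q [q0 Dr]]] := fracP r0; rewrite Dr in Hr0; have E := rv_eval q0 Hr0.
have C_over' : defined_over k' C.
  by case: C_over => G kG HG'; exists G => // g /kG kg m; apply/kk'/kg.
pose m := maxn (size p) (size q).
have kT := @param_field_cst F k' Hk' N phi.
have HT := param_field_subfield Hk' phi.
(* Indices below [m] carry the coefficients of [p], the next [m] those of [q]. The family [y]
   computes [q(w)], which has to remain nonzero under the descent. *)
pose x i := if (i < m)%N then w ^+ i else - (phi j * w ^+ (i - m)).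
pose y i := if (i < m)%N then 0 else w ^+ (i - m).
pose cc (i : nat) := if (i < m)%N then p`_i else q`_(i - m).
have Tx i : param_field k' phi (x i).
  have Tw l : param_field k' phi (w ^+ l) by apply: (sfX HT); apply: reparam_field.
  rewrite /x; case: ifP => // _; apply: (sfN HT); apply: (sfM HT) => //.
  exact: (param_field_gen Hk').
have splitx (z : nat -> F) : \sum_(i < m + m) cst (z i) * x i =
   (map_poly (@cst F) (\poly_(i < m) z i)).[w] -
   phi j * (map_poly (@cst F) (\poly_(i < m) z (m + i)%N)).[w].
  rewrite big_split_ord /= !(@horner_coef_wide _ m) ?size_map_poly ?size_poly //.
  rewrite mulr_sumr -sumrN; congr (_ + _); apply: eq_bigr => i _.
    by rewrite /x ltn_ord coef_map coef_poly ltn_ord.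
  rewrite /x ltnNge leq_addr /= addKn coef_map coef_poly ltn_ord /=.
  by rewrite mulrN mulrCA.
have splity (z : nat -> F) : \sum_(i < m + m) cst (z i) * y i =
   (map_poly (@cst F) (\poly_(i < m) z (m + i)%N)).[w].
  rewrite big_split_ord /= [X in X + _]big1 ?add0r => [|i _].
    rewrite (@horner_coef_wide _ m) ?size_map_poly ?size_poly //; apply: eq_bigr => i _.
    by rewrite /y ltnNge leq_addr /= addKn coef_map coef_poly ltn_ord.
  by rewrite /y ltn_ord mulr0.
have pE : \poly_(i < m) cc i = p.
  apply/polyP => i; rewrite coef_poly /cc; have [//|le] := ltnP i m.
  by rewrite nth_default // (leq_trans _ le) // leq_maxl.
have qE : \poly_(i < m) cc (m + i)%N = q.
  apply/polyP => i; rewrite coef_poly /cc [(m + i < m)%N]ltnNge leq_addr /= addKn; have [//|le] := ltnP i m.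
  by rewrite nth_default // (leq_trans _ le) // leq_maxr.
have [||z [kz Ez nz]] := lindisj_descent Hk' HT kT (param_field_lindisj Hk' char0 C_phi C_over')
   (r := m + m) (c := cc) (y := y) Tx.
- by rewrite splitx pE qE E subrr.
- by rewrite splity qE; apply: tr_w.
rewrite splity in nz; rewrite splitx in Ez.
set p' := \poly_(i < m) z i in Ez; set q' := \poly_(i < m) z (m + i)%N in Ez nz.
exists (p'%:F / q'%:F); split.
  exists p', q'; split=> //; last exact: map_neq0_neq0 nz.
    by move=> i; rewrite coef_poly; case: ifP => // _; apply: (sf0 Hk').
  by move=> i; rewrite coef_poly; case: ifP => // _; apply: (sf0 Hk').
exists p', q'; split=> //.
by move/eqP: Ez; rewrite subr_eq0 => /eqP ->; rewrite mulfK.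
Qed.
End Reparametrization.

(** * The witness set *)

Section WitnessIdentity.
Variables (F : fieldType) (n : nat).
Local Notation mpC := (@mpolyC n F).

Lemma mpoly_frac_const_scale (c : F) (g : {mpoly F[n]}) :
  mpoly_frac_const n c * g%:F = (c *: g)%:F.
Proof. by rewrite /mpoly_frac_const -tofracM mul_mpolyC. Qed.

Lemma horner_map_mpolyC (E : nzRingType) (e : {rmorphism F -> E}) (h : {rmorphism {mpoly F[n]} -> E})
    (p : {poly F}) y :
  (forall c, h c%:MP = e c) -> h (map_poly mpC p).[y] = (map_poly e p).[h y].
Proof.
move=> H; rewrite -horner_map -map_poly_comp; congr (_.[_]).
by apply: eq_map_poly => c /=.
Qed.

(** Without denominators the expansion becomes a polynomial identity, which can be conjugated and
    evaluated at points. *)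
Lemma witness_identity (p q : {poly F}) (x delta : {mpoly F[n]}) (c : 'I_n -> F) (f : 'I_n -> {mpoly F[n]}) :
  q != 0 -> delta != 0 ->
  ratfun_value (@mpoly_frac_const F n) (p%:F / q%:F) x%:F
    (\sum_(i < n) mpoly_frac_const n (c i) * ((f i)%:F / delta%:F)) ->
  delta * (map_poly mpC p).[x] = (map_poly mpC q).[x] * \sum_(i < n) c i *: f i.
Proof.
move=> q0 d0; pose e : {rmorphism F -> {fraction {mpoly F[n]}}} := @tofrac _ \o mpC.
set v := \sum_(i < n) _ => H.
have dF : delta%:F != 0 by rewrite tofrac_eq0.
have Dv : v * delta%:F = (\sum_(i < n) c i *: f i)%:F.
  rewrite mulr_suml rmorph_sum; apply: eq_bigr => i _.
  by rewrite -mulrA (divfK dF) mpoly_frac_const_scale.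
have He (r : {poly F}) : (map_poly e r).[x%:F] = ((map_poly mpC r).[x])%:F.
  by symmetry; apply: (@horner_map_mpolyC _ e (@tofrac {mpoly F[n]})).
have := @rv_eval F _ e p q _ _ q0 H; rewrite !He => E.
apply/eqP; rewrite -tofrac_eq !tofracM -E -Dv mulrCA [X in _ == X]mulrCA.
by rewrite [X in v * X]mulrC.
Qed.
End WitnessIdentity.

Section WitnessConjugation.
Variables (F : closedFieldType) (S : subfield F) (alpha z : F) (n : nat).
Hypothesis conjF : forall e1 e2, evF S alpha e1 = evF S alpha e2 -> evF S z e1 = evF S z e2.
Local Notation mpC := (@mpolyC n F).

Lemma mpoly_over_evF (p : {mpoly F[n]}) : mpoly_over S p ->
  exists ph : {mpoly {poly sfT S}[n]}, forall y, map_mpoly (evF S y) ph = p.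
Proof.
move=> /mpoly_over_lift [p0 ->]; exists (map_mpoly polyC p0) => y.
apply/mpolyP => m; rewrite !mcoeff_map_mpoly /= /horner_eval map_polyC hornerC //.
Qed.

Lemma evF_horner_mpoly y (uh : {poly {poly sfT S}}) :
  map_mpoly (evF S y) (map_poly (@mpolyC n _) uh).[\sum_(i < n) ('X^i)%:MP * 'X_i] =
  (map_poly mpC (map_poly (evF S y) uh)).[\sum_(i < n) y ^+ i *: 'X_i].
Proof.
rewrite -horner_map -!map_poly_comp rmorph_sum; congr (_.[_]).
  by apply: eq_map_poly => c; apply: map_mpolyC.
apply: eq_bigr => i _; rewrite rmorphM /= map_mpolyC map_mpolyX -mul_mpolyC.
by congr (_%:MP * _); rewrite /= /horner_eval map_polyXn hornerXn.
Qed.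

Lemma witness_conj (uh vh : {poly {poly sfT S}}) (f : 'I_n -> {mpoly F[n]}) (delta : {mpoly F[n]}) :
  (forall i, mpoly_over S (f i)) -> mpoly_over S delta ->
  delta * (map_poly mpC (map_poly (evF S alpha) uh)).[\sum_(i < n) alpha ^+ i *: 'X_i] =
    (map_poly mpC (map_poly (evF S alpha) vh)).[\sum_(i < n) alpha ^+ i *: 'X_i] *
      \sum_(i < n) alpha ^+ i *: f i ->
  delta * (map_poly mpC (map_poly (evF S z) uh)).[\sum_(i < n) z ^+ i *: 'X_i] =
    (map_poly mpC (map_poly (evF S z) vh)).[\sum_(i < n) z ^+ i *: 'X_i] *
      \sum_(i < n) z ^+ i *: f i.
Proof.
move=> Sf /mpoly_over_evF [dh Dd].
have Hf i : {fh : {mpoly {poly sfT S}[n]} | forall y, map_mpoly (evF S y) fh = f i}.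
  exact/constructive_indefinite_description/mpoly_over_evF.
pose x := \sum_(i < n) ('X^i)%:MP_[n] * 'X_i : {mpoly {poly sfT S}[n]}.
pose e1 := dh * (map_poly (@mpolyC n _) uh).[x].
pose e2 := (map_poly (@mpolyC n _) vh).[x] * \sum_(i < n) ('X^i)%:MP * sval (Hf i).
have E1 y : map_mpoly (evF S y) e1 =
    delta * (map_poly mpC (map_poly (evF S y) uh)).[\sum_(i < n) y ^+ i *: 'X_i].
  by rewrite rmorphM /= Dd evF_horner_mpoly.
have E2 y : map_mpoly (evF S y) e2 =
    (map_poly mpC (map_poly (evF S y) vh)).[\sum_(i < n) y ^+ i *: 'X_i] * \sum_(i < n) y ^+ i *: f i.
  rewrite rmorphM /= evF_horner_mpoly rmorph_sum; congr (_ * _); apply: eq_bigr => i _.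
  rewrite rmorphM /= map_mpolyC (svalP (Hf i)) -mul_mpolyC.
  by congr (_%:MP * _); rewrite /= /horner_eval map_polyXn hornerXn.
rewrite -!E1 -!E2 => /mpolyP E; apply/mpolyP => m.
by have := E m; rewrite !mcoeff_map_mpoly => /conjF.
Qed.

Lemma witness_conj_eval (uh vh : {poly {poly sfT S}}) (f : 'I_n -> {mpoly F[n]}) (delta : {mpoly F[n]}) (x : 'I_n -> F) :
  (forall i, mpoly_over S (f i)) -> mpoly_over S delta ->
  delta * (map_poly mpC (map_poly (evF S alpha) uh)).[\sum_(i < n) alpha ^+ i *: 'X_i] =
    (map_poly mpC (map_poly (evF S alpha) vh)).[\sum_(i < n) alpha ^+ i *: 'X_i] *
      \sum_(i < n) alpha ^+ i *: f i ->
  delta.@[x] * (map_poly (evF S z) uh).[\sum_(i < n) z ^+ i * x i] =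
    (map_poly (evF S z) vh).[\sum_(i < n) z ^+ i * x i] * \sum_(i < n) z ^+ i * (f i).@[x].
Proof.
move=> Sf Sd E; have := congr1 (meval x) (witness_conj Sf Sd E).
have HX : (\sum_(i < n) z ^+ i *: 'X_i).@[x] = \sum_(i < n) z ^+ i * x i.
  by rewrite rmorph_sum; apply: eq_bigr => i _ /=; rewrite mevalZ mevalXU.
have Hh p : ((map_poly mpC p).[\sum_(i < n) z ^+ i *: 'X_i]).@[x] = p.[\sum_(i < n) z ^+ i * x i].
  rewrite (@horner_map_mpolyC _ _ _ idfun (meval x)); last by move=> c; apply: mevalC.
  by rewrite map_poly_id //; congr p.[_]; apply: HX.
rewrite !rmorphM /= !Hh => ->; congr (_ * _).
by rewrite rmorph_sum; apply: eq_bigr => i _ /=; rewrite mevalZ.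
Qed.
End WitnessConjugation.

(** Coprimality is recorded as a Bezout relation over [L], a form that is preserved when the
    coefficients are conjugated. *)
Lemma ratfun_over_coprime (F : fieldType) (L : F -> Prop) (r : {fraction {poly F}}) :
  is_subfield L -> ratfun_over L r ->
  exists p q u v : {poly F}, [/\ poly_over L p, poly_over L q, poly_over L u, poly_over L v &
    u * p + v * q = 1 /\ (q != 0 /\ r = p%:F / q%:F)].
Proof.
move=> HL [p1 [q1 [Lp Lq q0 ->]]]; set S := Subfield HL.
have [p ->] := @poly_over_lift _ S _ Lp; have [q Eq] := @poly_over_lift _ S _ Lq.
have q0' : q != 0 by apply: contraNneq q0 => E; rewrite Eq E rmorph0.
set g := gcdp p q.
have ga : p = (p %/ g) * g by rewrite divpK ?dvdp_gcdl.
have gb : q = (q %/ g) * g by rewrite divpK ?dvdp_gcdr.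
have g0 : g != 0 by rewrite gcdp_eq0 negb_and q0' orbT.
have q10 : q %/ g != 0 by apply: contraNneq q0' => E; rewrite gb E mul0r.
have cop : coprimep (p %/ g) (q %/ g) by apply: coprimep_div_gcd; rewrite q0' orbT.
have /Bezout_coprimepP [[u v] /= /eqpP [[x y] /= /andP [x0 y0] E]] := cop.
have Sv w : poly_over L (map_poly (@sfv _ S) w) by apply: (@poly_over_sfv _ S).
exists (map_poly (@sfv _ S) (p %/ g)), (map_poly (@sfv _ S) (q %/ g)).
exists (map_poly (@sfv _ S) ((x / y) *: u)), (map_poly (@sfv _ S) ((x / y) *: v)).
split; [exact: Sv | exact: Sv | exact: Sv | exact: Sv | split].
  rewrite -!rmorphM -rmorphD -!scalerAl -scalerDr mulrC -scalerA E scalerA mulVf // scale1r.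
  by rewrite rmorph1.
split; first by rewrite map_poly_eq0.
apply/frac_eq; rewrite ?map_poly_eq0 //.
by rewrite Eq -!rmorphM [in LHS]ga [in RHS]gb; congr (map_poly _ _); ring.
Qed.

Lemma lindisj_powers (F Om : fieldType) (e : {rmorphism F -> Om}) (k : F -> Prop) (R : Om -> Prop) a n
    (y : nat -> Om) :
  is_subfield k -> is_subfield R -> (forall x, k x -> R (e x)) -> lindisj e k R ->
  algebraic_of_degree k a n -> (forall i, R (y i)) ->
  \sum_(i < n) e (a ^+ i) * y i = 0 -> forall i, (i < n)%N -> y i = 0.
Proof.
move=> Hk HR kR LD Da Ry E i lt_i.
have [_ min] := lindisj_degree Hk kR LD Da.
suff E0 : \poly_(i < n) y i = 0 by have := coef_poly n y i; rewrite E0 coef0 lt_i.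
apply: NNPP => /eqP q0; have := size_poly n y; rewrite leqNgt; apply/negP/negPn.
apply: min q0 _; first by move=> l; rewrite coef_poly; case: ifP => // _; apply: (sf0 HR).
rewrite rootE horner_poly -[X in _ == X]E; apply/eqP/eq_bigr => l _.
by rewrite rmorphXn mulrC.
Qed.

Lemma linear_poly_neq0 (F : fieldType) (a b c d : F) : a * d - b * c != 0 -> c *: 'X + d%:P != 0 :> {poly F}.
Proof.
apply: contra_neq => E.
have := congr1 (fun p : {poly F} => p`_0) E; have := congr1 (fun p : {poly F} => p`_1) E.
by rewrite !coefD !coefZ !coefX ![(_%:P)`__]coefC ?coef0 /= mulr0 mulr1 addr0 add0r => -> ->; rewrite !mulr0 subrr.
Qed.

Lemma moebius_nonconst (F K : fieldType) (e : {rmorphism F -> K}) (a b c d : F) (x w : K) :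
  (forall l, x <> e l) -> a * d - b * c != 0 -> w * (e c * x + e d) = e a * x + e b ->
  forall l, w <> e l.
Proof.
move=> nx det E l Dw; have E1 : e (a - l * c) * x = e (l * d - b).
  apply/eqP; rewrite -subr_eq0 !rmorphB !rmorphM; apply/eqP.
  transitivity ((e a * x + e b) - (e l) * (e c * x + e d)); first by ring.
  by rewrite -E Dw subrr.
have [E2|ne] := eqVneq (a - l * c) 0; last first.
  apply: (nx ((l * d - b) / (a - l * c))).
  by rewrite fmorph_div -E1 mulrC mulKf // fmorph_eq0.
move: E1; rewrite E2 rmorph0 mul0r => /esym/eqP; rewrite fmorph_eq0 subr_eq0 => /eqP E3.
move/eqP: E2; rewrite subr_eq0 => /eqP E2.
by move: det; rewrite E2 -E3 => /eqP; apply; ring.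
Qed.

Lemma inverse_moebius (R : comNzRingType) (a b c d x m : R) :
  m * (c * x + d) = a * x + b -> d * m - b = x * (a - c * m).
Proof.
move=> E; transitivity (m * (c * x + d) - b - c * x * m); first by ring.
by rewrite E; ring.
Qed.

(* [p(m) = r] may be checked after substituting the transcendental [w], where both sides
   become [p]. *)
Lemma rv_compose (F : fieldType) (p r w m : {fraction {poly F}}) :
  transcendental (@cst F) w -> transcendental (@cst F) m ->
  ratfun_value (@cst F) r w p -> ratfun_value (@cst F) m w 'X%:F ->
  ratfun_value (@cst F) p m r.
Proof.
move=> tw tm Hr Hm; have [u [v [v0 Dp]]] := fracP p.
have Hh (q : {poly F}) : ratfun_value (@cst F) (map_poly (@cst F) q).[m] w q%:F.
  rewrite -map_cst_X !horner_coef !size_map_poly; apply: rv_sum => i _.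
  rewrite !coef_map; apply: rv_mul; [exact: rv_cst | exact: rv_exp].
have E : (map_poly (@cst F) u).[m] - r * (map_poly (@cst F) v).[m] = 0.
  have vF : v%:F != 0 by rewrite tofrac_eq0.
  have Du : p * v%:F = u%:F by rewrite Dp; apply: (divfK vF).
  have := rv_add (Hh u) (rv_opp (rv_mul Hr (Hh v))); rewrite Du subrr.
  exact: (rv_eq0 tw).
exists u, v; split; [exact: Dp | exact: tm |].
apply: (mulIf (tm v v0)); rewrite (divfK (tm v v0)).
by symmetry; apply/eqP; rewrite -subr_eq0; apply/eqP.
Qed.

Lemma map_poly_bezout (A B : comNzRingType) (g : {rmorphism A -> B}) (u p v q : {poly A}) :
  map_poly g (u * p + v * q) = map_poly g u * map_poly g p + map_poly g v * map_poly g q.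
Proof. by rewrite rmorphD !rmorphM. Qed.

Lemma mulr_cross_cancel (R : comNzRingType) (x A B : R) : x * A * B - A * (x * B) = 0.
Proof. by ring. Qed.

(** Vandermonde in polynomial form: the differences are the coefficients of a polynomial of size at
    most [n] with [n] distinct roots. *)
Lemma power_sums_inj (F : fieldType) n (rs : seq F) (x y : 'I_n -> F) : uniq rs -> size rs = n ->
  (forall z, z \in rs -> \sum_(i < n) z ^+ i * x i = \sum_(i < n) z ^+ i * y i) -> x =1 y.
Proof.
move=> Urs srs E i; apply/eqP; rewrite -subr_eq0.
pose g l := if insub l is Some l' then x l' - y l' else 0.
suff E0 : \poly_(l < n) g l = 0.
  by have := coef_poly n g i; rewrite E0 coef0 ltn_ord /g valK => <-.
apply/eqP; apply: contraT => ne.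
have := @max_poly_roots _ _ rs ne; rewrite srs Urs ltnNge size_poly => /(_ _ isT) H.
apply: H; apply/allP => z zr; rewrite rootE horner_poly; apply/eqP.
transitivity (\sum_(l < n) (z ^+ l * x l - z ^+ l * y l)); last by rewrite sumrB E // subrr.
by apply: eq_bigr => l _; rewrite /g valK -mulrBr mulrC.
Qed.

(** * Points of the witness set when [phi], composed with a Moebius map, is defined over [k] *)

Section WitnessCurve.
Variables (F : closedFieldType) (k : F -> Prop) (alpha : F) (n : nat).
Hypothesis char0 : forall m, m.+1%:R != 0 :> F.
Hypothesis Hk : is_subfield k.
Hypothesis Da : algebraic_of_degree k alpha n.
Variables (N : nat) (phi : 'I_N -> {fraction {poly F}}).
Hypothesis phi_over : forall j, ratfun_over (adjoin k alpha) (phi j).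
Variables (P Q : {mpoly F[N]}).
Hypothesis Q0 : mpoly_at_param Q phi != 0.
Hypothesis PQ : mpoly_at_param P phi / mpoly_at_param Q phi = 'X%:F.
Variables a b c d : F.
Hypotheses (La : adjoin k alpha a) (Lb : adjoin k alpha b).
Hypotheses (Lc : adjoin k alpha c) (Ld : adjoin k alpha d).
Hypothesis det : a * d - b * c != 0.
Local Notation m := ((a *: 'X + b%:P)%:F / (c *: 'X + d%:P)%:F).
Variable r : 'I_N -> {fraction {poly F}}.
Hypothesis r_over : forall j, ratfun_over k (r j).
Hypothesis r_val : forall j, ratfun_value (@cst F) (phi j) m (r j).

Let S := Subfield Hk.
Let T := Subfield (ratfun_over_subfield Hk).
Let ST : forall x, S x -> T (cst x) := ratfun_over_cst Hk.
Let LD : lindisj (@cst F) S T := ratfun_over_lindisj Hk.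
Let HE := over_alpha_subfield ST Da LD.

Lemma moebius_eq : m * (cst c * 'X%:F + cst d) = cst a * 'X%:F + cst b.
Proof.
by rewrite !tofrac_linear; apply: divfK; rewrite tofrac_eq0; apply: linear_poly_neq0 det.
Qed.

Lemma X_nonconst (l : F) : 'X%:F <> cst l :> {fraction {poly F}}.
Proof.
move/eqP; rewrite tofrac_eq => /eqP E.
by have := congr1 (fun p : {poly F} => p`_1) E; rewrite coefX coefC => /eqP; rewrite oner_eq0.
Qed.

Lemma transcendental_moebius a' b' c' d' (m' : {fraction {poly F}}) : a' * d' - b' * c' != 0 ->
  m' * (cst c' * 'X%:F + cst d') = cst a' * 'X%:F + cst b' -> transcendental (@cst F) m'.
Proof.
move=> det' E; apply: transcendental_nonconst.
exact: (moebius_nonconst X_nonconst det' E).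
Qed.

Lemma moebius_over_alpha : over_alpha T alpha m.
Proof.
have lin x y : adjoin k alpha x -> adjoin k alpha y -> over_alpha T alpha (x *: 'X + y%:P)%:F.
  move=> Lx Ly; rewrite -tofrac_linear; apply: (sfD HE); last exact: (over_alpha_cst ST Da).
  apply: (sfM HE); first exact: (over_alpha_cst ST Da).
  by apply: over_alpha_T; apply: (ratfun_over_X Hk).
by apply: (sf_div HE); apply: lin.
Qed.

Lemma moebius_expansion : exists2 mh : {poly sfT T}, (size mh <= n)%N & m = evT T alpha mh.
Proof. exact: (over_alpha_small ST Da LD moebius_over_alpha). Qed.

(** The part of [witness_data] that is stable when the base field grows; it is passed from [K] to
    [K(eta)], the field that plays the role of [k] here. *)
Definition witness_identities (f : 'I_n -> 'I_N -> {mpoly F[n]}) (delta : {mpoly F[n]}) :=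
  [/\ forall i j, mpoly_over k (f i j), mpoly_over k delta, delta != 0 &
    forall j, ratfun_value (@mpoly_frac_const F n) (phi j)
          (\sum_(i < n) alpha ^+ i *: 'X_i)%:F
          (\sum_(i < n) mpoly_frac_const n (alpha ^+ i) * ((f i j)%:F / delta%:F))].

Section Expansion.
Variable mh : {poly sfT T}.
Hypothesis smh : (size mh <= n)%N.
Hypothesis Dm : m = evT T alpha mh.
Let psi (i : 'I_n) := sfv mh`_i.

Lemma witness_vanishing f delta (i : 'I_n) (j : 'I_N) : witness_identities f delta -> (0 < i)%N ->
  mpoly_at_param (f i j) psi = 0.
Proof.
case=> kf kdelta d0 /(_ j) W i0.
have HT := ratfun_over_subfield Hk; have HL := adjoin_subfield k alpha.
have [p [q [u [v [Lp Lq Lu Lv [_ [q0 Dphi]]]]]]] := ratfun_over_coprime HL (phi_over j).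
have tm := transcendental_moebius det moebius_eq.
have Er := r_val j; rewrite Dphi in Er W; have {}Er := rv_eval q0 Er.
have {}W := witness_identity q0 d0 W.
pose h : {rmorphism {mpoly F[n]} -> {fraction {poly F}}} := mmap (@cst F) psi.
have hC x : h x%:MP = cst x by apply: mmapC.
have hX : h (\sum_(i < n) alpha ^+ i *: 'X_i) = m.
  rewrite Dm (evT_expand _ smh) rmorph_sum; apply: eq_bigr => l _.
  by rewrite -mul_mpolyC rmorphM hC; congr (_ * _); rewrite /h /= mmapX mmap1U.
have hf : h (\sum_(i < n) alpha ^+ i *: f i j) = \sum_(i < n) cst (alpha ^+ i) * h (f i j).
  by rewrite rmorph_sum; apply: eq_bigr => l _; rewrite -mul_mpolyC rmorphM hC.
have := congr1 h W; rewrite rmorphM [in RHS]rmorphM !(horner_map_mpolyC _ _ hC) hf hX -Er.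
set qm := (map_poly _ q).[_] => E.
have qm0 : qm != 0 by apply: tm.
have {}E : h delta * r j = \sum_(i < n) cst (alpha ^+ i) * h (f i j).
  by apply: (mulIf qm0); rewrite -mulrA E mulrC.
(* The term along [alpha^0] is corrected by [delta(psi) r_j], an element of [k(t)]. The corrected
   terms give a zero combination of the powers of [alpha], so each is zero. *)
pose y l := (if insub l is Some i then h (f i j) else 0) - (l == 0)%:R * (h delta * r j).
have Th (g : {mpoly F[n]}) : mpoly_over k g -> ratfun_over k (h g).
  move=> kg; apply: (subfield_mpoly_at_param HT) => [l|l]; first exact: ratfun_over_cst.
  exact: (@sfvP _ T).
have Ty l : ratfun_over k (y l).
  apply: (sfB HT); first by case: insubP => [l' _ _|_]; [apply: Th | apply: (sf0 HT)].
  by apply: (sfM HT); [apply: (sf_nat HT) | apply: (sfM HT); [apply: Th | ]].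
have n0 : (0 < n)%N by apply: leq_ltn_trans (ltn_ord i).
have := lindisj_powers Hk HT ST LD Da Ty _ (ltn_ord i); rewrite /y valK.
rewrite (gtn_eqF i0) mul0r subr0; apply.
transitivity (\sum_(l < n) (cst (alpha ^+ l) * h (f l j) - cst (alpha ^+ l) * (l == Ordinal n0 :> nat)%:R * (h delta * r j))).
  by apply: eq_bigr => l _; rewrite valK mulrBr; congr (_ - _); apply: mulrA.
rewrite sumrB -mulr_suml (sum_delta (fun l => cst (alpha ^+ l)) (Ordinal n0)) /= expr0 rmorph1 mul1r.
by rewrite E subrr.
Qed.

Section Conjugate.
Variable z : F.
Hypothesis conjT : forall e1 e2, evT T alpha e1 = evT T alpha e2 -> evT T z e1 = evT T z e2.
Hypothesis conjF : forall e1 e2, evF S alpha e1 = evF S alpha e2 -> evF S z e1 = evF S z e2.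
Let mz := evT T z mh.

Lemma moebius_conj : exists az bz cz dz : F, az * dz - bz * cz != 0 /\
  mz * (cst cz * 'X%:F + cst dz) = cst az * 'X%:F + cst bz.
Proof.
have [ah Ea] := @adjoin_evF _ S _ _ Da _ La; have [bh Eb] := @adjoin_evF _ S _ _ Da _ Lb.
have [ch Ec] := @adjoin_evF _ S _ _ Da _ Lc; have [dh Ed] := @adjoin_evF _ S _ _ Da _ Ld.
have HL := adjoin_subfield k alpha.
(* The inverse of the determinant is lifted as well: conjugating the equation saying that their
   product is 1 keeps the conjugated determinant nonzero. *)
have [ih Ei] : exists q, (a * d - b * c)^-1 = evF S alpha q.
  apply: (@adjoin_evF _ S _ _ Da); apply: (sfV HL); apply: (sfB HL); exact: (sfM HL).
have [xh Ex] : exists xh : sfT T, sfv xh = 'X%:F by apply: sfv_lift; apply: (ratfun_over_X Hk).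
exists (evF S z ah), (evF S z bh), (evF S z ch), (evF S z dh); split.
  have Edet y : evF S y (ih * (ah * dh - bh * ch)) =
      evF S y ih * (evF S y ah * evF S y dh - evF S y bh * evF S y ch).
    by rewrite rmorphM rmorphB !rmorphM.
  have := conjF (e1 := ih * (ah * dh - bh * ch)) (e2 := 1); rewrite !Edet -Ea -Eb -Ec -Ed -Ei mulVf //.
  rewrite !rmorph1 => /(_ erefl) E.
  by apply: contra_eq_neq E => ->; rewrite mulr0 eq_sym oner_neq0.
pose g := map_poly (sfmap ST).
have lin y p q : evT T y (g p * xh%:P + g q) = cst (evF S y p) * 'X%:F + cst (evF S y q).
  by rewrite rmorphD rmorphM !evT_sfmap evT_C Ex.
rewrite -!lin -rmorphM; apply: conjT.
by rewrite rmorphM !lin -Ea -Eb -Ec -Ed -Dm moebius_eq.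
Qed.

Lemma phi_conj j : exists ph qh : {poly {poly sfT S}},
  [/\ map_poly (evF S alpha) qh != 0,
      phi j = (map_poly (evF S alpha) ph)%:F / (map_poly (evF S alpha) qh)%:F,
      exists u v, u * map_poly (evF S z) ph + v * map_poly (evF S z) qh = 1 &
      (map_poly (@cst F) (map_poly (evF S z) ph)).[mz] =
        r j * (map_poly (@cst F) (map_poly (evF S z) qh)).[mz]].
Proof.
have HL := adjoin_subfield k alpha.
have [p [q [u [v [Lp Lq Lu Lv [uv [q0 Dphi]]]]]]] := ratfun_over_coprime HL (phi_over j).
have [ph Ep] := @poly_lift_adjoin _ S _ _ Da _ Lp; have [qh Eq] := @poly_lift_adjoin _ S _ _ Da _ Lq.
have [uh Eu] := @poly_lift_adjoin _ S _ _ Da _ Lu; have [vh Ev] := @poly_lift_adjoin _ S _ _ Da _ Lv.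
have Erv : r j * (map_poly (@cst F) q).[m] = (map_poly (@cst F) p).[m].
  by have := r_val j; rewrite Dphi; apply: rv_eval.
exists ph, qh; rewrite -Ep -Eq; split=> //.
  exists (map_poly (evF S z) uh), (map_poly (evF S z) vh).
  rewrite -!rmorphM -rmorphD -(rmorph1 (map_poly (evF S z))).
  have E : map_poly (evF S alpha) (uh * ph + vh * qh) = map_poly (evF S alpha) 1.
    transitivity (u * p + v * q); last by rewrite uv rmorph1.
    by rewrite Ep Eq Eu Ev; apply: map_poly_bezout.
  apply/polyP => i; have := congr1 (fun w : {poly F} => w`_i) E; rewrite !coef_map.
  exact: conjF.
have [rh Er] := @sfv_lift _ T _ (r_over j).
rewrite -!(evT_liftST ST) -Er -(evT_C z) -rmorphM; apply: conjT.
by rewrite rmorphM evT_C !(evT_liftST ST) Er -Ep -Eq -Dm Erv.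
Qed.

Local Notation G := (d *: P - b *: Q).
Local Notation H := (a *: Q - c *: P).

Lemma mpoly_at_param_comb (x y : F) (A B : {mpoly F[N]}) rho :
  mpoly_at_param (x *: A - y *: B) rho = cst x * mpoly_at_param A rho - cst y * mpoly_at_param B rho.
Proof. by rewrite !mpoly_at_paramE rmorphB /= !(mmapZ _ (@cst F)). Qed.

(** From [phi(m) = r] it follows that [P / Q] takes the value [m] at [r]. Applying the inverse
    Moebius map shows that [G / H] takes the value [X] there: it inverts the parametrization [r]. *)
Lemma reparam_inverse : mpoly_at_param H r != 0 /\ mpoly_at_param G r = 'X%:F * mpoly_at_param H r.
Proof.
have tm := transcendental_moebius det moebius_eq.
have nm := moebius_nonconst X_nonconst det moebius_eq.
have val (A : {mpoly F[N]}) : ratfun_value (@cst F) (mpoly_at_param A phi) m (mpoly_at_param A r).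
  exact: rv_mpoly.
have Qr : mpoly_at_param Q r != 0.
  by apply/eqP => E; have := val Q; rewrite E => /(rv_eq0 tm) /eqP; apply/negP.
have EP : mpoly_at_param P r = m * mpoly_at_param Q r.
  have := rv_mul (rv_X (@cst F) m) (val Q); rewrite -PQ (divfK Q0); exact: rv_fun (val P).
have am : cst a - cst c * m != 0.
  apply/eqP => /eqP; rewrite subr_eq0 => /eqP E; have [c0|c0] := eqVneq c 0.
    move: E; rewrite c0 rmorph0 mul0r => /eqP; rewrite fmorph_eq0 => /eqP a0.
    by move: det; rewrite a0 c0 mul0r mulr0 subrr eqxx.
  have c0' : cst c != 0 by rewrite fmorph_eq0.
  by apply: (nm (a / c)); apply: (mulfI c0'); rewrite -E -rmorphM [c * _]mulrC divfK.
have EH : mpoly_at_param H r = (cst a - cst c * m) * mpoly_at_param Q r.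
  by rewrite mpoly_at_param_comb EP mulrBl mulrA.
have EG : mpoly_at_param G r = (cst d * m - cst b) * mpoly_at_param Q r.
  by rewrite mpoly_at_param_comb EP mulrBl mulrA.
split; first by rewrite EH; exact: (mulf_neq0 am Qr).
rewrite EH EG [RHS]mulrA; congr (_ * _); exact: (inverse_moebius moebius_eq).
Qed.

(** The conjugate [Phi] of [phi] satisfies [Phi(mz) = r] as well, so [G / H] at [Phi] is the Moebius
    inverse of [mz]. For [x] in the witness set [xi = Phi(t)], and the last equation is that
    identity evaluated at [t]; [h] is a numerator of [H(Phi)]. *)
Lemma conj_point : exists az bz cz dz : F, [/\ az * dz - bz * cz != 0,
  mz * (cst cz * 'X%:F + cst dz) = cst az * 'X%:F + cst bz &
  exists2 h : {poly F}, h != 0 & forall f delta (x : 'I_n -> F) (xi : 'rV[F]_N), witness_identities f delta ->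
    (forall (i : 'I_n) j, (0 < i)%N -> (f i j).@[x] = 0) ->
    (forall j, \sum_(i < n) (f i j).@[x] = delta.@[x] * xi 0 j) -> delta.@[x] != 0 ->
    let t := \sum_(i < n) z ^+ i * x i in
    (H.@[xi 0] = 0 -> h.[t] = 0) /\
    (dz * t - bz) * H.@[xi 0] = (az - cz * t) * G.@[xi 0]].
Proof.
have [az [bz [cz [dz [detz Ez]]]]] := moebius_conj; exists az, bz, cz, dz; split=> //.
have [HR GR] := reparam_inverse.
have tz := transcendental_moebius detz Ez.
pose dat j (pq : {poly {poly sfT S}} * {poly {poly sfT S}}) :=
  [/\ map_poly (evF S alpha) pq.2 != 0,
      phi j = (map_poly (evF S alpha) pq.1)%:F / (map_poly (evF S alpha) pq.2)%:F,
      exists u v, u * map_poly (evF S z) pq.1 + v * map_poly (evF S z) pq.2 = 1 &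
      (map_poly (@cst F) (map_poly (evF S z) pq.1)).[mz] =
        r j * (map_poly (@cst F) (map_poly (evF S z) pq.2)).[mz]].
have Hd j : {pq | dat j pq}.
  apply: constructive_indefinite_description.
  by have [ph [qh E]] := phi_conj j; exists (ph, qh).
pose p j := map_poly (evF S z) (sval (Hd j)).1.
pose q j := map_poly (evF S z) (sval (Hd j)).2.
have qn0 j : q j != 0.
  have [_ _ [u [v E]] Ev] := svalP (Hd j); apply/eqP => q0.
  have p0 : p j != 0.
    by apply: contra_eq_neq E => p0; rewrite -/(p j) -/(q j) p0 q0 !mulr0 addr0 eq_sym oner_neq0.
  by have := tz _ p0; rewrite Ev -/(q j) q0 rmorph0 horner0 mulr0 eqxx.
pose Phi j := (p j)%:F / (q j)%:F.
have PhiR j : ratfun_value (@cst F) (Phi j) mz (r j).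
  exists (p j), (q j); split; [exact: erefl | exact: (tz _ (qn0 j)) |].
  have [_ _ _ E] := svalP (Hd j); rewrite E; symmetry; exact: (mulfK (tz _ (qn0 j))).
have val (A : {mpoly F[N]}) : ratfun_value (@cst F) (mpoly_at_param A Phi) mz (mpoly_at_param A r).
  exact: rv_mpoly.
have HPhi : mpoly_at_param H Phi != 0.
  apply/eqP => E; have := val H; rewrite E => E'.
  move/eqP: HR; apply; apply: (rv_fun E').
  by have := rv_cst (@cst F) 0 mz; rewrite rmorph0.
have Y0 : (cst dz * 'X%:F - cst bz) * mpoly_at_param H Phi -
   (cst az - cst cz * 'X%:F) * mpoly_at_param G Phi = 0.
  apply: (rv_eq0 tz).
  have := rv_add (rv_mul (rv_add (rv_mul (rv_cst (@cst F) dz mz) (rv_X _ mz)) (rv_opp (rv_cst _ bz mz))) (val H))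
    (rv_opp (rv_mul (rv_add (rv_cst _ az mz) (rv_opp (rv_mul (rv_cst _ cz mz) (rv_X _ mz)))) (val G))).
  by rewrite GR (inverse_moebius Ez) mulr_cross_cancel.
have [h h0 Hh] := rv_zeros HPhi.
exists h => // f delta x xi [kf kdelta d0 W] fx Dxi dx t.
(* At [x] only the component [i = 0] of the conjugated identity survives; divided by [delta(x)] it
   reads [p(t) = q(t) xi_j]. The Bezout relation rules out [q(t) = 0]. *)
have PX : param_point Phi t xi.
  move=> j; have [q0 Dphi [u [v uv]] _] := svalP (Hd j).
  have Wj := W j; rewrite Dphi in Wj; have {}Wj := witness_identity q0 d0 Wj.
  have := @witness_conj_eval F S alpha z n conjF _ _ _ _ x (fun i => kf i j) kdelta Wj.
  rewrite -/(p j) -/(q j) -/t.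
  have -> : \sum_(i < n) z ^+ i * (f i j).@[x] = delta.@[x] * xi 0 j.
    rewrite -Dxi; apply: eq_bigr => -[[|i] lt_i] _ /=; first by rewrite expr0 mul1r.
    by rewrite fx // mulr0.
  rewrite mulrCA => /(mulfI dx) E.
  have qt : (q j).[t] != 0.
    apply/eqP => qt; have := congr1 (horner^~ t) uv.
    by rewrite hornerD !hornerM -/(p j) -/(q j) E qt mul0r !mulr0 addr0 hornerC => /eqP; rewrite eq_sym oner_eq0.
  exists (p j), (q j); rewrite !map_poly_id //; split=> //.
  by rewrite E [X in X / _]mulrC mulfK.
have valt (A : {mpoly F[N]}) := @rv_mpoly_id F N A Phi xi t PX.
split=> [E|]; first by apply: Hh; rewrite -E; apply: valt.
pose id' : {rmorphism F -> F} := idfun.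
have := rv_add (rv_mul (rv_add (rv_mul (rv_cst id' dz t) (rv_X id' t)) (rv_opp (rv_cst id' bz t))) (valt H))
    (rv_opp (rv_mul (rv_add (rv_cst id' az t) (rv_opp (rv_mul (rv_cst id' cz t) (rv_X id' t)))) (valt G))).
rewrite Y0 => E; apply/eqP; rewrite -subr_eq0; apply/eqP; apply: (rv_fun E).
by have := rv_cst id' 0 t; rewrite rmorph0.
Qed.
End Conjugate.
End Expansion.

(* The exceptional polynomials [E z] account for the points where the inverse of the
   parametrization is undefined and for the poles of [psi]. *)
Lemma witness_curve : exists psi : 'I_n -> {fraction {poly F}},
  [/\ forall i, ratfun_over k (psi i),
      m = \sum_(i < n) (alpha ^+ i)%:P%:F * psi i,
      forall f delta (i : 'I_n) j, witness_identities f delta -> (0 < i)%N ->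
        mpoly_at_param (f i j) psi = 0 &
      exists (rs : seq F) (E : F -> {poly F}), [/\ uniq rs, size rs = n,
        forall z, z \in rs -> E z != 0 &
        forall f delta (x : 'rV[F]_n), witness_identities f delta ->
          (forall (i : 'I_n) j, (0 < i)%N -> (f i j).@[x 0] = 0) -> delta.@[x 0] != 0 ->
          (exists s, param_point psi s x) \/
          forall z, z \in rs -> (E z).[\sum_(i < n) z ^+ i * x 0 i] = 0]].
Proof.
have [mh smh Dm] := moebius_expansion.
pose psi (i : 'I_n) := sfv mh`_i; exists psi; split.
- by move=> i; apply: (@sfvP _ T).
- by rewrite Dm (evT_expand _ smh).
- by move=> f delta i j; apply: witness_vanishing.
have [rs [Urs conjT conjF]] := conjugates char0 ST Da LD.
have [B B0 HB] := param_point_cofinite psi.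
have [ss DB] := closed_field_poly_normal B.
pose mz z := evT T z mh.
pose dat z (w : F * F * (F * F) * {poly F}) := z \in rs ->
  let: (az, bz, (cz, dz), h) := w in [/\ az * dz - bz * cz != 0,
  mz z * (cst cz * 'X%:F + cst dz) = cst az * 'X%:F + cst bz, h != 0 &
  forall f delta (x : 'I_n -> F) (xi : 'rV[F]_N), witness_identities f delta ->
    (forall (i : 'I_n) j, (0 < i)%N -> (f i j).@[x] = 0) ->
    (forall j, \sum_(i < n) (f i j).@[x] = delta.@[x] * xi 0 j) -> delta.@[x] != 0 ->
    let t := \sum_(i < n) z ^+ i * x i in
    ((a *: Q - c *: P).@[xi 0] = 0 -> h.[t] = 0) /\
    (dz * t - bz) * (a *: Q - c *: P).@[xi 0] = (az - cz * t) * (d *: P - b *: Q).@[xi 0]].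
have Hd z : {w | dat z w}.
  apply: constructive_indefinite_description; have [zr|/negbTE zr] := boolP (z \in rs); last first.
    by exists (0, 0, (0, 0), 0); rewrite /dat zr.
  have [az [bz [cz [dz [H1 H2 [h h0 H3]]]]]] := conj_point Dm (conjT z zr) (conjF z zr).
  by exists (az, bz, (cz, dz), h).
pose az z := (sval (Hd z)).1.1.1; pose bz z := (sval (Hd z)).1.1.2.
pose cz z := (sval (Hd z)).1.2.1; pose dz z := (sval (Hd z)).1.2.2.
pose h z := (sval (Hd z)).2.
have Hz z : dat z (az z, bz z, (cz z, dz z), h z).
  by have := svalP (Hd z); rewrite /az /bz /cz /dz /h; case: (sval _) => [[[? ?] [? ?]] ?].
(* A zero of [lin z s] is a value taken at [s] by the conjugated Moebius map. The product over [ss]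
   accounts for the parameters [s] where [psi] may be undefined. *)
pose lin z s : {poly F} := (cz z * s + dz z) *: 'X - (az z * s + bz z)%:P.
exists rs, (fun z => h z * \prod_(s <- ss) lin z s); split=> //; first by rewrite size_tuple.
  move=> z zr; have [det' _ h0 _] := Hz z zr; apply: mulf_neq0 => //.
  rewrite prodf_seq_neq0; apply/allP => s _ /=; apply/eqP => E.
  have E0 : (lin z s).[0] = 0 by rewrite E horner0.
  have E1 : (lin z s).[1] = 0 by rewrite E horner0.
  rewrite /lin hornerD hornerN hornerZ hornerX hornerC mulr0 in E0.
  rewrite /lin hornerD hornerN hornerZ hornerX hornerC mulr1 in E1.
  move/eqP: E0; rewrite sub0r oppr_eq0 => /eqP Eb; move/eqP: E1; rewrite Eb subr0 => /eqP Ed.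
  have {}Eb : bz z = - (az z * s) by apply/eqP; rewrite -addr_eq0 addrC Eb.
  have {}Ed : dz z = - (cz z * s) by apply/eqP; rewrite -addr_eq0 addrC Ed.
  by move: det'; rewrite Ed Eb => /eqP; apply; ring.
move=> f delta x W fx dx.
(* The sum over [i] is just the component [i = 0], since the others vanish at [x]; written as a sum
   it needs no index 0 in ['I_n]. *)
pose xi : 'rV[F]_N := \row_j ((\sum_(i < n) (f i j).@[x 0]) / delta.@[x 0]).
have Dxi j : \sum_(i < n) (f i j).@[x 0] = delta.@[x 0] * xi 0 j by rewrite mxE mulrC divfK.
pose H := (a *: Q - c *: P).@[xi 0]; pose G := (d *: P - b *: Q).@[xi 0].
pose t z := \sum_(i < n) z ^+ i * x 0 i.
have K z : z \in rs -> (H = 0 -> (h z).[t z] = 0) /\ (dz z * t z - bz z) * H = (az z - cz z * t z) * G.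
  by move=> zr; have [_ _ _ K] := Hz z zr; apply: (K f delta (x 0) xi W fx Dxi dx).
have [H0|H0] := eqVneq H 0.
  by right=> z zr; have [K1 _] := K z zr; rewrite hornerM K1 // mul0r.
pose s := G / H.
have ts z : z \in rs -> t z * (cz z * s + dz z) = az z * s + bz z.
  move=> zr; have [_ K2] := K z zr; apply: (mulIf H0).
  have Es : s * H = G by rewrite /s divfK.
  apply/eqP; rewrite -subr_eq0; apply/eqP.
  transitivity ((dz z * t z - bz z) * H - (az z - cz z * t z) * (s * H)); first by ring.
  by rewrite Es K2 subrr.
have [Bs|Bs] := eqVneq B.[s] 0.
  right=> z zr; rewrite hornerM horner_prod; apply/eqP; rewrite mulf_eq0; apply/orP; right.
  have sss : s \in ss.
    by move: Bs; rewrite DB => /eqP; rewrite -[_ == 0]rootE rootZ ?lead_coef_eq0 // root_prod_XsubC.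
  rewrite prodf_seq_eq0; apply/hasP; exists s => //=.
  by rewrite /lin hornerD hornerN hornerZ hornerX hornerC -/(t z) mulrC ts // subrr.
left; exists s; have [y Hy] := HB s Bs.
suff -> : x = y by [].
apply/rowP; apply: (@power_sums_inj F n rs) => //; first by rewrite size_tuple.
move=> z zr; rewrite -/(t z).
have [det' Ez _ _] := Hz z zr.
pose id' : {rmorphism F -> F} := idfun.
have rvm : ratfun_value id' (mz z) s (\sum_(i < n) z ^+ i * y 0 i).
  rewrite /mz (evT_expand _ smh); apply: rv_sum => i _; apply: rv_mul; last exact: Hy.
  exact: (rv_cst id').
have := rv_mul rvm (rv_add (rv_mul (rv_cst id' (cz z) s) (rv_X id' s)) (rv_cst id' (dz z) s)).
rewrite Ez => Hv; have := rv_fun Hv (rv_add (rv_mul (rv_cst id' (az z) s) (rv_X id' s)) (rv_cst id' (bz z) s)).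
rewrite /= -(ts z zr).
have [E|ne] := eqVneq (cz z * s + dz z) 0; last by move/(mulIf ne).
move: (ts z zr) => + _; rewrite E mulr0 => /esym/eqP; rewrite addrC addr_eq0 => /eqP Eb.
move/eqP: E; rewrite addrC addr_eq0 => /eqP Ed.
by move: det'; rewrite Ed Eb => /eqP []; ring.
Qed.
End WitnessCurve.

(** * Zariski closures and the theorem *)

Section ZariskiTopology.
Variables (F : closedFieldType) (n : nat).
Hypothesis char0 : forall m, m.+1%:R != 0 :> F.

Lemma irreducible_mul (U : affset F n) (p q : {mpoly F[n]}) : irreducible_closed U ->
  vanishes_on U (p * q) -> vanishes_on U p \/ vanishes_on U q.
Proof.
case=> _ _ irr Upq.
pose V (g : {mpoly F[n]}) : affset F n := fun x => g.@[x 0] = 0.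
have cV g : zariski_closed (V g).
  by exists (fun h => h = g) => x; split=> [Vx h ->|]; last apply.
have [|H|H] := irr _ _ (cV p) (cV q); [|by left=> x /H|by right=> x /H].
move=> x /Upq; rewrite mevalM => /eqP; rewrite mulf_eq0 => /orP [] /eqP; by [left|right].
Qed.

Lemma irreducible_prod (U : affset F n) (l : seq {mpoly F[n]}) : irreducible_closed U ->
  vanishes_on U (\prod_(p <- l) p) -> exists2 p, p \in l & vanishes_on U p.
Proof.
move=> irrU; elim: l => [|p l IH].
  case: (irrU) => _ [x Ux] _ /(_ x Ux); rewrite big_nil meval1 => /eqP.
  by rewrite oner_eq0.
rewrite big_cons => /(irreducible_mul irrU) [Up|/IH [q ql Uq]].
  by exists p; rewrite ?mem_head.
by exists q; rewrite // inE ql orbT.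
Qed.

Lemma zariski_closure_closed (A : affset F n) : zariski_closed (zariski_closure A).
Proof. by exists (vanishes_on A). Qed.

Lemma zariski_closure_min (A B : affset F n) : zariski_closed B -> sub_affset A B ->
  sub_affset (zariski_closure A) B.
Proof.
case=> G HB AB x Hx; apply/HB => p Gp; apply: Hx => y /AB /HB; exact.
Qed.

Lemma closed_separation (A : affset F n) (G : {mpoly F[n]} -> Prop) x :
  (forall x, A x <-> (forall p, G p -> p.@[x 0] = 0)) -> ~ A x ->
  exists2 g, G g & g.@[x 0] <> 0.
Proof.
move=> HA nA; apply: NNPP => E; apply: nA; apply/HA => g Gg.
by apply: NNPP => gx; apply: E; exists g.
Qed.

Lemma zariski_closedU (A B : affset F n) : zariski_closed A -> zariski_closed B ->
  zariski_closed (fun x => A x \/ B x).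
Proof.
case=> G HA [G' HB]; exists (fun p => exists g g', [/\ G g, G' g' & p = g * g']) => x; split.
  by case=> [/HA Ax|/HB Bx] _ [g [g' [Gg Gg' ->]]]; rewrite mevalM ?(Ax g) ?(Bx g') ?mul0r ?mulr0.
move=> H; apply: NNPP => /not_or_and [nA nB].
have [g Gg gx] := closed_separation HA nA; have [g' Gg' gx'] := closed_separation HB nB.
have := H _ (ex_intro _ g (ex_intro _ g' (And3 Gg Gg' erefl))).
by rewrite mevalM => /eqP; rewrite mulf_eq0 => /orP [] /eqP.
Qed.

Lemma krull_dim_ge1_distinct (U : affset F n) : krull_dim_ge U 1 ->
  exists x y, [/\ U x, U y & x <> y].
Proof.
case=> c [Hc Hs]; have [_ H] := Hs 0 isT.
have [y Hy] := not_all_ex_not _ _ H; have [cy ny] := imply_to_and _ _ Hy.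
have [[_ [x cx] _] H0] := Hc 0 isT; have [_ H1] := Hc 1 isT.
by exists x, y; split; [exact: H0 | exact: H1 | move=> E; apply: ny; rewrite -E].
Qed.

(** A product of polynomials vanishing on the curve becomes a zero product in the field [F(t)], so
    one of the factors already vanishes on the curve. *)
Lemma param_closure_irreducible (psi : 'I_n -> {fraction {poly F}}) :
  irreducible_closed (param_closure psi).
Proof.
have van p := param_closure_vanishing char0 p (fun x => iff_refl (param_closure psi x)).
split; first exact: zariski_closure_closed.
  have [q q0 Hq] := param_point_cofinite psi.
  have [m /Hq [x Hx]] := poly_nat_nonroot (nat_inj_of_char0 char0) q0.
  by exists x => p; apply; exists m%:R.
move=> B C [G HB] [G' HC] H; apply: NNPP => /not_or_and [nB nC].
have [x Hx] := not_all_ex_not _ _ nB; have [Ax Bx] := imply_to_and _ _ Hx.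
have [y Hy] := not_all_ex_not _ _ nC; have [Ay Cy] := imply_to_and _ _ Hy.
have [g Gg gx] := closed_separation HB Bx; have [g' Gg' gy] := closed_separation HC Cy.
have : vanishes_on (param_closure psi) (g * g').
  by move=> t /H [/HB Bt|/HC Ct]; rewrite mevalM ?(Bt g) ?(Ct g') ?mul0r ?mulr0.
move/van; rewrite mpoly_at_paramE rmorphM => /eqP; rewrite mulf_eq0 => /orP [] /eqP.
  by move=> /van /(_ x Ax).
by move=> /van /(_ y Ay).
Qed.

(* Irreducibility makes each of the [n] linear forms constant on [U], and these forms are
   independent by Vandermonde. *)
Lemma irreducible_singleton (U : affset F n) (rs : seq F) (E : F -> {poly F}) :
  uniq rs -> size rs = n -> (forall z, z \in rs -> E z != 0) -> irreducible_closed U ->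
  (forall x, U x -> forall z, z \in rs -> (E z).[\sum_(i < n) z ^+ i * x 0 i] = 0) ->
  forall x y, U x -> U y -> x = y.
Proof.
move=> Urs srs E0 irrU UE x y Ux Uy; apply/rowP; apply: (power_sums_inj Urs srs) => z zr.
pose X := \sum_(i < n) z ^+ i *: 'X_i : {mpoly F[n]}.
have HX (t : 'rV[F]_n) : X.@[t 0] = \sum_(i < n) z ^+ i * t 0 i.
  by rewrite rmorph_sum; apply: eq_bigr => i _ /=; rewrite mevalZ mevalXU.
have [ss DE] := closed_field_poly_normal (E z).
have [|p] := @irreducible_prod U [seq X - s%:MP | s <- ss] irrU.
  move=> t Ut; have /eqP := UE t Ut z zr; rewrite DE hornerZ mulf_eq0 lead_coef_eq0 (negbTE (E0 z zr)) /=.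
  rewrite big_map rmorph_prod horner_prod => /eqP <-; apply: eq_bigr => s _.
  by rewrite hornerXsubC rmorphB /= mevalC HX.
case/mapP => s _ -> Up; have := Up x Ux; have := Up y Uy.
by rewrite !rmorphB /= !mevalC !HX => /eqP + /eqP; rewrite !subr_eq0 => /eqP -> /eqP.
Qed.
End ZariskiTopology.

(** * Identification of the one-dimensional component *)

Section WitnessComponent.
Variables (F : closedFieldType) (K : F -> Prop) (alpha : F) (n N : nat).
Hypothesis char0 : forall m, m.+1%:R != 0 :> F.
Variables (phi : 'I_N -> {fraction {poly F}}) (psi : 'I_n -> {fraction {poly F}}).
Variables (rs : seq F) (E : F -> {poly F}).
Hypotheses (Urs : uniq rs) (srs : size rs = n) (E0 : forall z, z \in rs -> E z != 0).
Hypothesis psi_vanishing : forall f delta (i : 'I_n) j, witness_data K alpha phi f delta ->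
  (0 < i)%N -> mpoly_at_param (f i j) psi = 0.
Hypothesis psi_exhausts : forall f delta (x : 'rV[F]_n), witness_data K alpha phi f delta ->
  (forall (i : 'I_n) j, (0 < i)%N -> (f i j).@[x 0] = 0) -> delta.@[x 0] != 0 ->
  (exists s, param_point psi s x) \/
  forall z, z \in rs -> (E z).[\sum_(i < n) z ^+ i * x 0 i] = 0.

Let T0 : affset F n := fun x => forall z, z \in rs -> (E z).[\sum_(i < n) z ^+ i * x 0 i] = 0.

Lemma exceptional_closed : zariski_closed T0.
Proof.
pose X z := \sum_(i < n) z ^+ i *: 'X_i : {mpoly F[n]}.
have HX z (t : 'rV[F]_n) : (X z).@[t 0] = \sum_(i < n) z ^+ i * t 0 i.
  by rewrite rmorph_sum; apply: eq_bigr => i _ /=; rewrite mevalZ mevalXU.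
have HE z (t : 'rV[F]_n) : ((map_poly (@mpolyC n F) (E z)).[X z]).@[t 0] =
    (E z).[\sum_(i < n) z ^+ i * t 0 i].
  rewrite (@horner_map_mpolyC _ _ _ idfun (meval (t 0))); last by move=> c; apply: mevalC.
  by rewrite map_poly_id //; congr (_.[_]); apply: HX.
exists (fun p => exists2 z, z \in rs & p = (map_poly (@mpolyC n F) (E z)).[X z]) => x.
split=> [Tx p [z zr ->]|H z zr]; first by rewrite HE; apply: Tx.
by rewrite -HE; apply: H; exists z.
Qed.

Lemma witness_component (U : affset F n) : irreducible_component (witness_variety K alpha phi) U ->
  krull_dim_ge U 1 -> eq_affset U (param_closure psi).
Proof.
case=> irrU UZ maxU /krull_dim_ge1_distinct [x0 [y0 [Ux0 Uy0 ne]]].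
have nT0 : ~ sub_affset U T0.
  by move=> UT; apply: ne; apply: (irreducible_singleton Urs srs E0 irrU UT).
have UV : sub_affset U (param_closure psi).
  have [_ _ irr] := irrU.
  have [|//|//] := irr (param_closure psi) T0 (zariski_closure_closed _) exceptional_closed.
  move=> x /UZ [f [delta [W Hx]]].
  apply: (@zariski_closure_min _ _ _ (fun x => param_closure psi x \/ T0 x) _ _ _ Hx) => [|y [fy dy]].
    exact: (zariski_closedU (zariski_closure_closed _) exceptional_closed).
  by have [[s Hs]|Ty] := psi_exhausts W fy dy; [left=> p; apply; exists s | right].
have van p := param_closure_vanishing char0 p (fun x => iff_refl (param_closure psi x)).
(* [delta] is not identically zero along [psi]: a point of the witness set outside [T0] is some
   [psi(s)] with [delta] nonzero. If [p] vanishes on the witness set, then [p * delta] vanishes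
   along [psi], and hence so does [p]. *)
have VZ : sub_affset (param_closure psi) (witness_variety K alpha phi).
  have [x Hx] := not_all_ex_not _ _ nT0; have [Ux Tx] := imply_to_and _ _ Hx.
  have [f [delta [W Wx]]] := UZ x Ux.
  have [y [fy dy] nTy] : exists2 y : 'rV[F]_n, (forall (i : 'I_n) j, (0 < i)%N -> (f i j).@[y 0] = 0) /\
      delta.@[y 0] != 0 & ~ T0 y.
    apply: NNPP => H; apply: Tx; apply: (zariski_closure_min exceptional_closed _ Wx) => y Wy.
    by apply: NNPP => nTy; apply: H; exists y.
  have [[s Hs]|//] := psi_exhausts W fy dy.
  have delta0 : mpoly_at_param delta psi != 0.
    apply: contraNneq dy => /(param_vanishing char0) /(_ s y Hs) ->; exact: eqxx.
  move=> t Vt; exists f, delta; split=> // p pW; apply: (van p).1 => //.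
  have : mpoly_at_param (p * delta) psi = 0.
    apply/(param_vanishing char0) => s' y' Hs'; rewrite mevalM.
    have [->|dy'] := eqVneq delta.@[y' 0] 0; first by rewrite mulr0.
    rewrite pW ?mul0r //; split=> // i j i0.
    by have /(param_vanishing char0) := psi_vanishing j W i0; apply; exact: Hs'.
  rewrite mpoly_at_paramE rmorphM => /eqP; rewrite mulf_eq0 => /orP [/eqP //|].
  by move: delta0; rewrite mpoly_at_paramE => /negbTE ->.
move=> x; split; first exact: UV.
by apply: maxU => //; apply: param_closure_irreducible.
Qed.
End WitnessComponent.

(** Write [q = q1 + eta q2] over [k]. If [q2(alpha)] were nonzero, [q(alpha) = 0] would place [eta]
    in [k(alpha)]. So [q1] and [q2] both annihilate [alpha], and one of them is nonzero. *)
Lemma degree_over_quadratic (F : fieldType) (k : F -> Prop) alpha n eta : is_subfield k ->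
  algebraic_of_degree k alpha n -> ~ adjoin k alpha eta -> k (eta ^+ 2) ->
  algebraic_of_degree (adjoin k eta) alpha n.
Proof.
move=> Hk [[p [kp sp rp]] min] neta keta2; split.
  by exists p; split=> // i; apply: adjoin_base.
have nk : ~ k eta by move=> ke; apply: neta; apply: adjoin_base.
move=> q kq q0 rq; have Hcd i : {cd : F * F | [/\ k cd.1, k cd.2 & q`_i = cd.1 + cd.2 * eta]}.
  apply: constructive_indefinite_description.
  by have [c [d Hcd]] := adjoin_quadratic Hk nk keta2 (kq i); exists (c, d).
pose q1 := \poly_(i < size q) (sval (Hcd i)).1; pose q2 := \poly_(i < size q) (sval (Hcd i)).2.
have Dq : q = q1 + eta *: q2.
  apply/polyP => i; rewrite coefD coefZ !coef_poly; case: ltnP => [_|le].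
    by have [_ _ Ei] := svalP (Hcd i); rewrite [eta * _]mulrC.
  by rewrite nth_default // mulr0 addr0.
have k1 : poly_over k q1.
  by move=> i; rewrite coef_poly; case: ifP => _; [have [] := svalP (Hcd i) | apply: (sf0 Hk)].
have k2 : poly_over k q2.
  by move=> i; rewrite coef_poly; case: ifP => _; [have [] := svalP (Hcd i) | apply: (sf0 Hk)].
have HL := adjoin_subfield k alpha.
have Lev g : poly_over k g -> adjoin k alpha g.[alpha].
  by move=> kg; apply: (sf_horner HL); [move=> i; apply: adjoin_base | apply: adjoin_gen].
have r2 : root q2 alpha.
  apply: NNPP => /negP r2; apply: neta.
  have -> : eta = - q1.[alpha] / q2.[alpha].
    apply: (mulIf r2); rewrite divfK //; move: rq.
    by rewrite rootE Dq hornerD hornerZ addrC addr_eq0 => /eqP.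
  by apply: (sf_div HL); [apply: (sfN HL)|]; apply: Lev.
have r1 : root q1 alpha.
  by move: rq; rewrite !rootE Dq hornerD hornerZ (eqP (r2 : q2.[alpha] == 0)) mulr0 addr0.
have [E|ne] := eqVneq q2 0; last exact: leq_trans (min _ k2 ne r2) (size_poly _ _).
apply: leq_trans (min _ k1 _ r1) (size_poly _ _).
by apply: contraNneq q0 => E1; rewrite Dq E E1 scaler0 addr0.
Qed.

Lemma moebius_swap (R : comNzRingType) (a b c d x w : R) :
  a * x + b = w * (c * x + d) -> x * (- c * w + a) = d * w + - b.
Proof.
move=> E; transitivity (a * x + b - c * w * x - b); first by ring.
by rewrite E; ring.
Qed.

Lemma inverse_moebius_value (F : fieldType) (a b c d : F) (w : {fraction {poly F}}) :
  a * d - b * c != 0 -> transcendental (@cst F) w ->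
  cst a * 'X%:F + cst b = w * (cst c * 'X%:F + cst d) ->
  ratfun_value (@cst F) ((d *: 'X + (- b)%:P)%:F / ((- c) *: 'X + a%:P)%:F) w 'X%:F.
Proof.
move=> det tw E.
have lin x y : (map_poly (@cst F) (x *: 'X + y%:P)).[w] = cst x * w + cst y.
  by rewrite rmorphD /= map_polyZ map_polyX map_polyC hornerD hornerZ hornerX hornerC.
have q0 : (- c) *: 'X + a%:P != 0 :> {poly F}.
  by apply: (@linear_poly_neq0 _ d (- b)); rewrite mulrNN mulrC.
have ne := tw _ q0.
exists (d *: 'X + (- b)%:P), ((- c) *: 'X + a%:P); split; [exact: erefl | exact: ne |].
apply: (mulIf ne); rewrite (divfK ne) !lin !rmorphN.
exact: (moebius_swap E).
Qed.

Lemma scaled_avoids (F : fieldType) (w : F) (s : seq F) : (forall m, m.+1%:R != 0 :> F) -> w != 0 ->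
  exists2 m : nat, m%:R != 0 :> F & m%:R * w \notin s.
Proof.
move=> char0 w0.
have p0 : 'X * \prod_(y <- s) (w *: 'X - y%:P) != 0 :> {poly F}.
  rewrite mulf_neq0 ?polyX_eq0 // prodf_seq_neq0; apply/allP => y _ /=.
  apply/eqP => E; have /eqP := congr1 (fun p : {poly F} => p`_1) E.
  by rewrite coefB coefZ coefX coefC coef0 /= mulr1 subr0 (negbTE w0).
have [m] := poly_nat_nonroot (nat_inj_of_char0 char0) p0.
rewrite hornerM hornerX mulf_eq0 negb_or => /andP [m0 H]; exists m => //.
apply: contra H => ms; rewrite horner_prod prodf_seq_eq0; apply/hasP; exists (m%:R * w) => //=.
by rewrite hornerD hornerN hornerZ hornerX hornerC mulrC subrr.
Qed.

(** [eta0] is the coordinate of the point of the conic and [eta] generates a field containing it;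
    keeping them apart lets one point serve all multiples of [eta0]. The linear fraction of the
    hypercircle is the inverse of the one giving [w] in terms of [X], hence its coefficients [d1],
    [-b1], [-c1], [a1]. *)
Lemma hypercircle_of_conic (F : closedFieldType) (k : F -> Prop) (alpha : F) (n N : nat)
    (C : affset F N) (phi : 'I_N -> {fraction {poly F}}) (P Q : {mpoly F[N]})
    (f' g0 g1 g2 : {fraction {poly F}}) (b c d s eta0 eta : F) (U : affset F n) :
  (forall m, m.+1%:R != 0 :> F) -> is_subfield k ->
  algebraic_of_degree (adjoin k eta) alpha n ->
  defined_over k C -> eq_affset C (param_closure phi) ->
  (forall j, ratfun_over (adjoin k alpha) (phi j)) ->
  mpoly_at_param Q phi != 0 -> mpoly_at_param P phi / mpoly_at_param Q phi = 'X%:F ->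
  f' != 0 -> frame (@cst F) (param_field k phi) f' (f' * 'X%:F) g0 g1 g2 -> k s ->
  g0 ^+ 2 = cst b * g1 ^+ 2 + 2%:R * (cst c * (g1 * g2)) + cst d * g2 ^+ 2 ->
  eta0 != 0 -> eta0 ^+ 2 = b + 2%:R * (c * s) + d * s ^+ 2 -> adjoin k eta eta0 ->
  irreducible_component (witness_variety k alpha phi) U -> krull_dim_ge U 1 ->
  hypercircle (adjoin k eta) alpha U.
Proof.
move=> char0 Hk Da C_over C_phi phi_over Q0 PQ f0 Fg ks Eg eta0n Eeta keta Ucomp Udim.
have Hk' := @adjoin_subfield _ k eta; have kk' x : k x -> adjoin k eta x by apply: adjoin_base.
have [a1 [b1 [c1 [d1 [[La Lb Lc Ld] det Ew]]]]] :=
  reparam_moebius char0 Hk' kk' phi_over f0 Fg ks keta eta0n Eg Eeta.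
have Hr := phi_reparam char0 Hk' kk' C_over C_phi f0 Fg ks keta eta0n Eg Eeta.
have tw := transcendental_nonconst (reparam_nonconst Fg (s := s) (eta := eta0)).
move: (_ / _) tw Ew Hr => w tw Ew Hr.
have Hr' j : {r | ratfun_over (adjoin k eta) r /\ ratfun_value (@cst F) r w (phi j)}.
  exact/constructive_indefinite_description/Hr.
have det' : d1 * a1 - (- b1) * (- c1) != 0 by rewrite mulrNN mulrC.
have HL := @adjoin_subfield _ (adjoin k eta) alpha.
have Hm := inverse_moebius_value det tw Ew.
have phi_over' j : ratfun_over (adjoin (adjoin k eta) alpha) (phi j) := phi_over' kk' phi_over j.
have tm := transcendental_moebius det' (moebius_eq det').
have r_val j := rv_compose tw tm (proj2 (svalP (Hr' j))) Hm.
have [psi [psi_over Dpsi van [rs [E [Urs srs E0 ex]]]]] := witness_curve char0 Hk' Da phi_over' Q0 PQ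
  Ld (sfN HL Lb) (sfN HL Lc) La det' (fun j => proj1 (svalP (Hr' j))) r_val.
have wit f delta : witness_data k alpha phi f delta ->
    witness_identities (adjoin k eta) alpha phi f delta.
  by case=> -[kf kd] d0 _ H; split=> // [i j m'|m']; apply: adjoin_base; [exact: kf | exact: kd].
split=> //; exists d1, (- b1), (- c1), a1, psi; split=> //; first by split=> //; apply: (sfN HL).
apply: (witness_component char0 Urs srs E0 _ _ Ucomp Udim).
  by move=> f delta i j /wit; apply: van.
by move=> f delta x /wit; apply: ex.
Qed.

Theorem theorem3p9
  (F : closedFieldType) (u : nat)
  (iota : {rmorphism {fraction {mpoly rat[u]}} -> F})
  (beta : F) (beta_alg : algebraicOver iota beta)
  (K : F -> Prop)
  (K_def : forall x, K x <-> adjoin (fun z => exists r, z = iota r) beta x)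
  (F_alg : forall z : F, algebraic_over K z)
  (n : nat) (alpha : F) (alpha_deg : algebraic_of_degree K alpha n)
  (N : nat) (C : affset F N) (C_curve : is_curve C)
  (C_over_K : defined_over K C)
  (C_not_param : ~ parametrizable K C)
  (phi : 'I_N -> {fraction {poly F}})
  (phi_over : forall j, ratfun_over (adjoin K alpha) (phi j))
  (phi_birat : birational_param (fun _ => True) C phi)
  (U : affset F n)
  (U_comp : irreducible_component (witness_variety K alpha phi) U)
  (U_dim : krull_dim U 1) :
  forall s : seq F, exists eta : F,
    [/\ eta \notin s, algebraic_of_degree K eta 2
      & hypercircle (adjoin K eta) alpha U].
Proof.
move=> s0; have char0 := base_char0 iota; have HK := base_subfield K_def.
have HL := @adjoin_subfield _ K alpha.
case: phi_birat => C_phi [P [Q [_ Q0 PQ _]]].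
have [f' [g0 [g1 [g2 [b [c [d [f0 Fg [kb kc kd] disc Eg]]]]]]]] :=
  conic_model char0 HK alpha_deg C_over_K C_phi phi_over Q0 PQ.
have [s ks nsq] := nonsquare_value beta_alg K_def alpha_deg kb kc kd disc.
set e := b + 2%:R * (c * s) + d * s ^+ 2 in nsq.
have ke : K e.
  have kM x y : K x -> K y -> K (x * y) by apply: (sfM HK).
  apply: (sfD HK); first apply: (sfD HK) => //; apply: (kM); [exact: (sf_nat HK)|exact: kM|by []|exact: (sfX HK)].
have [w Ew] : exists w : F, w ^+ 2 = e.
  have [w] := @solve_monicpoly F 2 (fun i => if i == 0%N then e else 0) isT.
  by rewrite !big_ord_recl big_ord0 /= mulr1 mul0r !addr0; exists w.
have nLw : ~ adjoin K alpha w by move=> /nsq; rewrite Ew.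
have w0 : w != 0 by apply/eqP => E; apply: nLw; rewrite E; apply: (sf0 HL).
(* [m w] generates the same quadratic extension as [w], so the multiple changes [eta] but neither
   the conic nor its point. *)
have [m m0 ms] := scaled_avoids s0 char0 w0.
have nLm : ~ adjoin K alpha (m%:R * w).
  by move=> Lm; apply: nLw; rewrite -[w](mulKf m0) mulrC; apply: (sf_div HL) => //; apply: (sf_nat HL).
have Km2 : K ((m%:R * w) ^+ 2).
  by rewrite exprMn Ew; apply: (sfM HK) => //; apply: (sfX HK); apply: (sf_nat HK).
exists (m%:R * w); split=> //.
  by apply: quadratic_degree => // Km; apply: nLm; apply: adjoin_base.
apply: (hypercircle_of_conic (eta0 := w) char0 HK _ C_over_K C_phi phi_over Q0 PQ f0 Fg ks Eg) => //.
- exact: degree_over_quadratic.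
- have HK' := @adjoin_subfield _ K (m%:R * w).
  have Dw : m%:R * w / m%:R = w by rewrite mulrC mulKf.
  rewrite -[X in adjoin _ _ X]Dw.
  by apply: (sf_div HK'); [apply: adjoin_gen | apply: (sf_nat HK')].
by case: U_dim.
Qed.
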